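(* Let $\tau = e^{2\pi i/3}$. There is an algorithm which, given $(m,n)\in\mathbb{Z}^2$ and $t=m+n\tau\in\mathbb{Z}(\tau)$, outputs an element $s\in\{1,\infty\}$ and a finite sequence $i_1,\dots,i_k$ of elements of $\{1,\tau,\tau^2,\infty\}$ such that the elliptic pencil $\mathcal{F}_{m+n\tau}$ is obtained from the elliptic pencil of cubics $\mathcal{F}_s$, where $$\mathcal{F}_1:\ c_1 (y-x)(z-x)(y-z)+c_2 (y-\tau x)(z-\tau^2 x)(z-\tau y)=0,$$ $$\mathcal{F}_\infty:\ c_1 (y-x)(y-\tau x)(y-\tau^2 x)+c_2 (y-z)(y-\tau z)(y-\tau^2 z)=0,\qquad (c_1:c_2)\in\mathbb{P}^1_{\mathbb{C}},$$ by successively taking strict transforms under the quadratic Cremona maps $Q_{i_1},Q_{i_2},\dots,Q_{i_k}$ (in this order), where $$Q_1(x:y:z)=(y^2-xz:x^2-yz:z^2-xy),$$ $$Q_\tau(x:y:z)=(\tau y^2-xz:\tau x^2-yz:z^2-\tau^2xy),$$ $$Q_{\tau^2}(x:y:z)=(\tau^2y^2-xz:\tau^2x^2-yz:z^2-\tau xy),$$ $$Q_\infty(x:y:z)=(yz:xz:xy).$$ By means of these transformations the algorithm also determines the degree of the generic element of the elliptic pencil $\mathcal{F}_{m+n\tau}$, the positions and multiplicities of the singularities of this generic element, and explicit homogeneous polynomials generating the pencil, that is, a rational first integral of the foliation $\mathcal{F}_{m+n\tau}$.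
   Context: Work on $\mathbb{P}^2=\mathbb{P}^2_{\mathbb{C}}$ with homogeneous coordinates $(x:y:z)$. Lins Neto's family of degree four foliations is $$\mathcal{F}_t:\ \Omega+t\,\Xi=0,\quad t\in\overline{\mathbb{C}}=\mathbb{C}\cup\{\infty\}\quad(\mathcal{F}_\infty:\ \Xi=0),$$ $$\Omega=yz(y^3-z^3)\,dx-xz(x^3-z^3)\,dy+xy(x^3-y^3)\,dz,$$ $$\Xi=-x^2(y^3-z^3)\,dx+y^2(x^3-z^3)\,dy-z^2(x^3-y^3)\,dz.$$ A foliation is (given by) the pencil $c_1F+c_2G=0$ ($F,G$ homogeneous of the same degree, without common factor, generic element irreducible) if $F\,dG-G\,dF$ equals a polynomial times the $1$-form defining the foliation; then $F/G$ is a rational first integral and $F,G$ are generators of the pencil. The pencil is elliptic if its generic element is an irreducible curve of geometric genus one. The pencils $\mathcal{F}_1$ and $\mathcal{F}_\infty$ displayed in the claim are the members $t=1$ and $t=\infty$ of the family. The strict transform of a foliation $\omega=0$ under a (birational) map $Q_i$ is the foliation with finite singular set obtained from $Q_i^*\omega$ by dividing by the common factors of its coefficients; the strict transform of a pencil $c_1F+c_2G=0$ is the pencil obtained from $F\circ Q_i$, $G\circ Q_i$ after removing their common factors. Each $Q_i$ is an involution as a birational map. The sequence $i_1,\dots,i_k$ may be empty ($k=0$). *)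

(* Defs.v *)
(* trigo is only required, not imported: the notations of its dependencies
   clash with those of mpoly. *)
From HB Require Import structures.
From mathcomp Require Import all_boot all_order all_algebra.
From mathcomp Require Import complex mpoly reals.
From mathcomp Require trigo.

Set Implicit Arguments.
Unset Strict Implicit.
Unset Printing Implicit Defensive.

Import Order.TTheory GRing.Theory Num.Theory.
Local Open Scope ring_scope.

Section Polynomials.
Variable K : fieldType.
Implicit Types (A B F G H : {mpoly K[3]}) (p q : 'rV[K]_3).

Definition vx : {mpoly K[3]} := 'X_(@Ordinal 3 0 isT).
Definition vy : {mpoly K[3]} := 'X_(@Ordinal 3 1 isT).
Definition vz : {mpoly K[3]} := 'X_(@Ordinal 3 2 isT).

Definition divides A B := exists C : {mpoly K[3]}, B = C * A.

Definition irreducible H :=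
  [/\ H != 0, H \isn't a GRing.unit &
      forall A B, H = A * B -> A \is a GRing.unit \/ B \is a GRing.unit].

Definition no_common_factor (I : Type) (f : I -> {mpoly K[3]}) :=
  forall A, (forall i, divides A (f i)) -> A \is a GRing.unit.

(* p and q are homogeneous coordinates of the same point of P^2. *)
Definition same_point p q := exists2 c : K, c != 0 & p = c *: q.

(* In characteristic 0 this is the multiplicity at p of the plane curve H = 0:
   the order at p of the homogeneous polynomial H on the affine cone equals
   that of its dehomogenizations. *)
Definition multiplicity H p (r : nat) :=
  (forall m : 'X_{1..3}, (mdeg m < r)%N -> (mderivm m H).@[p 0] = 0) /\
  (exists m : 'X_{1..3}, mdeg m = r /\ (mderivm m H).@[p 0] != 0).

End Polynomials.

(* L is a finitely generated extension, along iota, of an algebraically closed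
   field K of characteristic 0, of transcendence degree 1.  The points of its
   smooth projective model are the valuation rings of L / K. *)
Section FunctionField.
Variables (K L : fieldType) (iota : {rmorphism K -> L}).

Definition valuation_ring (O : L -> Prop) :=
  [/\ forall c, O (iota c),
      forall a b, O a -> O b -> O (a - b),
      forall a b, O a -> O b -> O (a * b),
      forall a, O a \/ O a^-1
    & exists a, ~ O a].

Definition derivation (D : L -> L) :=
  [/\ forall c, D (iota c) = 0,
      forall a b, D (a + b) = D a + D b
    & forall a b, D (a * b) = a * D b + D a * b].

(* [:: (a1, b1); ...; (an, bn)] stands for the Kaehler differential
   a1 d(b1) + ... + an d(bn); as L / K is separable, two differentials are
   equal iff they agree on all K-derivations of L. *)
Definition differential := seq (L * L).

Definition deval (w : differential) (D : L -> L) : L :=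
  \sum_(u <- w) u.1 * D u.2.

Definition regular_at (O : L -> Prop) (w : differential) :=
  exists w' : differential,
    (forall u, u \in w' -> O u.1 /\ O u.2) /\
    (forall D, derivation D -> deval w D = deval w' D).

Definition regular (w : differential) :=
  forall O, valuation_ring O -> regular_at O w.

(* The K-vector space of everywhere regular differentials has a basis of
   g elements. *)
Definition function_field_genus (g : nat) :=
  exists e : g.-tuple differential,
    (forall i, regular (tnth e i)) /\
    (forall w, regular w ->
       exists! c : {ffun 'I_g -> K}, forall D, derivation D ->
         deval w D = \sum_i iota (c i) * deval (tnth e i) D).

End FunctionField.

Section PlaneCurve.
Variable K : fieldType.

(* L, with the generic point xi, is the function field of the irreducible
   curve H = 0, i.e. the degree 0 part of the homogeneous field of fractions
   of K[x, y, z] / (H).  It is determined by H up to isomorphism. *)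
Definition is_function_field (H : {mpoly K[3]}) (L : fieldType)
    (iota : {rmorphism K -> L}) (xi : 'I_3 -> L) :=
  [/\ exists i, xi i != 0,
      forall (d : nat) (A : {mpoly K[3]}), A \is d.-homog ->
        (mmap iota xi A = 0 <-> divides H A)
    & forall f : L, exists (d : nat) (A B : {mpoly K[3]}),
        [/\ A \is d.-homog, B \is d.-homog, mmap iota xi B != 0
          & f = mmap iota xi A / mmap iota xi B]].

Definition geometric_genus (H : {mpoly K[3]}) (g : nat) :=
  exists (L : fieldType) (iota : {rmorphism K -> L}) (xi : 'I_3 -> L),
    is_function_field H iota xi /\ function_field_genus iota g.

End PlaneCurve.

Section Foliations.
Variable K : fieldType.

(* [tuple A; B; C] is the 1-form A dx + B dy + C dz. *)
Definition one_form := 3.-tuple {mpoly K[3]}.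

Definition rational_map := 3.-tuple {mpoly K[3]}.

Definition pencil := ({mpoly K[3]} * {mpoly K[3]})%type.

Definition gen (P : pencil) (b : bool) : {mpoly K[3]} := if b then P.1 else P.2.

(* The element c1 F + c2 G of the pencil satisfies S for all (c1 : c2) in P^1
   outside a finite set E; E must not contain (0, 0), which would exclude
   every (c1 : c2). *)
Definition for_generic_element (P : pencil) (S : {mpoly K[3]} -> Prop) :=
  exists2 E : seq (K * K), (0, 0) \notin E &
    forall c1 c2 : K, (c1, c2) != (0, 0) ->
      (forall e, e \in E -> c1 * e.2 != c2 * e.1) ->
      S (c1 *: P.1 + c2 *: P.2).

Definition is_pencil_of (w : one_form) (P : pencil) :=
  [/\ exists d : nat, P.1 \is d.-homog /\ P.2 \is d.-homog,
      no_common_factor (gen P),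
      for_generic_element P (@irreducible K)
    & exists h : {mpoly K[3]}, forall i : 'I_3,
        P.1 * mderiv i P.2 - P.2 * mderiv i P.1 = h * tnth w i].

Definition elliptic (P : pencil) :=
  for_generic_element P (fun H => irreducible H /\ geometric_genus H 1).

Definition generic_degree (P : pencil) (d : nat) :=
  for_generic_element P (fun H => H != 0 /\ H \is d.-homog).

(* s lists, without repetition, the singular points of the generic element
   together with their multiplicities. *)
Definition generic_singularities (P : pencil) (s : seq ('rV[K]_3 * nat)) :=
  [/\ forall u, u \in s -> u.1 != 0,
      forall i j u, (i < j < size s)%N ->
        ~ same_point (nth u s i).1 (nth u s j).1
    & for_generic_element P (fun H =>
        forall (p : 'rV[K]_3) (r : nat), p != 0 -> (1 < r)%N ->
          (multiplicity H p r <->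
           exists q, (q, r) \in s /\ same_point p q))].

Definition pullback_form (Q : rational_map) (w : one_form) (i : 'I_3) :
    {mpoly K[3]} :=
  \sum_(j < 3) (tnth w j \mPo Q) * mderiv i (tnth Q j).

(* A singular set in P^2 is finite iff the coefficients of the form have no
   common factor.  w' is determined up to a nonzero constant factor. *)
Definition strict_transform_form (Q : rational_map) (w w' : one_form) :=
  no_common_factor (tnth w') /\
  (exists2 h : {mpoly K[3]}, h != 0 &
     forall i, pullback_form Q w i = h * tnth w' i).

Definition strict_transform_pencil (Q : rational_map) (P P' : pencil) :=
  no_common_factor (gen P') /\
  (exists2 h : {mpoly K[3]}, h != 0 &
     forall b, gen P b \mPo Q = h * gen P' b).

Fixpoint successive (I X : Type) (step : I -> X -> X -> Prop)
    (x : X) (l : seq I) (y : X) : Prop :=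
  if l is i :: l' then exists2 x', step i x x' & successive step x' l' y
  else x = y.

End Foliations.

Inductive start := Start1 | StartInf.
Inductive cremona_index := Idx1 | IdxTau | IdxTau2 | IdxInf.

Definition tau (R : realType) : R[i] :=
  (trigo.cos (2 * trigo.pi / 3) +i* trigo.sin (2 * trigo.pi / 3))%C.

Section LinsNeto.
Variable K : fieldType.
Local Notation x := (vx K).
Local Notation y := (vy K).
Local Notation z := (vz K).

Definition Omega : one_form K :=
  [tuple y * z * (y ^+ 3 - z ^+ 3);
         - (x * z * (x ^+ 3 - z ^+ 3));
         x * y * (x ^+ 3 - y ^+ 3)].

Definition Xi : one_form K :=
  [tuple - (x ^+ 2 * (y ^+ 3 - z ^+ 3));
         y ^+ 2 * (x ^+ 3 - z ^+ 3);
         - (z ^+ 2 * (x ^+ 3 - y ^+ 3))].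

(* None is t = infinity. *)
Definition lins_neto (t : option K) : one_form K :=
  if t is Some t then [tuple tnth Omega i + t *: tnth Xi i | i < 3] else Xi.

Definition start_param (s : start) : option K :=
  if s is Start1 then Some 1 else None.

Variable tau : K.

Definition start_pencil (s : start) : pencil K :=
  match s with
  | Start1 => ((y - x) * (z - x) * (y - z),
               (y - tau *: x) * (z - tau ^+ 2 *: x) * (z - tau *: y))
  | StartInf => ((y - x) * (y - tau *: x) * (y - tau ^+ 2 *: x),
                 (y - z) * (y - tau *: z) * (y - tau ^+ 2 *: z))
  end.

Definition cremona (i : cremona_index) : rational_map K :=
  match i with
  | Idx1 => [tuple y ^+ 2 - x * z; x ^+ 2 - y * z; z ^+ 2 - x * y]
  | IdxTau => [tuple tau *: y ^+ 2 - x * z; tau *: x ^+ 2 - y * z;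
                     z ^+ 2 - tau ^+ 2 *: (x * y)]
  | IdxTau2 => [tuple tau ^+ 2 *: y ^+ 2 - x * z; tau ^+ 2 *: x ^+ 2 - y * z;
                      z ^+ 2 - tau *: (x * y)]
  | IdxInf => [tuple y * z; x * z; x * y]
  end.

(* Finite data denoting elements of Z[tau], points of P^2 with coordinates in
   Z[tau], and polynomials with coefficients in Z[tau]. *)
Definition eisenstein := (int * int)%type.
Definition point_code := (eisenstein * eisenstein * eisenstein)%type.
Definition poly_code := seq (eisenstein * (nat * nat * nat)).

Definition eis_val (a : eisenstein) : K := a.1%:~R + a.2%:~R * tau.

Definition point_val (p : point_code) : 'rV[K]_3 :=
  \row_i tnth [tuple eis_val p.1.1; eis_val p.1.2; eis_val p.2] i.

Definition poly_val (P : poly_code) : {mpoly K[3]} :=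
  \sum_(u <- P)
    eis_val u.1 *: (x ^+ u.2.1.1 * y ^+ u.2.1.2 * z ^+ u.2.2).

Definition sing_val (s : seq (point_code * nat)) : seq ('rV[K]_3 * nat) :=
  [seq (point_val u.1, u.2) | u <- s].

End LinsNeto.

(* Kleene's total recursive functions, stated directly on the data types
   generated by booleans, natural numbers, integers, the indices above, pairs
   and finite sequences: closure under composition, primitive recursion and
   minimization of total functions.  No clause applies a value of function
   type, so quantifying over all types adds no function between data types. *)
Inductive computable : forall A B : Type, (A -> B) -> Prop :=
| CompExt A B (f g : A -> B) : f =1 g -> computable f -> computable g
| CompId A : computable (fun a : A => a)
| CompComp A B C (f : A -> B) (g : B -> C) :
    computable f -> computable g -> computable (fun a => g (f a))
| CompPair A B C (f : A -> B) (g : A -> C) :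
    computable f -> computable g -> computable (fun a => (f a, g a))
| CompFst A B : computable (fun p : A * B => p.1)
| CompSnd A B : computable (fun p : A * B => p.2)
| CompConst A B (b : B) : computable (fun _ : A => b)
| CompIf A B (b : A -> bool) (f g : A -> B) :
    computable b -> computable f -> computable g ->
    computable (fun a => if b a then f a else g a)
| CompIndex A B (f : cremona_index -> A -> B) :
    (forall i, computable (f i)) ->
    computable (fun p : cremona_index * A => f p.1 p.2)
| CompSucc : computable succn
| CompNatRec A B (f : A -> B) (g : A * nat * B -> B) :
    computable f -> computable g ->
    computable (fun p : A * nat =>
      nat_rect (fun _ => B) (f p.1) (fun k b => g (p.1, k, b)) p.2)
| CompPosz : computable Posz
| CompNegz : computable Negz
| CompIntCase A B (f g : A * nat -> B) :
    computable f -> computable g ->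
    computable (fun p : A * int =>
      match p.2 with Posz k => f (p.1, k) | Negz k => g (p.1, k) end)
| CompCons A : computable (fun p : A * seq A => p.1 :: p.2)
| CompSeqRec A B T (f : A -> B) (g : A * T * seq T * B -> B) :
    computable f -> computable g ->
    computable (fun p : A * seq T =>
      list_rect (fun _ => B) (f p.1) (fun u s b => g (p.1, u, s, b)) p.2)
| CompMin A (f : A * nat -> bool) (f_ex : forall a, exists k, f (a, k)) :
    computable f -> computable (fun a => ex_minn (f_ex a)).

(* The start s, the indices i_1, ..., i_k, the degree of the generic element,
   its singular points with their multiplicities, and two generators. *)
Definition output :=
  (start * seq cremona_index * nat * seq (point_code * nat) *
   poly_code * poly_code)%type.

(* Main.v *)
(* Write w_t = Omega + t Xi.  For s = 1, tau, tau^2 the map Q_s pulls w_t back to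
   a multiple of w_{-t-s}, and Q_oo pulls Xi back to a multiple of Omega.  Hence
   Q_s followed by Q_s' translates t by s - s'; as 3 = (1 - tau) + (1 - tau^2),
   every t in Z[tau] is reached by such maps from t = 1 or from t = 0, the image
   of oo under Q_oo.

   The pencils are followed through the twelve base points of the pencils F_1 and
   F_oo, which form four classes of three.  Up to linear maps, each Q_i is the
   standard quadratic map based at the class of i, and it permutes the other
   three classes.  If a pencil of degree d has multiplicity m_j at the points of
   class j, its transform has degree 2d - 3 m_i, multiplicity d - 2 m_i at class
   i, and the permuted multiplicities elsewhere.  The step preserves a property
   of the pencil (the record good below) which says that blowing up the twelve
   points removes all base points and singularities of the generic element: at
   each point the leading forms of the generators have no common zero, and there
   are no other base points or singular points.  The genus is followed through
   the function field, which for F_oo is that of y^2 z = x^3 - z^3; its regular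
   differentials are the multiples of du / 2v because the dual derivation
   preserves every valuation ring. *)

Require Import Defs.
From HB Require Import structures.
From mathcomp Require Import all_boot all_order all_algebra.
From mathcomp Require Import complex mpoly reals boolp ring zify fraction generic_quotient.

Set Implicit Arguments.
Unset Strict Implicit.
Unset Printing Implicit Defensive.

Import Order.TTheory GRing.Theory Num.Theory.
Local Open Scope ring_scope.

(** * Polynomials in three variables *)

Section PolynomialRing.
Variables (n : nat) (K : fieldType).
Implicit Types (A B C : {mpoly K[n]}).

(** The three lines contracted in one plane are the exceptional curves of the other, so a quadratic
    step must control infinitely near points. This is what the tangent clause of [good] is for: a
    common zero of the leading forms at a vertex would become a base point on the opposite line.
    Conversely, the absence of base points on a line yields the tangent clause at the new vertex,
    the inequality [2 * m <= d] that keeps natural subtraction from truncating, and, through a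
    Wronskian on the line, generic smoothness along it. The genus is computed for a single field,
    directly with valuation rings: the transformed curve has the same function field with another
    generic point. Irreducibility of the generic element is a consequence of the existence of its
    function field. Facts about particular points, matrices and forms are stated over Z[tau], where
    equality of codes is decidable, and are settled by evaluation; the geometric argument is then
    made once, for the standard map. *)

Lemma mpoly_ring_ind (P : {mpoly K[n]} -> Prop) :
  (forall c, P c%:MP) -> (forall i, P 'X_i) ->
  (forall A B, P A -> P B -> P (A + B)) ->
  (forall A B, P A -> P B -> P (A * B)) ->
  forall A, P A.
Proof.
move=> PC PX PD PM; apply: mpolyind => [|c m A _ _ PA].
  by rewrite -(mpolyC0 n K); apply: PC.
apply: PD => //; rewrite -mul_mpolyC; apply: (PM) => //.
rewrite mpolyXE_id; apply: (big_ind P) => // [|i _].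
  by rewrite -mpolyC1; apply: PC.
elim: (m i) => [|k IHk]; first by rewrite expr0 -mpolyC1; apply: PC.
by rewrite exprS; apply: PM.
Qed.

Lemma mmap_comp (k : nat) (S : comNzRingType) (f : {rmorphism K -> S})
    (u : 'I_k -> S) (Q : n.-tuple {mpoly K[k]}) A :
  mmap f u (A \mPo Q) = mmap f (fun i => mmap f u (tnth Q i)) A.
Proof.
elim/mpoly_ring_ind: A => [c|i|A B IA IB|A B IA IB].
- by rewrite comp_mpolyC !mmapC.
- by rewrite comp_mpolyXU -tnth_nth mmapX mmap1U.
- by rewrite comp_mpolyD !mmapD IA IB.
- by rewrite !rmorphM /= IA IB.
Qed.

Lemma mmap_eq (S : comNzRingType) (f : {rmorphism K -> S}) (u v : 'I_n -> S) A :
  u =1 v -> mmap f u A = mmap f v A.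
Proof.
move=> e; rewrite /mmap; apply: eq_bigr => m _.
by congr (_ * _); rewrite /mmap1; apply: eq_bigr => i _; rewrite e.
Qed.

Lemma mmap_scale (S : comNzRingType) (f : {rmorphism K -> S}) (u : 'I_n -> S)
    (c : S) (d : nat) A :
  A \is d.-homog -> mmap f (fun i => c * u i) A = c ^+ d * mmap f u A.
Proof.
move=> hA; rewrite /mmap mulr_sumr; apply: eq_big_seq => m mA.
rewrite mulrCA; congr (_ * _); rewrite /mmap1 -(dhomog_mf hA mA) /= mdegE.
rewrite -prodrXr -big_split /=; apply: eq_bigr => i _.
by rewrite exprMn.
Qed.

Lemma dhomog_comp (k d e : nat) (Q : n.-tuple {mpoly K[k]}) A :
  A \is d.-homog -> (forall i, tnth Q i \is e.-homog) ->
  A \mPo Q \is (d * e).-homog.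
Proof.
move=> hA hQ; rewrite comp_mpolyEX big_seq; apply: rpred_sum => m mA.
apply: rpredZ; rewrite comp_mpolyX -(dhomog_mf hA mA) /= mdegE big_distrl /=.
elim/big_ind2: _ => [|x a y b hx hy|i _]; [exact: dhomog1|exact: dhomogM|].
by rewrite mulnC; apply: dhomogMn.
Qed.

Lemma mderiv_var (i j : 'I_n) : mderiv i ('X_j : {mpoly K[n]}) = (i == j)%:R.
Proof.
rewrite mderivX mnm1E eq_sym; case: eqVneq => [->|_]; last by rewrite scale0r.
rewrite scale1r (_ : (U_(j) - U_(j))%MM = 0%MM) ?mpolyX0 //.
by apply/mnmP => l; rewrite mnmBE subnn mnm0E.
Qed.

Lemma mderiv_comp (k : nat) (Q : n.-tuple {mpoly K[k]}) A i :
  mderiv i (A \mPo Q) =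
    \sum_(j < n) (mderiv j A \mPo Q) * mderiv i (tnth Q j).
Proof.
elim/mpoly_ring_ind: A => [c|j|A B IA IB|A B IA IB].
- rewrite comp_mpolyC mderivC big1 // => j _.
  by rewrite mderivC comp_mpoly0 mul0r.
- rewrite comp_mpolyXU -tnth_nth (bigD1 j) //= big1 => [|l lj].
    by rewrite addr0 mderiv_var eqxx comp_mpoly1 mul1r.
  by rewrite mderiv_var (negPf lj) comp_mpoly0 mul0r.
- rewrite comp_mpolyD mderivD IA IB -big_split /=; apply: eq_bigr => j _.
  by rewrite mderivD comp_mpolyD mulrDl.
- rewrite rmorphM /= mderivM IA IB mulr_suml mulr_sumr -big_split /=.
  apply: eq_bigr => j _; rewrite mderivM rmorphD !rmorphM /=; ring.
Qed.

Lemma euler (d : nat) A :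
  A \is d.-homog -> \sum_(i < n) 'X_i * mderiv i A = d%:R *: A.
Proof.
move=> hA; rewrite [in RHS](mpolyE A) scaler_sumr.
under eq_bigr => i _ do rewrite {1}(mpolyE A) raddf_sum mulr_sumr /=.
rewrite exchange_big /=; apply: eq_big_seq => m mA.
rewrite -(dhomog_mf hA mA) /= mdegE raddf_sum /= scaler_suml.
apply: eq_bigr => i _; rewrite mderivZ mderivX -!scalerAr.
have [m0|m0] := posnP (m i); first by rewrite m0 !scale0r scaler0.
by rewrite scalerA mulrC -scalerA -mpolyXD addmC submK // lep1mP -lt0n.
Qed.

End PolynomialRing.

Section PrimePolynomials.
Variable K : fieldType.
Implicit Types (A B C D H : {mpoly K[3]}) (l : {mpoly K[3]}).

Definition prime_polynomial l :=
  [/\ l != 0, l \isn't a GRing.unit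
    & forall A B, divides l (A * B) -> divides l A \/ divides l B].

Lemma divides_refl A : divides A A.
Proof. by exists 1; rewrite mul1r. Qed.

Lemma divides_mull A B C : divides A B -> divides A (C * B).
Proof. by case=> D ->; exists (C * D); rewrite mulrA. Qed.

Lemma divides_mulr A B C : divides A B -> divides A (B * C).
Proof. by rewrite mulrC; apply: divides_mull. Qed.

Lemma divides_trans A B C : divides A B -> divides B C -> divides A C.
Proof. by move=> AB [D ->]; apply: divides_mull. Qed.

Lemma dividesD A B C : divides A B -> divides A C -> divides A (B + C).
Proof. by move=> [D ->] [E ->]; exists (D + E); rewrite mulrDl. Qed.

Lemma dividesZ A B (c : K) : divides A B -> divides A (c *: B).
Proof. by move=> [D ->]; exists (c *: D); rewrite scalerAl. Qed.

Lemma divides0 A : divides A 0.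
Proof. by exists 0; rewrite mul0r. Qed.

Lemma divides_unit A B : divides A B -> B \is a GRing.unit -> A \is a GRing.unit.
Proof. by case=> C ->; rewrite unitrM => /andP[]. Qed.

(** Congruences modulo [l] between the variables and the entries of [Q] pass to all polynomials,
    being compatible with sums and products. *)
Lemma divides_sub_comp l (Q : 3.-tuple {mpoly K[3]}) A :
  (forall i, divides l ('X_i - tnth Q i)) -> divides l (A - (A \mPo Q)).
Proof.
move=> lQ; elim/mpoly_ring_ind: A => [c|i|A B IA IB|A B IA IB].
- by rewrite comp_mpolyC subrr; apply: divides0.
- by rewrite comp_mpolyXU -tnth_nth; apply: lQ.
- by rewrite comp_mpolyD opprD addrACA; apply: dividesD.
- rewrite rmorphM /= (_ : _ - _ = A * (B - (B \mPo Q)) +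
    (A - (A \mPo Q)) * (B \mPo Q)); last by ring.
  by apply: dividesD; [apply: divides_mull|apply: divides_mulr].
Qed.

Definition linear_form (a : 'I_3 -> K) : {mpoly K[3]} := \sum_i a i *: 'X_i.

Lemma linear_form_coef a i : (linear_form a)@_U_(i) = a i.
Proof.
rewrite /linear_form raddf_sum (bigD1 i) //= big1 => [|j ji].
  by rewrite addr0 mcoeffZ mcoeffX eqxx mulr1.
by rewrite mcoeffZ mcoeffXU (negPf ji) mulr0.
Qed.

Lemma unit_mcoeffU A i : A \is a GRing.unit -> A@_U_(i) = 0.
Proof.
rewrite unfold_in /= => /andP[/eqP-> _].
by rewrite mcoeffC (_ : _ == _ = false) ?mulr0 // -mdeg_eq0 mdeg1.
Qed.

Lemma linear_form_homog a : linear_form a \is 1.-homog.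
Proof.
apply: rpred_sum => i _; apply: rpredZ.
by rewrite dhomogX /= mdeg1.
Qed.

(* Divisibility by the form is detected by eliminating one variable, a
   substitution with values in an integral domain. *)
Lemma linear_form_prime a j : a j != 0 -> prime_polynomial (linear_form a).
Proof.
move=> aj0; set l := linear_form a.
have l0 : l != 0.
  by apply: contraNneq aj0 => l0; rewrite -(linear_form_coef a j) -/l l0 mcoeff0.
pose Q := [tuple 'X_i - ((i == j)%:R / a j) *: l | i < 3].
have Ql : l \mPo Q = 0.
  rewrite {1}/l raddf_sum /=.
  under eq_bigr => i _.
    rewrite comp_mpolyZ comp_mpolyXU -tnth_nth tnth_mktuple scalerBr scalerA.
    over.
  rewrite sumrB -scaler_suml -/(linear_form a) -/l (bigD1 j) //= big1 => [|i ij].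
    by rewrite eqxx mul1r divff // addr0 scale1r subrr.
  by rewrite (negPf ij) mul0r mulr0.
have div_iff A : divides l A <-> (A \mPo Q) = 0.
  split=> [[B ->]|A0]; first by rewrite rmorphM /= Ql mulr0.
  rewrite -[A]subr0 -A0; apply: divides_sub_comp => i.
  rewrite tnth_mktuple opprB addrC subrK -mul_mpolyC.
  by apply/divides_mull/divides_refl.
split=> // [|A B /div_iff].
  by apply/negP => /(unit_mcoeffU j); rewrite linear_form_coef; apply/eqP.
rewrite rmorphM /= => /eqP; rewrite mulf_eq0 => /orP[]/eqP/div_iff; tauto.
Qed.

Lemma varE i : 'X_i = linear_form (fun j => (j == i)%:R).
Proof.
rewrite /linear_form (bigD1 i) //= eqxx scale1r big1 ?addr0 // => j ji.
by rewrite (negPf ji) scale0r.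
Qed.

Lemma var_prime i : prime_polynomial ('X_i : {mpoly K[3]}).
Proof. by rewrite varE; apply: (@linear_form_prime _ i); rewrite eqxx oner_neq0. Qed.

Lemma divides_strip l A B D :
  prime_polynomial l -> divides D (l * A) -> divides D B -> ~ divides l B ->
  divides D A.
Proof.
case=> l0 _ pl [C eC] DB lB.
have [|[C' eC']|lD] := pl C D; first by rewrite -eC mulrC; exists A.
  exists C'; apply: (mulfI l0); rewrite eC eC'; ring.
by case: lB; apply: divides_trans DB.
Qed.

Lemma divides_strip_prod (ls : seq {mpoly K[3]}) H A :
  (forall l, l \in ls -> prime_polynomial l /\ ~ divides l H) ->
  divides H (\prod_(l <- ls) l * A) -> divides H A.
Proof.
elim: ls => [|l ls IH] pls; first by rewrite big_nil mul1r.
rewrite big_cons -mulrA => dH; have [pl lH] := pls l (mem_head _ _).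
apply: IH => [l' l'ls|]; first by apply: pls; rewrite inE l'ls orbT.
exact: (divides_strip pl dH (divides_refl H) lH).
Qed.

(** Each prime fails to divide some [w i], hence divides the cofactor [B], and the quotient of [B]
    serves all indices at once. This removes the contracted lines from the Wronskian of a
    transformed pencil. *)
Lemma form_quotient (I : Type) (ls : seq {mpoly K[3]}) B (a w : I -> {mpoly K[3]}) :
  (forall l, l \in ls -> prime_polynomial l /\ exists i, ~ divides l (w i)) ->
  (forall i, \prod_(l <- ls) l * a i = B * w i) ->
  exists C, forall i, a i = C * w i.
Proof.
elim: ls B => [|l ls IH] B pls e.
  by exists B => i; rewrite -e big_nil mul1r.
have [[l0 _ pl] [i0 li0]] := pls l (mem_head _ _).
have [|[C eC]|//] := pl B (w i0).
  by rewrite -e big_cons -mulrA; apply/divides_mulr/divides_refl.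
apply: (IH C) => [l' l'ls|i]; first by apply: pls; rewrite inE l'ls orbT.
by apply: (mulfI l0); move: (e i); rewrite big_cons eC mulrA => ->; ring.
Qed.

End PrimePolynomials.

(** * Orders and leading forms at a point *)

Section Orders.
Variable K : numFieldType.
Implicit Types (A B F G H : {mpoly K[3]}) (p q v : 'I_3 -> K).

(** Iterated first derivatives allow the Leibniz and chain rules to be applied one derivative at a
    time; [order_geP] makes the link with [multiplicity]. *)
Fixpoint order_ge r p A : Prop :=
  if r is r'.+1 then A.@[p] = 0 /\ forall i, order_ge r' p (mderiv i A) else True.

(* The r-th iterated derivative at p in the direction v: when A has order at
   least r at p, this is r! times the value at v of its leading form. *)
Fixpoint leading r p v A : K :=
  if r is r'.+1 then \sum_i v i * leading r' p v (mderiv i A) else A.@[p].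

Lemma order_geSP r p A : order_ge r.+1 p A ->
  A.@[p] = 0 /\ forall i, order_ge r p (mderiv i A).
Proof. by []. Qed.

Lemma order_geS r p A : order_ge r.+1 p A -> order_ge r p A.
Proof.
elim: r A => [//|r IH] A /order_geSP[Ap Ar]; split=> // i.
by apply: IH.
Qed.

Lemma order_ge_eval r p A : order_ge r.+1 p A -> A.@[p] = 0.
Proof. by case. Qed.

Lemma order_geD r p A B : order_ge r p A -> order_ge r p B -> order_ge r p (A + B).
Proof.
elim: r A B => [//|r IH] A B /order_geSP[Ap Ar] /order_geSP[Bp Br]; split=> [|i].
  by rewrite mevalD Ap Bp addr0.
by rewrite mderivD; apply: IH.
Qed.

Lemma order_ge0 r p : order_ge r p 0.
Proof. by elim: r => [//|r IH]; split=> [|i]; rewrite ?meval0 ?mderiv0. Qed.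

Lemma order_ge_sum (I : Type) (s : seq I) r p (f : I -> {mpoly K[3]}) :
  (forall i, order_ge r p (f i)) -> order_ge r p (\sum_(i <- s) f i).
Proof.
by move=> h; apply: big_ind => //; [exact: order_ge0|apply: order_geD].
Qed.

(** Induction on [r + s]: in each Leibniz term one factor loses one order, and if that factor had
    order 0, the other one has an order to spare. *)
Lemma order_geM r s p A B :
  order_ge r p A -> order_ge s p B -> order_ge (r + s) p (A * B).
Proof.
move: {2}(r + s)%N (erefl (r + s)%N) => n e; rewrite e.
elim: n r s e A B => // n IH r s e A B hA hB; split=> [|i].
  rewrite mevalM; case: r e hA => [|r] e hA; last by rewrite (order_ge_eval hA) mul0r.
  by rewrite add0n in e; rewrite e in hB; rewrite (order_ge_eval hB) mulr0.
rewrite mderivM; apply: order_geD.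
  case: r e hA => [|r] e hA; last by apply: (IH r s) => //; [case: e|case/order_geSP: hA].
  rewrite add0n in e; apply: (IH 0%N n) => //.
  by apply: order_geS; rewrite -e.
case: s e hB => [|s] e hB; last first.
  by apply: (IH r s) => //; [rewrite addnS in e; case: e|case/order_geSP: hB].
rewrite addn0 in e; apply: (IH n 0%N) => //; first by rewrite addn0.
by apply: order_geS; rewrite -e.
Qed.

Lemma order_geMl r p A B : order_ge r p B -> order_ge r p (A * B).
Proof. exact: (@order_geM 0). Qed.

Lemma order_geMr r p A B : order_ge r p A -> order_ge r p (A * B).
Proof. by rewrite mulrC; apply: order_geMl. Qed.

Lemma order_geZ r p c A : order_ge r p A -> order_ge r p (c *: A).
Proof. by rewrite -mul_mpolyC; apply: order_geMl. Qed.

(** [A] times a derivative of [B] is the derivative of [A * B] minus a multiple of [B], which allows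
    induction on [r]. *)
Lemma order_ge_cancel r p A B :
  A.@[p] != 0 -> order_ge r p (A * B) -> order_ge r p B.
Proof.
move=> Ap; elim: r B => [//|r IH] B AB; split=> [|i].
  have /eqP := order_ge_eval AB; rewrite mevalM mulf_eq0 (negPf Ap) /=.
  by move/eqP.
apply: (IH); rewrite (_ : A * _ = mderiv i (A * B) - mderiv i A * B); last first.
  by rewrite mderivM; ring.
case/order_geSP: (AB) => _ h; apply: order_geD => //; rewrite -mulNr.
by apply/order_geMl/IH/order_geS.
Qed.

Lemma order_ge_comp r p (Q : 3.-tuple {mpoly K[3]}) A :
  order_ge r (fun i => (tnth Q i).@[p]) A -> order_ge r p (A \mPo Q).
Proof.
elim: r A => [//|r IH] A /order_geSP[Ap Ar]; split=> [|i]; first by rewrite comp_mpoly_meval.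
rewrite mderiv_comp; apply: order_ge_sum => j.
exact/order_geMr/IH.
Qed.

Lemma meval_scale d p c A :
  A \is d.-homog -> A.@[fun i => c * p i] = c ^+ d * A.@[p].
Proof. exact: (mmap_scale idfun). Qed.

Lemma mderiv_homog d i A : A \is d.+1.-homog -> mderiv i A \is d.-homog.
Proof.
move=> hA; apply/dhomogP => m /=.
rewrite mcoeff_msupp mcoeff_mderiv => h.
have : (m + U_(i))%MM \in msupp A.
  by rewrite mcoeff_msupp; apply: contraNneq h => ->; rewrite mul0rn.
by move/(dhomog_mf hA); rewrite /= mdegD mdeg1 addn1 => -[].
Qed.

Lemma mderiv_homog0 i A : A \is 0.-homog -> mderiv i A = 0.
Proof.
move=> hA; apply/mpolyP => m; rewrite mcoeff0 mcoeff_mderiv.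
by rewrite (dhomog_nemf_coeff hA) ?mul0rn //= mdegD mdeg1 addn1.
Qed.

Lemma order_ge_scale r d p c A :
  A \is d.-homog -> order_ge r p A -> order_ge r (fun i => c * p i) A.
Proof.
elim: r d A => [//|r IH] d A hA /order_geSP[Ap Ar]; split=> [|i].
  by rewrite (meval_scale _ _ hA) Ap mulr0.
case: d hA => [|d] hA; first by rewrite mderiv_homog0 //; apply: order_ge0.
exact/(IH d)/Ar/mderiv_homog.
Qed.

Lemma order_ge_ext r p q A : p =1 q -> order_ge r p A -> order_ge r q A.
Proof.
move=> e; elim: r A => [//|r IH] A /order_geSP[Ap Ar]; split=> [|i]; last exact: IH.
by rewrite -(meval_eq _ e).
Qed.

Lemma leading_ext r p q v A : p =1 q -> leading r p v A = leading r q v A.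
Proof.
move=> e; elim: r A => [|r IH] A /=; first exact: meval_eq.
by apply: eq_bigr => i _; rewrite IH.
Qed.

Lemma leading_ext_dir r p v w A : v =1 w -> leading r p v A = leading r p w A.
Proof.
by move=> e; elim: r A => [//|r IH] A /=; apply: eq_bigr => i _; rewrite IH e.
Qed.

Lemma leadingD r p v A B : leading r p v (A + B) = leading r p v A + leading r p v B.
Proof.
elim: r A B => [|r IH] A B /=; first by rewrite mevalD.
by rewrite -big_split; apply: eq_bigr => i _; rewrite mderivD IH mulrDr.
Qed.

Lemma leadingZ r p v c A : leading r p v (c *: A) = c * leading r p v A.
Proof.
elim: r A => [|r IH] A /=; first by rewrite mevalZ.
by rewrite mulr_sumr; apply: eq_bigr => i _; rewrite mderivZ IH mulrCA.
Qed.

Lemma leading0 r p v : leading r p v 0 = 0.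
Proof. by rewrite -(scale0r (0 : {mpoly K[3]})) leadingZ mul0r. Qed.

Lemma leading_sum (I : Type) (s : seq I) r p v (f : I -> {mpoly K[3]}) :
  leading r p v (\sum_(i <- s) f i) = \sum_(i <- s) leading r p v (f i).
Proof.
elim: s => [|i s IH]; first by rewrite !big_nil leading0.
by rewrite !big_cons leadingD IH.
Qed.

Lemma leading_order r p v A : order_ge r.+1 p A -> leading r p v A = 0.
Proof.
elim: r A => [|r IH] A /order_geSP[Ap Ar] //=.
by apply: big1 => i _; rewrite IH ?mulr0.
Qed.

(** Once a derivative falls on [A], too few remain to reach the order of [B]; only the term with all
    derivatives on [B] survives. *)
Lemma leadingMl r p v A B :
  order_ge r p B -> leading r p v (A * B) = A.@[p] * leading r p v B.
Proof.
elim: r A B => [|r IH] A B hB /=; first by rewrite mevalM.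
rewrite mulr_sumr; apply: eq_bigr => i _; rewrite mderivM leadingD.
by rewrite leading_order ?add0r ?IH ?mulrA 1?[_ * v i]mulrC ?mulrA //;
  [case/order_geSP: hB|apply: order_geMl].
Qed.

(** The leading form is pulled back by the differential [w] of [Q] at [p]: higher derivatives of [Q]
    only multiply derivatives of [A] that vanish at the image point. *)
Lemma leading_comp r p v (Q : 3.-tuple {mpoly K[3]}) A :
  let q i := (tnth Q i).@[p] in
  let w i := \sum_j v j * (mderiv j (tnth Q i)).@[p] in
  order_ge r q A -> leading r p v (A \mPo Q) = leading r q w A.
Proof.
move=> q w; elim: r A => [|r IH] A hA /=; first by rewrite comp_mpoly_meval.
under eq_bigr => i _.
  rewrite mderiv_comp leading_sum mulr_sumr.
  under eq_bigr => j _ do rewrite mulrC [_ * mderiv _ _]mulrC.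
  over.
rewrite exchange_big; apply: eq_bigr => i _; rewrite /w mulr_suml.
apply: eq_bigr => j _; case/order_geSP: hA => Ap Ar.
rewrite leadingMl; last exact: order_ge_comp.
by rewrite IH //; ring.
Qed.

(** By Euler's identity the derivative of [A] in the radial direction [p] is a multiple of [A], so
    its contribution vanishes. The leading form thus lives on the tangent plane of P^2. *)
Lemma leading_along r d p v c A :
  A \is d.-homog -> order_ge r p A ->
  leading r p (fun i => v i + c * p i) A = leading r p v A.
Proof.
elim: r d A => [//|r IH] d A hA hr /=; case/order_geSP: (hr) => _ Ar.
case: d hA => [|d] hA.
  by apply: eq_bigr => i _; rewrite mderiv_homog0 // !leading0 !mulr0.
under eq_bigr => i _ do rewrite (IH d) ?mderiv_homog // mulrDl -mulrA.
rewrite big_split /= -mulr_sumr.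
suff -> : \sum_i p i * leading r p v (mderiv i A) = 0 by rewrite mulr0 addr0.
transitivity (leading r p v (d.+1%:R *: A)).
  rewrite -(euler hA) leading_sum; apply: eq_bigr => i _.
  by rewrite leadingMl // mevalXU.
by rewrite leadingZ leading_order // mulr0.
Qed.

Lemma leading_scale_dir r p v c A :
  leading r p (fun i => c * v i) A = c ^+ r * leading r p v A.
Proof.
elim: r A => [|r IH] A /=; first by rewrite mul1r.
rewrite mulr_sumr; apply: eq_bigr => i _; rewrite IH exprS; ring.
Qed.

Lemma leading_scale_point r d p v c A : order_ge r p A ->
  A \is d.-homog -> c != 0 -> leading r (fun i => c * p i) v A = 0 ->
  leading r p v A = 0.
Proof.
move=> hr hA c0; suff -> : leading r p v A = c ^- d * c ^+ r * leading r (fun i => c * p i) v A.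
  by move=> ->; rewrite mulr0.
elim: r d A hA hr => [|r IH] d A hA hr /=.
  by rewrite (meval_scale _ _ hA) mulr1 mulKf // expf_neq0.
rewrite mulr_sumr; apply: eq_bigr => i _; case/order_geSP: hr => _ /(_ i) hr.
case: d hA => [|d] hA; first by rewrite mderiv_homog0 // !leading0 !mulr0.
rewrite (IH d) ?mderiv_homog // !exprS; field.
by rewrite c0 expf_neq0.
Qed.

End Orders.

(** * Restriction of polynomials to lines *)

Section Lines.
Variable K : numFieldType.
Implicit Types (A B F G H : {mpoly K[3]}) (p q v : 'I_3 -> K).

Definition line_poly p v A : {poly K} :=
  mmap (@polyC K) (fun i => (p i)%:P + v i *: 'X) A.

Lemma line_poly_horner p v A c :
  (line_poly p v A).[c] = A.@[fun i => p i + c * v i].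
Proof.
rewrite /line_poly; elim/mpoly_ring_ind: A => [a|i|A B IA IB|A B IA IB].
- by rewrite mmapC mevalC hornerC.
- by rewrite mmapX mmap1U mevalXU !hornerE mulrC.
- by rewrite mmapD mevalD hornerD IA IB.
- by rewrite !rmorphM /= hornerM IA IB.
Qed.

Lemma line_poly_deriv p v A :
  (line_poly p v A)^`() = \sum_i v i *: line_poly p v (mderiv i A).
Proof.
rewrite /line_poly; elim/mpoly_ring_ind: A => [a|i|A B IA IB|A B IA IB].
- by rewrite mmapC derivC big1 // => i _; rewrite mderivC mmap0 scaler0.
- rewrite mmapX mmap1U derivD derivC add0r derivZ derivX.
  rewrite (bigD1 i) //= big1 => [|j ji].
    by rewrite mderiv_var eqxx -mpolyC1 mmapC addr0.
  by rewrite mderiv_var (negPf ji) mmap0 scaler0.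
- rewrite mmapD derivD IA IB -big_split; apply: eq_bigr => i _ /=.
  by rewrite mderivD mmapD scalerDr.
- rewrite rmorphM /= derivM IA IB mulr_suml mulr_sumr -big_split.
  apply: eq_bigr => i _ /=; rewrite mderivM mmapD !rmorphM /=.
  by rewrite scalerDr scalerAl -scalerAr.
Qed.

(** Taylor's formula along the line. *)
Lemma line_poly_coef r p v A : (line_poly p v A)`_r *+ r`! = leading r p v A.
Proof.
suff -> : leading r p v A = (line_poly p v A)^`(r)`_0.
  by rewrite coef_derivn addn0 ffactnn.
elim: r A => [|r IH] A.
  by rewrite derivn0 -horner_coef0 line_poly_horner /=; apply: meval_eq => i; ring.
rewrite derivSn line_poly_deriv raddf_sum coef_sum /=; apply: eq_bigr => i _.
by rewrite IH derivnZ coefZ.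
Qed.

Lemma order_geP r p A :
  order_ge r p A <-> forall m, (mdeg m < r)%N -> (mderivm m A).@[p] = 0.
Proof.
elim: r A => [//|r IH] A; split=> [/order_geSP[Ap Ar] m|h].
  have [->|m0] := eqVneq m 0%MM; first by rewrite mderivm0m.
  have [i mi] : exists i, (0 < m i)%N.
    apply/existsP; apply: contraNT m0; rewrite negb_exists => /forallP h.
    by apply/eqP/mnmP => i; rewrite mnm0E; apply/eqP; rewrite -leqn0 leqNgt.
  rewrite -(@submK _ U_(i) m) ?lep1mP -?lt0n // addmC mderivmDm mderivmU1m.
  rewrite mdegD mdeg1 add1n ltnS => mr.
  by have /IH := Ar i; apply.
split; first by have := h 0%MM; rewrite mdeg0 mderivm0m; apply.
move=> i; apply/IH => m mr; rewrite -mderivmU1m -mderivmDm h //.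
by rewrite mdegD mdeg1.
Qed.

Lemma multiplicityP H (p : 'rV[K]_3) r :
  multiplicity H p r <-> order_ge r (p 0) H /\ ~ order_ge r.+1 (p 0) H.
Proof.
split=> [[h [m [mr hm]]]|[/order_geP h hn]].
  split; first exact/order_geP.
  by move=> /order_geP h'; move/eqP: hm; apply; apply: h'; rewrite mr.
split=> //; apply: contra_notP hn => hn; apply/order_geP => m.
rewrite ltnS leq_eqVlt => /orP[/eqP mr|]; last exact: h.
by apply/eqP; apply: contra_notT hn => hm; exists m.
Qed.

Lemma order_ge_le r s p A : (s <= r)%N -> order_ge r p A -> order_ge s p A.
Proof. by move=> sr /order_geP h; apply/order_geP => m ms; apply/h/(leq_trans ms). Qed.

End Lines.

(** * The genus of the field K(u)(v), v^2 a squarefree cubic in u *)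

Section ValuationRings.
Variables (K L : fieldType) (iota : {rmorphism K -> L}) (O : L -> Prop).
Hypothesis vO : valuation_ring iota O.

Lemma valuation_const c : O (iota c). Proof. by case: vO. Qed.

Lemma valuation0 : O 0.
Proof. by rewrite -(rmorph0 iota); apply: valuation_const. Qed.

Lemma valuation1 : O 1.
Proof. by rewrite -(rmorph1 iota); apply: valuation_const. Qed.

Lemma valuationB x y : O x -> O y -> O (x - y). Proof. by case: vO => _ h *; apply: h. Qed.

Lemma valuationN x : O x -> O (- x).
Proof. by rewrite -sub0r; apply: valuationB; apply: valuation0. Qed.

Lemma valuationD x y : O x -> O y -> O (x + y).
Proof. by move=> hx /valuationN; rewrite -{2}[y]opprK; apply: valuationB. Qed.

Lemma valuationM x y : O x -> O y -> O (x * y).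
Proof. by case: vO => _ _ h *; apply: h. Qed.

Lemma valuationX x n : O x -> O (x ^+ n).
Proof.
move=> hx; elim: n => [|n IH]; first exact: valuation1.
by rewrite exprS; apply: valuationM.
Qed.

Lemma valuationV x : ~ O x -> O x^-1.
Proof. by case: vO => _ _ _ h _ nx; case: (h x). Qed.

Lemma valuationMn x n : O x -> O (x *+ n).
Proof.
move=> hx; rewrite -mulr_natr; apply: valuationM => //.
by rewrite -(rmorph_nat iota); apply: valuation_const.
Qed.

Lemma valuation_poly x (A : {poly K}) : O x -> O (map_poly iota A).[x].
Proof.
move=> hx; elim/poly_ind: A => [|A c IH]; first by rewrite rmorph0 horner0; apply: valuation0.
rewrite rmorphD rmorphM /= map_polyX map_polyC !hornerE.
by apply: valuationD; [apply: valuationM|apply: valuation_const].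
Qed.

Lemma valuation_sqrt x : O (x ^+ 2) -> O x.
Proof.
move=> hx; case: (pselect (O x)) => // nx.
have x0 : x != 0 by apply: contra_notN nx => /eqP->; apply: valuation0.
rewrite (_ : x = x ^+ 2 * x^-1); first by apply/valuationM/valuationV.
by rewrite expr2 mulfK.
Qed.

(** The maximal ideal of [O]. Zero is listed separately because its inverse is 0 by convention and
    lies in [O]. *)
Definition valuation_ideal x := x = 0 \/ ~ O x^-1.

Lemma ideal_valuation x : valuation_ideal x -> O x.
Proof.
case=> [->|nx]; first exact: valuation0.
by rewrite -[x]invrK; apply: valuationV.
Qed.

Lemma idealM x y : valuation_ideal x -> O y -> valuation_ideal (x * y).
Proof.
move=> [->|nx] hy; first by left; rewrite mul0r.
have [->|y0] := eqVneq y 0; first by left; rewrite mulr0.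
have [->|x0] := eqVneq x 0; first by left; rewrite mul0r.
right=> h; apply: nx; rewrite (_ : x^-1 = (x * y)^-1 * y); first exact: valuationM.
by field; rewrite ?x0 ?y0.
Qed.

Lemma ideal_prime x y : valuation_ideal (x * y) -> valuation_ideal x \/ valuation_ideal y.
Proof.
move=> h; case: (pselect (valuation_ideal x)) => [|nx]; first by left.
right; have : valuation_ideal ((x * y) * x^-1).
  by apply: idealM => //; apply: contra_notP nx; right.
rewrite [x * y]mulrC mulfK //.
by apply: contra_notN nx => /eqP->; left.
Qed.

Lemma idealN x : valuation_ideal x -> valuation_ideal (- x).
Proof. by rewrite -mulrN1 => h; apply: idealM h (valuationN valuation1). Qed.

(** One of [y / x] and [x / y] lies in [O]; the difference is then the denominator times an element
    of [O]. *)
Lemma idealB x y : valuation_ideal x -> valuation_ideal y -> valuation_ideal (x - y).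
Proof.
suff H x' y' : O (y' / x') -> valuation_ideal x' -> valuation_ideal y' ->
    valuation_ideal (x' - y').
  move=> hx hy; case: (pselect (O (y / x))) => [h|h]; first exact: H.
  rewrite -opprB; apply/idealN/H => //.
  by rewrite -[x / y]invf_div; apply: valuationV.
move=> h hx hy; have [x0|x0] := eqVneq x' 0.
  by rewrite x0 sub0r; apply: idealN.
have -> : x' - y' = x' * (1 - y' / x') by field.
by apply: idealM => //; apply: valuationB => //; apply: valuation1.
Qed.

Lemma unit_not_ideal x : x != 0 -> O x^-1 -> ~ valuation_ideal x.
Proof. by move=> /eqP x0 h []. Qed.

End ValuationRings.

(** * The affine curve v^2 = f(u): local rings, centers of valuation rings, dual derivation *)

Section Charts.
Variables (K : numClosedFieldType) (L : fieldType) (iota : {rmorphism K -> L}).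
Implicit Types (u v x : L) (A B C D f g : {poly K}) (a b c : K).

Definition ev u A : L := (map_poly iota A).[u].

Lemma evD u A B : ev u (A + B) = ev u A + ev u B.
Proof. by rewrite /ev rmorphD hornerD. Qed.
Lemma evB u A B : ev u (A - B) = ev u A - ev u B.
Proof. by rewrite /ev rmorphB hornerD hornerN. Qed.
Lemma evM u A B : ev u (A * B) = ev u A * ev u B.
Proof. by rewrite /ev rmorphM hornerM. Qed.
Lemma evC u a : ev u a%:P = iota a.
Proof. by rewrite /ev map_polyC hornerC. Qed.
Lemma evX u : ev u 'X = u.
Proof. by rewrite /ev map_polyX hornerX. Qed.
Lemma ev0 u : ev u 0 = 0. Proof. by rewrite /ev rmorph0 horner0. Qed.
Lemma ev1 u : ev u 1 = 1. Proof. by rewrite /ev rmorph1 hornerC. Qed.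
Lemma evN u A : ev u (- A) = - ev u A. Proof. by rewrite -sub0r evB ev0 sub0r. Qed.
Lemma evXn u A n : ev u (A ^+ n) = ev u A ^+ n.
Proof. by elim: n => [|n IH]; rewrite ?expr0 ?ev1 // !exprS evM IH. Qed.
Definition evE := (evD, evB, evM, evC, evX, ev0, ev1, evN, evXn).

Definition el u v A B : L := ev u A + ev u B * v.

Definition value a b A B : K := A.[a] + B.[a] * b.

(* The affine curve v^2 = f(u) is smooth and L is its field of functions. *)
Record chart u v f : Prop := Chart {
  chart_eq : v ^+ 2 = ev u f;
  chart_inj : forall A B, el u v A B = 0 -> A = 0 /\ B = 0;
  chart_gen : forall x, exists A B C, C != 0 /\ x * ev u C = el u v A B;
  chart_smooth : forall a, f.[a] = 0 -> f^`().[a] != 0 }.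

Section OneChart.
Variables (u v : L) (f : {poly K}).
Hypothesis uvf : chart u v f.
Let v2 : v ^+ 2 = ev u f := chart_eq uvf.
Local Notation el := (el u v).
Local Notation ev := (ev u).

Lemma el_mul A B C D : el A B * el C D = el (A * C + B * D * f) (A * D + B * C).
Proof. by rewrite /el !evE -v2; ring. Qed.

Lemma el_sub A B C D : el A B - el C D = el (A - C) (B - D).
Proof. by rewrite /el !evE; ring. Qed.

Lemma el_ev A : ev A = el A 0. Proof. by rewrite /el ev0 mul0r addr0. Qed.

Lemma el_eq A B C D : el A B = el C D -> A = C /\ B = D.
Proof.
move=> /eqP; rewrite -subr_eq0 el_sub => /eqP/(chart_inj uvf)[].
by move=> /eqP; rewrite subr_eq0 => /eqP-> /eqP; rewrite subr_eq0 => /eqP->.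
Qed.

Section Point.
Variables (a b : K).
Hypothesis ab : b ^+ 2 = f.[a].

Lemma value_mul A B C D :
  value a b (A * C + B * D * f) (A * D + B * C) = value a b A B * value a b C D.
Proof. by rewrite /value !hornerE -ab; ring. Qed.

Lemma value_el A B A' B' : value a b A B != 0 -> el A B = el A' B' -> value a b A' B' != 0.
Proof. by move=> h /el_eq[<- <-]. Qed.

Lemma el_neq0 A B : value a b A B != 0 -> el A B != 0.
Proof.
by apply: contra_neq => /(chart_inj uvf)[-> ->]; rewrite /value !hornerE.
Qed.

(** The local ring of the curve at the point [(a, b)]. *)
Definition local_ring x := exists A B C D, value a b C D != 0 /\ x * el C D = el A B.

Definition local_unit x := exists A B C D,
  [/\ value a b A B != 0, value a b C D != 0 & x * el C D = el A B].

(** At a branch point, where [b = 0], the function [u - a] vanishes to order two and [v] to order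
    one; elsewhere [u - a] is a local parameter. *)
Definition uniformizer := if b == 0 then v else u - iota a.

Lemma local_el A B : local_ring (el A B).
Proof.
exists A, B, 1, 0; rewrite -el_ev ev1 mulr1 /value !hornerE oner_neq0.
by split.
Qed.

Lemma unit_el A B : value a b A B != 0 -> local_unit (el A B).
Proof.
move=> h; exists A, B, 1, 0; rewrite -el_ev ev1 mulr1 /value !hornerE oner_neq0.
by split.
Qed.

Lemma local_unit_local x : local_unit x -> local_ring x.
Proof. by case=> A [B [C [D [_ h e]]]]; exists A, B, C, D. Qed.

Lemma local_sub x y : local_ring x -> local_ring y -> local_ring (x - y).
Proof.
move=> [A [B [C [D [h e]]]]] [A' [B' [C' [D' [h' e']]]]].
exists (A * C' + B * D' * f - (A' * C + B' * D * f)).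
exists (A * D' + B * C' - (A' * D + B' * C)).
exists (C * C' + D * D' * f), (C * D' + D * C').
rewrite value_mul mulf_neq0 //; split=> //.
by rewrite -el_sub -!el_mul -e -e'; ring.
Qed.

Lemma local_mul x y : local_ring x -> local_ring y -> local_ring (x * y).
Proof.
move=> [A [B [C [D [h e]]]]] [A' [B' [C' [D' [h' e']]]]].
exists (A * A' + B * B' * f), (A * B' + B * A').
exists (C * C' + D * D' * f), (C * D' + D * C').
rewrite value_mul mulf_neq0 //; split=> //.
by rewrite -!el_mul -e -e'; ring.
Qed.

Lemma local_unit_mul x y : local_unit x -> local_unit y -> local_unit (x * y).
Proof.
move=> [A [B [C [D [k h e]]]]] [A' [B' [C' [D' [k' h' e']]]]].
exists (A * A' + B * B' * f), (A * B' + B * A').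
exists (C * C' + D * D' * f), (C * D' + D * C').
rewrite !value_mul !mulf_neq0 //; split=> //.
by rewrite -!el_mul -e -e'; ring.
Qed.

Lemma local_unit_neq0 x : local_unit x -> x != 0.
Proof.
case=> A [B [C [D [h h' e]]]]; have := el_neq0 h.
by rewrite -e mulf_eq0 negb_or => /andP[].
Qed.

Lemma local_unit_inv x : local_unit x -> local_unit x^-1.
Proof.
move=> ux; have x0 := local_unit_neq0 ux; case: ux => A [B [C [D [h h' e]]]].
exists C, D, A, B; split=> //.
by rewrite -e mulKf.
Qed.

Lemma uniformizer_el : exists A B, [/\ uniformizer = el A B, value a b A B = 0 & uniformizer != 0].
Proof.
rewrite /uniformizer; have [b0|b0] := eqVneq b 0.
  exists 0, 1; rewrite /value !hornerE b0 /el !evE mul1r add0r; split=> //.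
  apply/eqP=> v0; have [|_ /eqP] := @chart_inj _ _ _ uvf 0 1.
    by rewrite /el !evE v0 mulr0 addr0.
  by rewrite oner_eq0.
exists ('X - a%:P), 0; rewrite /value !hornerE /el !evE mul0r addr0 subrr; split=> //.
apply/eqP => ua; have [|/eqP] := @chart_inj _ _ _ uvf ('X - a%:P) 0.
  by rewrite /el !evE ua mul0r addr0.
by rewrite polyXsubC_eq0.
Qed.

Lemma root_factor A c : A.[c] = 0 -> exists B, A = ('X - c%:P) * B.
Proof. by move=> /eqP/factor_theorem[B ->]; exists B; rewrite mulrC. Qed.

(** Induction on the sizes of [A] and [B]. If both vanish at [a], a factor [u - a] is split off;
    otherwise the order at the point can be computed directly. *)
Lemma local_normal_el A B : (A, B) != (0, 0) ->
  exists k x, local_unit x /\ el A B = uniformizer ^+ k * x.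
Proof.
move: {2}(size A + size B).+1 (ltnSn (size A + size B)) => n.
elim: n A B => [//|n IH] A B sAB AB0.
have [hv|hv] := eqVneq (value a b A B) 0; last first.
  by exists 0%N, (el A B); rewrite expr0 mul1r; split=> //; apply: unit_el.
have step : A.[a] = 0 -> B.[a] = 0 -> exists k x, local_unit x /\
    el A B = (u - iota a) * (uniformizer ^+ k * x).
  move=> /root_factor[A1 eA] /root_factor[B1 eB].
  have sX q : q != 0 -> size (('X - a%:P) * q) = (size q).+1.
    by move=> q0; rewrite size_monicM ?monicXsubC // size_XsubC.
  have [||k [x [ux e]]] := IH A1 B1.
  - suff : (size A1 + size B1 < size A + size B)%N by move=> h; apply: leq_trans h sAB.
    move: AB0; rewrite eA eB.
    have [->|A10] := eqVneq A1 0; have [->|B10] := eqVneq B1 0; rewrite ?mulr0 ?eqxx //.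
    + by rewrite size_poly0 !add0n sX.
    + by rewrite size_poly0 !addn0 sX.
    + by rewrite !sX // addSn ltnS addnS leqnSn.
  - by apply: contra_neq AB0 => -[A10 B10]; rewrite eA eB A10 B10 !mulr0.
  by exists k, x; split=> //; rewrite -e /el eA eB !evE; ring.
have [b0|b0] := eqVneq b 0.
  have uv : uniformizer = v by rewrite /uniformizer b0 eqxx.
  have fa : f.[a] = 0 by rewrite -ab b0 expr0n.
  have [g eg] := root_factor fa.
  have ga : g.[a] != 0.
    by have := chart_smooth uvf fa; rewrite eg derivM derivXsubC !hornerE subrr mul0r addr0.
  have ug : local_unit (ev g).
    by rewrite el_ev; apply: unit_el; rewrite /value !hornerE.
  have g0 := local_unit_neq0 ug.
  have Aa : A.[a] = 0 by move: hv; rewrite /value b0 mulr0 addr0.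
  (* At a branch point [u - a] is the square of the parameter times a unit. *)
  have vv : u - iota a = v ^+ 2 * (ev g)^-1.
    by rewrite v2 eg !evE mulfK.
  have [Ba|Ba] := eqVneq B.[a] 0.
    have [k [x [ux e]]] := step Aa Ba.
    exists (2 + k)%N, (x * (ev g)^-1); split.
      by apply: local_unit_mul => //; apply: local_unit_inv.
    by rewrite e vv uv exprD; ring.
  have [A1 eA] := root_factor Aa.
  exists 1%N, (el (B * g) A1 * (ev g)^-1); split.
    apply: local_unit_mul; last exact: local_unit_inv.
    by apply: unit_el; rewrite /value b0 !hornerE mulf_neq0.
  rewrite /el eA !evE vv uv; field.
  exact: g0.
(* Vanishing at both points over [a] forces [A] and [B] to vanish at [a]. *)
have [/eqP Ba|Ba] := boolP (value a (- b) A B == 0).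
  have e1 : A.[a] *+ 2 = 0.
    rewrite -[RHS]addr0 -{1}hv -Ba /value; ring.
  have e2 : A.[a] = 0 by move/eqP: e1; rewrite mulrn_eq0 => /eqP.
  have e3 : B.[a] = 0.
    by move/eqP: hv; rewrite /value e2 add0r mulf_eq0 (negPf b0) orbF => /eqP.
  have [k [x [ux e]]] := step e2 e3.
  by exists k.+1, x; split=> //; rewrite e exprS mulrA /uniformizer (negPf b0).
(* Here the conjugate [A - B v] is a unit at [(a, b)], so the order of [A + B v] is that of the
   norm, a polynomial in [u]. *)
have elN : el A B * el A (- B) = ev (A ^+ 2 - B ^+ 2 * f).
  by rewrite el_mul el_ev; congr (el _ _); ring.
have vN : value a b A (- B) != 0 by move: Ba; rewrite /value hornerN mulNr mulrN.
have N0 : A ^+ 2 - B ^+ 2 * f != 0.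
  apply: contra_neq AB0 => N0; move/eqP: elN; rewrite N0 ev0 mulf_eq0.
  by rewrite (negPf (el_neq0 vN)) orbF => /eqP/(chart_inj uvf)[-> ->].
have [k [g]] := multiplicity_XsubC (A ^+ 2 - B ^+ 2 * f) a.
rewrite N0 /= => ga eg; exists k, (ev g * (el A (- B))^-1); split.
  apply: local_unit_mul; last by apply/local_unit_inv/unit_el.
  by rewrite el_ev; apply: unit_el; rewrite /value !hornerE.
rewrite mulrA -[LHS](mulfK (el_neq0 vN)) elN eg !evE /uniformizer (negPf b0).
by congr (_ / _); rewrite mulrC.
Qed.

Lemma local_normal x : x != 0 ->
  exists k y, local_unit y /\ (x = uniformizer ^+ k * y \/ x * uniformizer ^+ k = y).
Proof.
have [_ [_ [_ _ p0]]] := uniformizer_el.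
move=> x0; have [A [B [C [C0 e]]]] := chart_gen uvf x.
have [|k [y [uy ey]]] := @local_normal_el C 0; first by rewrite xpair_eqE negb_and C0.
have [|l [z [uz ez]]] := @local_normal_el A B.
  apply: contra_neq x0 => -[A0 B0]; move/eqP: e; rewrite A0 B0 /el !evE mul0r addr0 mulf_eq0.
  by rewrite el_ev ey mulf_eq0 expf_eq0 (negPf p0) andbF (negPf (local_unit_neq0 uy)) !orbF => /eqP.
have y0 := local_unit_neq0 uy.
have {e}e : x * uniformizer ^+ k = uniformizer ^+ l * (z / y).
  by apply: (mulIf y0); rewrite -mulrA -ey -el_ev e ez mulrA mulfVK.
have uzy : local_unit (z / y) by apply: local_unit_mul => //; apply: local_unit_inv.
have [kl|kl] := leqP k l.
  exists (l - k)%N, (z / y); split=> //; left.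
  apply: (mulIf (expf_neq0 k p0)); rewrite e -{1}(subnK kl) exprD; ring.
exists (k - l)%N, (z / y); split=> //; right.
apply: (mulIf (expf_neq0 l p0)); rewrite -mulrA -exprD subnK 1?ltnW // e; ring.
Qed.

Lemma uniformizer_local k : local_ring (uniformizer ^+ k).
Proof.
have [A [B [-> _ _]]] := uniformizer_el.
elim: k => [|k IH]; first by rewrite expr0 -(ev1 u) el_ev; apply: local_el.
by rewrite exprS; apply: local_mul => //; apply: local_el.
Qed.

Lemma local_valuation_ring : valuation_ring iota local_ring.
Proof.
split.
- by move=> c; rewrite -(evC u) el_ev; apply: local_el.
- exact: local_sub.
- exact: local_mul.
- move=> x; have [->|x0] := eqVneq x 0.
    by left; rewrite -(ev0 u) el_ev; apply: local_el.
  have [_ [_ [_ _ p0]]] := uniformizer_el.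
  have [k [y [uy [->|e]]]] := local_normal x0.
    by left; apply: local_mul; [apply: uniformizer_local|apply: local_unit_local].
  right; rewrite (_ : x^-1 = uniformizer ^+ k * y^-1).
    by apply: local_mul; [apply: uniformizer_local|apply/local_unit_local/local_unit_inv].
  by rewrite -e; field; rewrite x0 expf_neq0.
- have [A [B [e vAB p0]]] := uniformizer_el.
  exists uniformizer^-1 => -[A' [B' [C [D [h e']]]]].
  have : el C D = el A B * el A' B' by rewrite -e' -e mulVKf.
  by rewrite el_mul => /(value_el h); rewrite value_mul vAB mul0r eqxx.
Qed.

End Point.

(** Membership in the local rings at both points over [a] gives two linear conditions on [A.[a]] and
    [B.[a]]. They are independent when [b != 0]; at a branch point a second condition has to be
    found. *)
Lemma pole a b x A B C : b ^+ 2 = f.[a] ->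
  local_ring a b x -> local_ring a (- b) x ->
  x * ev C = el A B -> C.[a] = 0 -> A.[a] = 0 /\ B.[a] = 0.
Proof.
move=> ab hx hx' e Ca.
have mab : (- b) ^+ 2 = f.[a] by rewrite sqrrN.
have key b' : b' ^+ 2 = f.[a] -> local_ring a b' x -> value a b' A B = 0.
  move=> ab' [E [F [G [H [vGH eE]]]]].
  have : el A B * el G H = el C 0 * el E F by rewrite -e -eE -el_ev; ring.
  rewrite !el_mul => /el_eq[e1 e2].
  have := value_mul ab' A B G H; rewrite e1 e2 value_mul // {1}/value Ca horner0.
  rewrite mul0r addr0 mul0r => /esym/eqP.
  by rewrite mulf_eq0 (negPf vGH) orbF => /eqP.
have [b0|b0] := eqVneq b 0; last first.
  have h1 := key _ ab hx; have h2 := key _ mab hx'.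
  have e2 : A.[a] *+ 2 = 0 by rewrite -[RHS]addr0 -{1}h1 -h2 /value; ring.
  have e1 : A.[a] = 0 by move/eqP: e2; rewrite mulrn_eq0 => /eqP.
  split=> //; move/eqP: h1.
  by rewrite /value e1 add0r mulf_eq0 (negPf b0) orbF => /eqP.
have Aa : A.[a] = 0 by have := key _ ab hx; rewrite /value b0 mulr0 addr0.
split=> //.
have fa : f.[a] = 0 by rewrite -ab b0 expr0n.
have [g eg] := root_factor fa.
have ga : g.[a] != 0.
  by have := chart_smooth uvf fa; rewrite eg derivM derivXsubC !hornerE subrr mul0r addr0.
have [A1 eA] := root_factor Aa; have [C1 eC] := root_factor Ca.
have ua : u - iota a != 0.
  apply/eqP => ua; have [|/eqP] := @chart_inj _ _ _ uvf ('X - a%:P) 0.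
    by rewrite /el !evE ua mul0r addr0.
  by rewrite polyXsubC_eq0.
(* The equation multiplied by [v] and divided by [u - a]. Its right side vanishes at [(a, 0)], which
   forces [B * g] to vanish at [a]. *)
have {}e : el (B * g) A1 = el 0 C1 * x.
  apply: (mulfI ua); transitivity (v * el A B).
    rewrite /el eA !evE (_ : v * _ = (u - iota a) * ev A1 * v + ev B * v ^+ 2); last by ring.
    by rewrite v2 eg !evE; ring.
  by rewrite -e eC /el !evE; ring.
case: hx => [E [F [G [H [vGH eE]]]]].
have : el (B * g) A1 * el G H = el 0 C1 * el E F by rewrite e -eE; ring.
rewrite !el_mul => /el_eq[e1 e2].
have := value_mul ab (B * g) A1 G H; rewrite e1 e2 value_mul // /value b0 !mulr0 !addr0.
rewrite horner0 mul0r hornerM => /esym/eqP; move: vGH; rewrite /value b0 mulr0 addr0 => vGH.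
by rewrite !mulf_eq0 (negPf vGH) (negPf ga) !orbF => /eqP.
Qed.

Lemma two_neq0 : 2%:R != 0 :> L.
Proof. by rewrite -(rmorph_nat iota) fmorph_eq0 pnatr_eq0. Qed.

Lemma v_neq0 : v != 0.
Proof.
apply/eqP => v0; have [|_ /eqP] := @chart_inj _ _ _ uvf 0 1.
  by rewrite /el !evE v0 mulr0 addr0.
by rewrite oner_eq0.
Qed.

Section Derivations.
Variable D : L -> L.
Hypothesis dD : derivation iota D.

Lemma derivation_const c : D (iota c) = 0. Proof. by case: dD. Qed.
Lemma derivationD x y : D (x + y) = D x + D y. Proof. by case: dD. Qed.
Lemma derivationM x y : D (x * y) = x * D y + D x * y. Proof. by case: dD. Qed.
Lemma derivation0 : D 0 = 0.
Proof. by rewrite -(rmorph0 iota) derivation_const rmorph0. Qed.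

Lemma derivationX x n : D (x ^+ n) = (x ^+ n.-1 * D x) *+ n.
Proof.
elim: n => [|n IH]; first by rewrite expr0 -(rmorph1 iota) derivation_const mulr0n.
rewrite exprS derivationM IH; case: n {IH} => [|n]; first by rewrite mulr0 expr0 mulr1 add0r mul1r.
by rewrite /= -mulr_natr -[RHS]mulr_natr exprS -[n.+2%:R]natr1; ring.
Qed.

Lemma derivation_ev A : D (ev A) = ev A^`() * D u.
Proof.
elim/poly_ind: A => [|A c IH]; first by rewrite deriv0 ev0 derivation0 mul0r.
rewrite !evE derivationD derivationM derivation_const IH.
by rewrite derivD derivC derivM derivX !evE; ring.
Qed.

Lemma derivation_v : v * D v *+ 2 = ev f^`() * D u.
Proof. by rewrite -derivation_ev -v2 expr2 derivationM; ring. Qed.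

Lemma derivation_el A B :
  D (el A B) = (ev A^`() + ev B^`() * v) * D u + ev B * D v.
Proof. by rewrite derivationD derivationM !derivation_ev; ring. Qed.

End Derivations.

Lemma dual_derivation_v (D : L -> L) : derivation iota D -> D u = v *+ 2 -> D v = ev f^`().
Proof.
move=> dD Du; have v0 := v_neq0; have n2 := two_neq0.
have v2n : v *+ 2 != 0 by rewrite -mulr_natr mulf_neq0.
apply: (mulfI v2n); transitivity (v * D v *+ 2); first by ring.
by rewrite derivation_v // Du; ring.
Qed.

Lemma ev_neq0 C : C != 0 -> ev C != 0.
Proof.
apply: contra_neq => C0.
by have [|->] := @chart_inj _ _ _ uvf C 0; rewrite // /el C0 ev0 mul0r addr0.
Qed.

(* The derivation with value 2v at u is dual to du / 2v. *)
Lemma derivation_scale (D D' : L -> L) : derivation iota D -> derivation iota D' ->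
  D' u = v *+ 2 -> forall x, D x = D u / (v *+ 2) * D' x.
Proof.
move=> dD dD' D'u x; have v0 := v_neq0; have n2 := two_neq0.
set c := D u / _.
have v2n : v *+ 2 != 0 by rewrite -mulr_natr mulf_neq0.
have cu : D u = c * (v *+ 2) by rewrite divfK.
have D'v := dual_derivation_v dD' D'u.
have Dv : D v = c * D' v.
  apply: (mulfI v2n); rewrite D'v; transitivity (v * D v *+ 2); first by ring.
  by rewrite derivation_v // cu; ring.
have el_case A B : D (el A B) = c * D' (el A B).
  by rewrite !derivation_el // cu Dv D'u; ring.
have [A [B [C [C0 e]]]] := chart_gen uvf x.
have e1 := derivationM dD x (ev C); have e2 := derivationM dD' x (ev C).
apply: (mulIf (ev_neq0 C0)); apply: (addrI (x * D (ev C))).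
by rewrite -e1 e el_case -e e2 el_ev el_case; ring.
Qed.


Section AnyValuationRing.
Variable O : L -> Prop.
Hypotheses (vO : valuation_ring iota O) (Ou : O u).

Lemma valuation_v : O v.
Proof. by apply: (valuation_sqrt vO); rewrite v2; apply: valuation_poly. Qed.

Lemma valuation_el A B : O (el A B).
Proof.
apply: (valuationD vO); first exact: valuation_poly.
by apply: (valuationM vO); [apply: valuation_poly|apply: valuation_v].
Qed.

(** If no [u - a] lay in the maximal ideal, every nonzero polynomial in [u] would be invertible in
    [O], and [O] would be all of [L]. Given [a], the product of [v - b] and [v + b] is
    [f(u) - f(a)], so one of the factors lies in the ideal. *)
Lemma valuation_center : exists a b, [/\ b ^+ 2 = f.[a],
  valuation_ideal O (u - iota a) & valuation_ideal O (v - iota b)].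
Proof.
have [a ha] : exists a, valuation_ideal O (u - iota a).
  apply: contrapT => h.
  have invC C : C != 0 -> O (ev C)^-1.
    move=> C0; have [s ->] := closed_field_poly_normal C.
    rewrite -mul_polyC !evE invfM; apply: (valuationM vO).
      by rewrite -fmorphV; apply: (valuation_const vO).
    elim: s => [|a s IH]; first by rewrite big_nil ev1 invr1; apply: valuation1 vO.
    rewrite big_cons !evE invfM; apply: (valuationM vO) => //.
    by apply: contrapT => na; apply: h; exists a; right.
  have [_ _ _ _ [x nx]] := vO; apply: nx.
  have [A [B [C [C0 e]]]] := chart_gen uvf x.
  have C0' := ev_neq0 C0.
  rewrite -[x](mulfK C0') e; apply: (valuationM vO); first exact: valuation_el.
  exact: invC.
pose b := sqrtC f.[a].
have b2 : b ^+ 2 = f.[a] by rewrite sqrtCK.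
have [g eg] : exists g, f - f.[a]%:P = ('X - a%:P) * g.
  by apply: root_factor; rewrite !hornerE subrr.
have : valuation_ideal O ((v - iota b) * (v - iota (- b))).
  have -> : (v - iota b) * (v - iota (- b)) = (u - iota a) * ev g.
    rewrite rmorphN -[RHS](_ : ev (('X - a%:P) * g) = _); last by rewrite !evE.
    by rewrite -eg !evE -v2 -b2 rmorphXn /=; ring.
  by apply: (idealM vO) => //; apply: valuation_poly.
case/(ideal_prime vO) => h; first by exists a, b.
by exists a, (- b); rewrite sqrrN.
Qed.

Section Center.
Variables (a b : K).
Hypotheses (ab : b ^+ 2 = f.[a]) (ua : valuation_ideal O (u - iota a))
  (vb : valuation_ideal O (v - iota b)).

(** Modulo the maximal ideal an element of the coordinate ring is congruent to its value at the
    center, a nonzero constant. *)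
Lemma valuation_el_unit A B : value a b A B != 0 -> O (el A B)^-1.
Proof.
move=> h; apply: contrapT => nO.
have [A1 eA] : exists A1, A - A.[a]%:P = ('X - a%:P) * A1.
  by apply: root_factor; rewrite !hornerE subrr.
have [B1 eB] : exists B1, B - B.[a]%:P = ('X - a%:P) * B1.
  by apply: root_factor; rewrite !hornerE subrr.
have /(idealB vO) hi : valuation_ideal O (el A B) by right.
have {hi}/hi : valuation_ideal O (el A B - iota (value a b A B)).
  have -> : el A B - iota (value a b A B) =
      (u - iota a) * (ev A1 + ev B1 * iota b) - (v - iota b) * (- ev B).
    have hA : (u - iota a) * ev A1 = ev A - iota A.[a].
      by rewrite -(evC u A.[a]) -evB eA !evE.
    have hB : (u - iota a) * ev B1 = ev B - iota B.[a].
      by rewrite -(evC u B.[a]) -evB eB !evE.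
    by rewrite mulrDr mulrA hA hB /el /value rmorphD rmorphM /=; ring.
  apply: (idealB vO); apply: (idealM vO) => //.
    apply: (valuationD vO); first exact: valuation_poly.
    by apply: (valuationM vO); [apply: valuation_poly|apply: valuation_const vO _].
  by apply: (valuationN vO); apply: valuation_poly.
rewrite opprB addrCA subrr addr0; apply: (unit_not_ideal); first by rewrite fmorph_eq0.
by rewrite -fmorphV; apply: (valuation_const vO).
Qed.

Lemma uniformizer_ideal : valuation_ideal O (uniformizer a b).
Proof.
rewrite /uniformizer; case: eqVneq => // b0; move: vb.
by rewrite b0 rmorph0 subr0.
Qed.

(** From [2 v dv = f'(u) du] one has du / 2v = dv / f'(u). Away from branch points [v] is a unit,
    and at branch points [f'(u)] is one by smoothness. *)
Lemma regular_at_dual : regular_at iota O [:: ((v *+ 2)^-1, u)].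
Proof.
have v0 := v_neq0; have n2 := two_neq0.
have O2 : O (2%:R^-1).
  by rewrite -(rmorph_nat iota) -fmorphV; apply: (valuation_const vO).
have [b0|b0] := eqVneq b 0; last first.
  exists [:: ((v *+ 2)^-1, u)]; split=> // x; rewrite inE => /eqP-> /=; split=> //.
  rewrite -mulr_natr invfM; apply: (valuationM vO) => //.
  rewrite (_ : v = el 0 1); last by rewrite /el !evE mul1r add0r.
  by apply: valuation_el_unit; rewrite /value !hornerE.
have fa : f^`().[a] != 0 by apply: (chart_smooth uvf); rewrite -ab b0 expr0n.
have Of : O (ev f^`())^-1.
  by rewrite el_ev; apply: valuation_el_unit; rewrite /value !hornerE.
have f0 : ev f^`() != 0.
  by rewrite el_ev; apply: (el_neq0 (a := a) (b := b)); rewrite /value !hornerE.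
exists [:: ((ev f^`())^-1, v)]; split.
  by move=> x; rewrite inE => /eqP-> /=; split=> //; apply: valuation_v.
move=> D dD; rewrite /deval !big_seq1 /=; have e := derivation_v dD.
have -> : D u = v * D v *+ 2 / ev f^`() by rewrite e mulrC mulKf.
by field; rewrite f0 n2 v0.
Qed.

(** [D] preserves the coordinate ring, hence sends units of the local ring into [O]. An element of
    [O] is such a unit times a power of the parameter, and the parameter itself has its derivative
    in the coordinate ring. *)
Lemma derivation_valuation (D : L -> L) x : derivation iota D -> D u = v *+ 2 -> O x -> O (D x).
Proof.
move=> dD Du Ox; have v0 := v_neq0; have n2 := two_neq0.
have v2n : v *+ 2 != 0 by rewrite -mulr_natr mulf_neq0.
have [->|x0] := eqVneq x 0; first by rewrite (derivation0 dD); apply: (valuation0 vO).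
have Dv := dual_derivation_v dD Du.
have Del A B : O (D (el A B)).
  rewrite (derivation_el dD) Du Dv.
  have -> : (ev A^`() + ev B^`() * v) * (v *+ 2) + ev B * ev f^`() = el A^`() B^`() * (v *+ 2) + ev B * ev f^`() by [].
  apply: (valuationD vO); apply: (valuationM vO); do ?exact: valuation_poly.
    exact: valuation_el.
  exact/(valuationMn vO)/valuation_v.
have Dunit y : local_unit a b y -> O y /\ O (D y).
  case=> A [B [C [E [h h' e]]]].
  have c0 := el_neq0 h'; have Oc := valuation_el_unit h'.
  have ey : y = el A B * (el C E)^-1 by rewrite -e mulfK.
  split; first by rewrite ey; apply: (valuationM vO) => //; apply: valuation_el.
  have -> : D y = (D (el A B) - y * D (el C E)) * (el C E)^-1.
    by rewrite -e (derivationM dD) addrC addKr mulfK.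
  apply: (valuationM vO) => //; apply: (valuationB vO) => //.
  apply: (valuationM vO) => //.
  by rewrite ey; apply: (valuationM vO) => //; apply: valuation_el.
have [A [B [pE _ p0]]] := uniformizer_el a b.
have Op := ideal_valuation vO uniformizer_ideal.
have [k [y [uy ey]]] := local_normal ab x0; have [Oy ODy] := Dunit y uy.
suff [l el'] : exists l, x = uniformizer a b ^+ l * y.
  rewrite el' (derivationM dD) (derivationX dD).
  apply: (valuationD vO); apply: (valuationM vO) => //; first exact: (valuationX vO).
  apply: (valuationMn vO); apply: (valuationM vO); first exact: (valuationX vO).
  by rewrite pE.
case: ey => [->|ey]; first by exists k.
case: k ey => [|k] ey; first by exists 0%N; rewrite expr0 mul1r -ey expr0 mulr1.
(* A negative exponent would put the unit [y] into the maximal ideal. *)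
have : valuation_ideal O y.
  rewrite -ey exprS mulrCA; apply: (idealM vO); first exact: uniformizer_ideal.
  by apply: (valuationM vO) => //; apply: (valuationX vO).
have Oy' := (Dunit _ (local_unit_inv uy)).1.
by move=> /(unit_not_ideal (local_unit_neq0 uy) Oy').
Qed.

End Center.
End AnyValuationRing.
End OneChart.

End Charts.

(** * Gluing the affine curve with a chart at infinity *)

Section TwoCharts.
Variables (K : numClosedFieldType) (L : fieldType) (iota : {rmorphism K -> L}).
Implicit Types (x : L) (A B C : {poly K}).

Lemma derivationV (D : L -> L) x : derivation iota D -> D x^-1 = - (D x / x ^+ 2).
Proof.
move=> dD; have [->|x0] := eqVneq x 0.
  by rewrite invr0 (derivation0 dD) mul0r oppr0.
have := derivationM dD x x^-1; rewrite divff // -(rmorph1 iota) (derivation_const dD).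
move=> /eqP; rewrite eq_sym addr_eq0 => /eqP e.
by apply: (mulfI x0); rewrite e; field.
Qed.

Lemma derivation_opp (D : L -> L) : derivation iota D -> derivation iota (fun x => - D x).
Proof.
move=> dD; split=> [c|x y|x y]; first by rewrite (derivation_const dD) oppr0.
  by rewrite (derivationD dD) opprD.
by rewrite (derivationM dD); ring.
Qed.

Lemma regular_at_opp O w w' : regular_at iota O w -> valuation_ring iota O ->
  (forall D, derivation iota D -> deval w' D = - deval w D) -> regular_at iota O w'.
Proof.
move=> [w1 [hw1 e1]] vO e; exists [seq (- z.1, z.2) | z <- w1]; split.
  move=> _ /mapP[z /hw1[h1 h2] ->] /=; split=> //.
  exact: (valuationN vO).
move=> D dD; rewrite e // e1 // /deval big_map -sumrN.
by apply: eq_bigr => z _; rewrite mulNr.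
Qed.

Definition reverse_poly N A : {poly K} := \poly_(i < N.+1) A`_(N - i).

Lemma ev_reverse (u : L) N A : u != 0 -> (size A <= N.+1)%N ->
  ev iota u A = u ^+ N * ev iota u^-1 (reverse_poly N A).
Proof.
move=> u0 sA; rewrite /ev (@horner_coef_wide _ N.+1) ?size_map_poly //.
rewrite (@horner_coef_wide _ N.+1) ?size_map_poly ?size_poly // mulr_sumr.
rewrite [RHS](reindex_inj rev_ord_inj) /=; apply: eq_bigr => i _.
have iN : (i <= N)%N by rewrite -ltnS.
rewrite !coef_map coef_poly /= subSS ltnS leq_subr subKn // mulrCA.
by rewrite exprVn (exprB iN) ?unitfE // invf_div mulrC [_ * (_ / _)]mulrC divfK ?expf_neq0 // mulrC.
Qed.

Variables (u v : L) (f f' : {poly K}) (dual : L -> L).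
Hypotheses (uvf : chart iota u v f) (uvf' : chart iota u^-1 (v / u ^+ 2) f').
Hypotheses (f'0 : f'.[0] = 0) (d_dual : derivation iota dual) (dual_u : dual u = v *+ 2).

Let u0 : u != 0.
Proof.
apply/eqP => u0; have [|/eqP] := @chart_inj _ _ _ _ _ _ uvf 'X 0.
  by rewrite /el !evE u0 mul0r addr0.
by rewrite polyX_eq0.
Qed.

(** The sign means that [- dual] is the dual derivation of the second chart, and that its
    differential is the negative of the first one. *)
Let dual_u' : - dual u^-1 = v / u ^+ 2 *+ 2.
Proof. by rewrite (derivationV _ d_dual) dual_u; field. Qed.

Lemma regular_dual : regular iota [:: ((v *+ 2)^-1, u)].
Proof.
have v0 := v_neq0 uvf; have n2 := two_neq0 iota.
move=> O vO; case: (pselect (O u)) => [Ou|/(valuationV vO) Ou'].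
  have [a [b [ab ua vb]]] := valuation_center uvf vO Ou.
  exact: (regular_at_dual uvf vO Ou ab).
have [a [b [ab ua vb]]] := valuation_center uvf' vO Ou'.
have h := regular_at_dual uvf' vO Ou' ab ua vb.
apply: (regular_at_opp h vO) => D dD; rewrite /deval !big_seq1 /= (derivationV _ dD).
by field; rewrite u0 v0 n2.
Qed.

Lemma dual_valuation O x : valuation_ring iota O -> O x -> O (dual x).
Proof.
move=> vO Ox; case: (pselect (O u)) => [Ou|/(valuationV vO) Ou'].
  have [a [b [ab ua vb]]] := valuation_center uvf vO Ou.
  exact: (derivation_valuation uvf vO Ou ab).
have [a [b [ab ua vb]]] := valuation_center uvf' vO Ou'.
rewrite -[dual x]opprK; apply: (valuationN vO).
by apply: (derivation_valuation uvf' vO Ou' ab ua vb (derivation_opp d_dual)).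
Qed.

(** The denominator loses its roots one at a time: by [pole] each of them is a root of both
    numerators. *)
Lemma no_finite_pole x : (forall O, valuation_ring iota O -> O x) ->
  exists A B, x = el iota u v A B.
Proof.
move=> hx; have [A [B [C [C0 e]]]] := chart_gen uvf x.
elim: {C}(size C) {-2}C (leqnn (size C)) C0 A B e => [|n IH] C sC C0 A B e.
  by move: C0; rewrite -size_poly_eq0; case: (size C) sC.
have [/eqP/size_poly1P[c c0 eC]|/closed_rootP[a]] := eqVneq (size C) 1%N.
  exists (c^-1%:P * A), (c^-1%:P * B).
  have c0' : iota c != 0 by rewrite fmorph_eq0.
  transitivity ((iota c)^-1 * el iota u v A B).
    by rewrite -e eC evC mulrC mulfK.
  by rewrite /el !evE fmorphV; ring.
move=> /eqP Ca; set b := sqrtC f.[a].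
have ab : b ^+ 2 = f.[a] by rewrite sqrtCK.
have mab : (- b) ^+ 2 = f.[a] by rewrite sqrrN.
have [Aa Ba] := pole uvf ab (hx _ (local_valuation_ring uvf ab))
  (hx _ (local_valuation_ring uvf mab)) e Ca.
have [A1 eA] := root_factor Aa; have [B1 eB] := root_factor Ba.
have [C1 eC] := root_factor Ca.
have C10 : C1 != 0 by apply: contraNneq C0 => C10; rewrite eC C10 mulr0.
apply: (IH C1 _ C10 A1 B1).
  by move: sC; rewrite eC size_monicM ?monicXsubC // size_XsubC.
have Xa0 : 'X - a%:P != 0 by rewrite polyXsubC_eq0.
apply: (mulfI (ev_neq0 uvf Xa0)); transitivity (x * ev iota u C).
  by rewrite eC !evE; ring.
by rewrite e eA eB /el !evE; ring.
Qed.

(** Without finite poles the function is [A + B v] with polynomials [A] and [B]; the remaining point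
    at infinity bounds their degrees. *)
Lemma regular_function_const x : (forall O, valuation_ring iota O -> O x) ->
  exists c, x = iota c.
Proof.
move=> hx; have [A [B e]] := no_finite_pole hx.
have [/andP[/eqP B0 sA]|AB] := boolP ((B == 0) && (size A <= 1)%N).
  by exists A`_0; rewrite e B0 /el ev0 mul0r addr0 {1}(size1_polyC sA) evC.
(* [B v] is [u^2 B] times the second coordinate [v / u^2] of the chart at infinity, so [N] is the
   larger of the degrees of [A] and [u^2 B]. With this choice the value at 0 of one of the reversed
   polynomials is a leading coefficient. *)
pose N := if B == 0 then (size A).-1 else maxn (size A).-1 (size B).+1.
pose A' := reverse_poly N A.
pose B' := if B == 0 then 0 else reverse_poly (N - 2) B.
have N0 : (0 < N)%N.
  move: AB; rewrite /N; case: eqP => [_|_ _]; last by rewrite leq_max ltnS leq0n orbT.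
  by rewrite /= -ltnNge; case: (size A) => [|[]].
have sA : (size A <= N.+1)%N.
  rewrite /N; case: eqP => _; first by case: (size A).
  by apply: leq_trans (leqSpred _) _; rewrite ltnS leq_maxl.
have e' : x * ev iota u^-1 'X^N = el iota u^-1 (v / u ^+ 2) A' B'.
  rewrite e /el mulrDl (ev_reverse u0 sA) !evE exprVn; congr (_ + _).
    by rewrite mulrAC divff ?mul1r ?expf_neq0.
  rewrite /B'; have [->|B0] := eqVneq B 0; first by rewrite !evE !mul0r.
  have hN : ((size B).+1 <= N)%N by rewrite /N (negPf B0) leq_maxr.
  have sB : (size B <= (N - 2).+1)%N.
    by move: B0 hN; rewrite -size_poly_gt0; lia.
  have uN : u ^+ N = u ^+ (N - 2) * u ^+ 2.
    by rewrite -exprD subnK //; move: B0 hN; rewrite -size_poly_gt0; lia.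
  by rewrite (ev_reverse u0 sB) uN; field; rewrite u0 expf_neq0.
(* The point at infinity is a branch point of the second chart, so the two local rings asked for by
   [pole] coincide. *)
have l00 : 0 ^+ 2 = f'.[0] by rewrite f'0 expr0n.
have hl := hx _ (local_valuation_ring uvf' l00).
have [||A'0 B'0] := pole uvf' l00 hl _ e'.
- by rewrite oppr0.
- by rewrite hornerXn expr0n gtn_eqF.
have rev0 n C : (reverse_poly n C).[0] = C`_n.
  by rewrite horner_coef0 coef_poly subn0.
move: AB A'0 B'0; rewrite /A' /B' /N rev0; case: eqVneq => [_|B0 _] /=.
  rewrite -ltnNge -lead_coefE => sA2 /eqP; rewrite lead_coef_eq0 => /eqP A0.
  by move: sA2; rewrite A0 size_poly0.
rewrite rev0; case: leqP => [_ _|hAB + _].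
  rewrite subSS subn1 -lead_coefE => /eqP.
  by rewrite lead_coef_eq0 (negPf B0).
rewrite -lead_coefE => /eqP; rewrite lead_coef_eq0 => /eqP A0.
by move: hAB; rewrite A0 size_poly0.
Qed.

Lemma two_charts_genus : function_field_genus iota 1.
Proof.
have v0 := v_neq0 uvf; have n2 := two_neq0 iota.
have v2n : v *+ 2 != 0 by rewrite -mulr_natr mulf_neq0.
pose w0 := [:: ((v *+ 2)^-1, u)].
have w0E D : deval w0 D = D u / (v *+ 2) by rewrite /deval big_seq1 /= mulrC.
exists [tuple w0]; split=> [i|w rw].
  by rewrite (ord1 i); apply: regular_dual.
have wE D : derivation iota D -> deval w D = deval w dual * deval w0 D.
  move=> dD; rewrite /deval mulr_suml; apply: eq_bigr => z _.
  by rewrite (derivation_scale uvf dD d_dual dual_u) -/(deval w0 D) w0E; ring.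
have [O vO|c ec] := @regular_function_const (deval w dual).
  have [w' [hw' ->]] := rw O vO; last exact: d_dual.
  rewrite /deval big_seq; apply: big_ind => [|x y|z zw'].
  - exact: (valuation0 vO).
  - exact: (valuationD vO).
  by have [h1 h2] := hw' z zw'; apply: (valuationM vO) => //; apply: dual_valuation.
exists [ffun=> c]; split=> [D dD|c' hc'].
  by rewrite big_ord1 ffunE (tnth_nth w0) /= wE // ec.
apply/ffunP => i; rewrite ffunE (ord1 i); apply: (fmorph_inj iota).
rewrite -ec (hc' _ d_dual) big_ord1 (tnth_nth w0) /= w0E dual_u divff // mulr1.
by congr (iota (c' _)); apply: val_inj.
Qed.

End TwoCharts.

(* Instances over an abstract field, as [field] does not terminate on
   [{fraction {poly K}}]. *)
Lemma quadratic_norm_frac (F : fieldType) (n d m e c : F) : d != 0 -> e != 0 ->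
  (n * e) ^+ 2 - (m * d) ^+ 2 * c = (d * e) ^+ 2 * ((n / d) ^+ 2 - (m / e) ^+ 2 * c).
Proof. by move=> d0 e0; field; rewrite d0 e0. Qed.

Lemma quadratic_inv_re (F : fieldType) (a b c : F) : a ^+ 2 - b ^+ 2 * c != 0 ->
  a / (a ^+ 2 - b ^+ 2 * c) * a + - b / (a ^+ 2 - b ^+ 2 * c) * b * c = 1.
Proof. by move=> h; field. Qed.

Lemma common_denominator (F : fieldType) (n d m e : F) : d != 0 -> e != 0 ->
  n / d * (d * e) = n * e /\ m / e * (d * e) = m * d.
Proof. by move=> d0 e0; split; field. Qed.

Lemma cross_multiply (F : fieldType) (n d n1 d1 : F) : d != 0 -> d1 != 0 ->
  n / d = n1 / d1 -> n1 * d = n * d1.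
Proof. by move=> d0 d10 /eqP; rewrite eqr_div // => /eqP ->; rewrite mulrC. Qed.

Lemma quotient_rule_eq (F : fieldType) (n d n1 d1 n' d' n1' d1' : F) :
  n1 * d = n * d1 -> n1' * d + n1 * d' = n' * d1 + n * d1' -> d != 0 -> d1 != 0 ->
  (n1' * d1 - n1 * d1') / d1 ^+ 2 = (n' * d - n * d') / d ^+ 2.
Proof.
move=> h h' d0 d10; apply/eqP; rewrite eqr_div ?expf_neq0 //; apply/eqP.
have -> : (n1' * d1 - n1 * d1') * d ^+ 2 =
  d1 * d * (n1' * d + n1 * d') - (n1 * d) * (d1 * d' + d1' * d) by ring.
by rewrite h' h; ring.
Qed.

Lemma quotient_ruleD (F : fieldType) (n d m e n' d' m' e' : F) : d != 0 -> e != 0 ->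
  ((n' * e + n * e' + (m' * d + m * d')) * (d * e)
    - (n * e + m * d) * (d' * e + d * e')) / (d * e) ^+ 2 =
  (n' * d - n * d') / d ^+ 2 + (m' * e - m * e') / e ^+ 2.
Proof. by move=> d0 e0; field; rewrite d0 e0. Qed.

Lemma quotient_ruleM (F : fieldType) (n d m e n' d' m' e' : F) : d != 0 -> e != 0 ->
  ((n' * m + n * m') * (d * e) - n * m * (d' * e + d * e')) / (d * e) ^+ 2 =
  n / d * ((m' * e - m * e') / e ^+ 2) + (n' * d - n * d') / d ^+ 2 * (m / e).
Proof. by move=> d0 e0; field; rewrite d0 e0. Qed.

(** * The curve v^2 = u^3 - 1: its chart at infinity and its function field *)

Section ChartAtInfinity.
Variables (K : numClosedFieldType) (L : fieldType) (iota : {rmorphism K -> L}).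

Definition cubic : {poly K} := 'X^3 - 1.

Lemma chart_u_neq0 (u v : L) f : chart iota u v f -> u != 0.
Proof.
move=> uvf; apply/eqP => u0; have [|/eqP] := @chart_inj _ _ _ _ _ _ uvf 'X 0.
  by rewrite /el !evE u0 mul0r addr0.
by rewrite polyX_eq0.
Qed.

Lemma reverse_neq0 n (A : {poly K}) :
  (size A <= n.+1)%N -> reverse_poly n A = 0 -> A = 0.
Proof.
move=> sA r0; apply/polyP => i; rewrite coef0.
have [ni|ni] := ltnP n i; first by rewrite nth_default // (leq_trans sA).
have := congr1 (fun p : {poly K} => p`_(n - i)) r0.
by rewrite coef_poly ltnS leq_subr coef0 subKn.
Qed.

(** With [X = 1 / u], the square of [v / u^2] is [(u^3 - 1) / u^4 = X - X^4]. Reversing polynomials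
    passes between the two charts; the factor [u^2] of the second coordinate explains the powers
    ['X^2] below. *)
Lemma chart_infinity (u v : L) :
  chart iota u v cubic -> chart iota u^-1 (v / u ^+ 2) ('X - 'X^4).
Proof.
move=> uvf; have u0 := chart_u_neq0 uvf; have u0' : u^-1 != 0 by rewrite invr_eq0.
have [v2 inj gen _] := uvf.
split.
- rewrite !evE; have -> : (v / u ^+ 2) ^+ 2 = v ^+ 2 / u ^+ 4 by field.
  by rewrite v2 /cubic !evE; field.
- move=> A B; pose n := maxn (size A) (size B).
  have sA : (size A <= n.+1)%N by rewrite leqW ?leq_maxl.
  have sB : (size B <= n.+1)%N by rewrite leqW ?leq_maxr.
  rewrite /el (ev_reverse iota u0' sA) (ev_reverse iota u0' sB) invrK => e.
  have [|A0 B0] := inj ('X^2 * reverse_poly n A) (reverse_poly n B).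
    apply: (mulfI (expf_neq0 n u0')); apply: (mulfI (expf_neq0 2 u0')).
    by rewrite !mulr0 -[RHS]e /el !evE; field.
  move/eqP: A0; rewrite mulf_eq0 expf_eq0 polyX_eq0 /= => /eqP A0.
  by split; apply: (@reverse_neq0 n).
- move=> x; have [A [B [C [C0 e]]]] := gen x.
  pose n := maxn (size A) (maxn (size B) (size C)).
  have sA : (size A <= n.+1)%N by rewrite leqW ?leq_maxl.
  have sB : (size B <= n.+1)%N by rewrite leqW // !leq_max leqnn orbT.
  have sC : (size C <= n.+1)%N by rewrite leqW // !leq_max leqnn !orbT.
  exists ('X^2 * reverse_poly n A), (reverse_poly n B), ('X^2 * reverse_poly n C).
  split.
    rewrite mulf_neq0 ?expf_neq0 ?polyX_eq0 //.
    by apply: contra_neq C0; apply: reverse_neq0.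
  apply: (mulfI (expf_neq0 n u0)); apply: (mulfI (expf_neq0 2 u0)).
  move: e; rewrite /el (ev_reverse iota u0 sA) (ev_reverse iota u0 sB) (ev_reverse iota u0 sC) => e.
  transitivity (x * (u ^+ n * ev iota u^-1 (reverse_poly n C))).
    by rewrite !evE; field.
  by rewrite e !evE; field.
- move=> a; have -> : ('X - 'X^4)^`().[a] = 1 - 4%:R * a ^+ 3 :> K.
    by rewrite derivB derivX derivXn hornerD hornerN hornerC hornerMn hornerXn mulr_natl.
  rewrite !(hornerD, hornerN, hornerX, hornerXn).
  have -> : a - a ^+ 4 = a * (1 - a ^+ 3) by ring.
  move=> /eqP; rewrite mulf_eq0 => /orP[/eqP->|].
    by rewrite expr0n mulr0 subr0 oner_eq0.
  rewrite subr_eq0 => /eqP <-; rewrite (_ : 1 - 4%:R * 1 = - 3%:R); last by ring.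
  by rewrite oppr_eq0 pnatr_eq0.
Qed.

End ChartAtInfinity.


Section WeierstrassField.
Variable K : numClosedFieldType.
Local Notation k := {fraction {poly K}}.
Local Notation "x %:F" := (tofrac x).

(* The function field K(u)(v) of v^2 = u^3 - 1; (p, q) stands for p + q v. *)
Definition cubic_field : Type := (k * k)%type.

HB.instance Definition _ := GRing.Zmodule.on cubic_field.

Implicit Types (x y z : cubic_field).

Definition cf_one : cubic_field := (1, 0).
Definition cf_mul x y : cubic_field :=
  (x.1 * y.1 + x.2 * y.2 * (cubic K)%:F, x.1 * y.2 + x.2 * y.1).
Definition cf_norm x : k := x.1 ^+ 2 - x.2 ^+ 2 * (cubic K)%:F.
Definition cf_inv x : cubic_field := (x.1 / cf_norm x, - x.2 / cf_norm x).

Lemma cf_mulA : associative cf_mul.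
Proof. by move=> x y z; rewrite /cf_mul /=; congr (_, _); ring. Qed.
Lemma cf_mulC : commutative cf_mul.
Proof. by move=> x y; rewrite /cf_mul; congr (_, _); ring. Qed.
Lemma cf_mul1 : left_id cf_one cf_mul.
Proof. by case=> a b; rewrite /cf_mul /=; congr (_, _); ring. Qed.
Lemma cf_mulD : left_distributive cf_mul +%R.
Proof. by move=> x y z; rewrite /cf_mul; congr (_, _) => /=; ring. Qed.
Lemma cf_one_neq0 : cf_one != 0.
Proof. by rewrite xpair_eqE oner_eq0. Qed.

HB.instance Definition _ := GRing.Zmodule_isComNzRing.Build cubic_field
  cf_mulA cf_mulC cf_mul1 cf_mulD cf_one_neq0.

Lemma size_cubic : size (cubic K) = 4%N.
Proof. by rewrite /cubic -polyC1 size_XnsubC. Qed.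

Lemma fractionP (a : k) : exists nd : {poly K} * {poly K},
  nd.2 != 0 /\ a = nd.1%:F / nd.2%:F.
Proof.
elim/quotW: a => r; exists (\n_r, \d_r); split; first exact: denom_ratioP.
have d0 : (\d_r)%:F != 0 by rewrite tofrac_eq0 denom_ratioP.
apply: (mulIf d0); rewrite divfK //; unlock FracField.tofrac.
rewrite -[LHS]FracField.pi_mul; apply/eqmodP => /=; rewrite FracField.equivfE /=.
rewrite /FracField.mulf /= !numden_Ratio ?mulf_neq0 ?oner_neq0 ?denom_ratioP //.
by rewrite !mulr1 mulrC.
Qed.

Lemma norm_eq0_poly (n d m e c : {poly K}) : d != 0 -> e != 0 ->
  (n%:F / d%:F) ^+ 2 - (m%:F / e%:F) ^+ 2 * c%:F = 0 ->
  (n * e) ^+ 2 = (m * d) ^+ 2 * c.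
Proof.
rewrite -(tofrac_eq0 d) -(tofrac_eq0 e) => d0 e0 h.
apply/eqP; rewrite -subr_eq0 -tofrac_eq0.
have -> : ((n * e) ^+ 2 - (m * d) ^+ 2 * c)%:F =
    (n%:F * e%:F) ^+ 2 - (m%:F * d%:F) ^+ 2 * c%:F.
  by rewrite !(rmorphB, rmorphM, rmorphXn).
by apply/eqP; rewrite (quadratic_norm_frac _ _ _ d0 e0) h mulr0.
Qed.

(** The cubic has odd degree, so it is not a square in K(u): after clearing denominators the two
    sides would have degrees of different parity. *)
Lemma cf_norm_eq0 x : cf_norm x = 0 -> x = 0.
Proof.
case: x => a b; rewrite /cf_norm /=.
have [[n d] [/= d0 ->]] := fractionP a; have [[m e] [/= e0 ->]] := fractionP b.
have d0' : d%:F != 0 by rewrite tofrac_eq0.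
have e0' : e%:F != 0 by rewrite tofrac_eq0.
move=> /(norm_eq0_poly d0 e0).
have c0 : cubic K != 0 by rewrite -size_poly_eq0 size_cubic.
have [->|m0] := eqVneq m 0.
  rewrite mul0r expr0n mul0r => /eqP; rewrite expf_eq0 /= mulf_eq0 (negPf e0) orbF.
  by move=> /eqP->; rewrite !tofrac0 !mul0r.
have md0 : m * d != 0 by rewrite mulf_neq0.
have [n0|ne0] := eqVneq (n * e) 0.
  rewrite n0 expr0n => /esym/eqP; rewrite mulf_eq0 expf_eq0 (negPf md0) (negPf c0).
  by [].
move=> /(congr1 (fun p : {poly K} => size p)).
rewrite [RHS](size_mul (expf_neq0 2 md0) c0) size_cubic.
have := size_exp (n * e) 2; have := size_exp (m * d) 2.
have := expf_neq0 2 ne0; have := expf_neq0 2 md0.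
have parity (s t i j : nat) : (0 < i)%N -> (0 < j)%N -> (0 < t)%N -> (0 < s)%N ->
  t.-1 = (j.-1 * 2)%N -> s.-1 = (i.-1 * 2)%N -> s = (t + 4).-1 -> False by lia.
move: ne0 md0; rewrite -!size_poly_gt0 => h1 h2 h3 h4 h5 h6 h7.
by case: (parity _ _ _ _ h1 h2 h3 h4 h5 h6 h7).
Qed.

Lemma cf_mulVf x : x != 0 -> cf_mul (cf_inv x) x = cf_one.
Proof.
move=> x0; have n0 : cf_norm x != 0 by apply: contra_neq x0; apply: cf_norm_eq0.
rewrite /cf_mul /cf_inv /cf_one /=; congr (_, _); last by ring.
exact: quadratic_inv_re.
Qed.

Lemma cf_inv0 : cf_inv 0 = 0.
Proof. by rewrite /cf_inv /= oppr0 !mul0r. Qed.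

HB.instance Definition _ := GRing.ComNzRing_isField.Build cubic_field cf_mulVf cf_inv0.

Definition cf_const (c : K) : cubic_field := (c%:P%:F, 0).

Lemma cf_const_zmod : zmod_morphism cf_const.
Proof. by move=> a b; rewrite /cf_const rmorphB tofracB; congr (_, _); rewrite subr0. Qed.

Lemma cf_const_monoid : monoid_morphism cf_const.
Proof.
split; first by rewrite /cf_const tofrac1.
move=> a b; rewrite /cf_const rmorphM tofracM; congr (_, _) => /=; ring.
Qed.

HB.instance Definition _ := GRing.isZmodMorphism.Build K cubic_field cf_const cf_const_zmod.
HB.instance Definition _ := GRing.isMonoidMorphism.Build K cubic_field cf_const cf_const_monoid.

Definition cf_u : cubic_field := ('X%:F, 0).
Definition cf_v : cubic_field := (0, 1).

Lemma cf_ev A : ev cf_const cf_u A = (A%:F, 0).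
Proof.
elim/poly_ind: A => [|A c IH]; first by rewrite ev0 tofrac0.
rewrite !evE IH tofracD tofracM; congr (_, _) => /=; ring.
Qed.

Lemma cf_el A B : el cf_const cf_u cf_v A B = (A%:F, B%:F).
Proof. by rewrite /el !cf_ev; congr (_, _) => /=; ring. Qed.

Lemma cf_chart : chart cf_const cf_u cf_v (cubic K).
Proof.
split.
- by rewrite cf_ev; congr (_, _) => /=; ring.
- by move=> A B; rewrite cf_el => -[/eqP + /eqP]; rewrite !tofrac_eq0 => /eqP-> /eqP->.
- case=> a b; have [[n d] [/= d0 ->]] := fractionP a.
  have [[m e] [/= e0 ->]] := fractionP b.
  have d0' : d%:F != 0 by rewrite tofrac_eq0.
  have e0' : e%:F != 0 by rewrite tofrac_eq0.
  exists (n * e), (m * d), (d * e); split; first by rewrite mulf_neq0.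
  have [h1 h2] := common_denominator n%:F m%:F d0' e0'.
  by rewrite cf_ev cf_el !tofracM -h1 -h2; congr (_, _) => /=; ring.
- move=> a; rewrite /cubic -polyC1 derivB derivXn derivC subr0 hornerMn hornerXn.
  rewrite !hornerE => /eqP; rewrite subr_eq0 => /eqP a3.
  apply/eqP => /eqP; rewrite mulrn_eq0 /= => /eqP a2.
  by move/eqP: a3; rewrite exprS a2 mulr0 eq_sym oner_eq0.
Qed.

(** The quotient rule applied to a chosen representative; [frac_derivE] shows independence of the
    choice. *)
Definition frac_deriv (a : k) : k :=
  let: nd := projT1 (cid (fractionP a)) in
  (nd.1^`() * nd.2 - nd.1 * nd.2^`())%:F / (nd.2 ^+ 2)%:F.

Lemma frac_derivE (n d : {poly K}) : d != 0 -> frac_deriv (n%:F / d%:F) =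
  (n^`()%:F * d%:F - n%:F * d^`()%:F) / d%:F ^+ 2.
Proof.
move=> d0; rewrite /frac_deriv; case: cid => [[n1 d1] [/= d10 e]].
have d0' : d%:F != 0 by rewrite tofrac_eq0.
have d10' : d1%:F != 0 by rewrite tofrac_eq0.
have h := cross_multiply d0' d10' e.
have {}h : n1 * d = n * d1 by apply/eqP; rewrite -tofrac_eq !tofracM h.
have := congr1 (fun p : {poly K} => p^`()%:F) h; have := congr1 (fun p : {poly K} => p%:F) h.
rewrite expr2 tofracB !tofracM -expr2 !derivM !tofracD !tofracM.
by move=> h1 h2; rewrite (quotient_rule_eq h1 h2 d0' d10').
Qed.

Lemma frac_derivC (n : {poly K}) : frac_deriv n%:F = n^`()%:F.
Proof.
have -> : n%:F = n%:F / 1%:F by rewrite tofrac1 divr1.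
rewrite (frac_derivE _ (oner_neq0 _)) -polyC1 derivC tofrac0 polyC1 tofrac1.
by rewrite mulr0 subr0 mulr1 expr1n divr1.
Qed.

Lemma frac_derivD (a b : k) : frac_deriv (a + b) = frac_deriv a + frac_deriv b.
Proof.
have [[n d] [/= d0 ->]] := fractionP a; have [[m e] [/= e0 ->]] := fractionP b.
have d0' : d%:F != 0 by rewrite tofrac_eq0.
have e0' : e%:F != 0 by rewrite tofrac_eq0.
rewrite (addf_div _ _ d0' e0') -!tofracM -tofracD.
rewrite (frac_derivE _ d0) (frac_derivE _ e0) (frac_derivE _ (mulf_neq0 d0 e0)).
rewrite derivD !derivM !(tofracD, tofracM); by rewrite (quotient_ruleD _ _ _ _ _ _ d0' e0').
Qed.

Lemma frac_derivM (a b : k) :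
  frac_deriv (a * b) = a * frac_deriv b + frac_deriv a * b.
Proof.
have [[n d] [/= d0 ->]] := fractionP a; have [[m e] [/= e0 ->]] := fractionP b.
have d0' : d%:F != 0 by rewrite tofrac_eq0.
have e0' : e%:F != 0 by rewrite tofrac_eq0.
rewrite mulf_div -!tofracM.
rewrite (frac_derivE _ d0) (frac_derivE _ e0) (frac_derivE _ (mulf_neq0 d0 e0)).
rewrite !derivM !(tofracD, tofracM); by rewrite (quotient_ruleM _ _ _ _ _ _ d0' e0').
Qed.

(** The derivation [2 v d/du]. As [v^2 = f], it sends [v] to [f'], and [p + q v] to
    [(2 f q' + q f') + 2 p' v]. *)
Definition cf_dual x : cubic_field :=
  (2%:R * (cubic K)%:F * frac_deriv x.2 + x.2 * (cubic K)^`()%:F,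
   2%:R * frac_deriv x.1).

Lemma cf_dual_derivation : derivation cf_const cf_dual.
Proof.
have d0 : frac_deriv 0 = 0 by rewrite -tofrac0 frac_derivC deriv0.
split=> [c|[a b] [a' b']|[a b] [a' b']]; rewrite /cf_dual /=.
- by rewrite d0 frac_derivC derivC tofrac0 !mulr0 mul0r addr0.
- by rewrite !frac_derivD; congr (_, _) => /=; ring.
- rewrite !(frac_derivD, frac_derivM) frac_derivC; congr (_, _) => /=; ring.
Qed.

Lemma cf_dual_u : cf_dual cf_u = cf_v *+ 2.
Proof.
have d0 : frac_deriv 0 = 0 by rewrite -tofrac0 frac_derivC deriv0.
rewrite /cf_dual /= d0 frac_derivC derivX tofrac1; congr (_, _) => /=; ring.
Qed.

Lemma cubic_field_genus : function_field_genus cf_const 1.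
Proof.
apply: (two_charts_genus cf_chart (chart_infinity cf_chart) _ cf_dual_derivation cf_dual_u).
by rewrite hornerD hornerN hornerX hornerXn expr0n subr0.
Qed.

End WeierstrassField.

(** * Function fields of plane curves *)

Lemma comp_comp_scale (K : fieldType) (Q Q' : 3.-tuple {mpoly K[3]}) h A k :
  A \is k.-homog -> (forall i, tnth Q' i \mPo Q = h * 'X_i) ->
  (A \mPo Q') \mPo Q = h ^+ k * A.
Proof.
move=> hA e; rewrite {1}/comp_mpoly mmap_comp.
rewrite (@mmap_eq _ _ _ _ _ (fun i => h * 'X_i)) // (mmap_scale _ _ _ hA).
congr (_ * _); rewrite -[RHS]comp_mpoly_id; apply: mmap_eq => i.
by rewrite tnth_mktuple.
Qed.

Section FunctionFields.
Variables (K L : fieldType) (iota : {rmorphism K -> L}).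
Implicit Types (A B C H : {mpoly K[3]}) (xi : 'I_3 -> L).

Section Irreducible.
Variables (H : {mpoly K[3]}) (d : nat) (xi : 'I_3 -> L).
Hypotheses (H0 : H != 0) (hH : H \is d.-homog) (ff : is_function_field H iota xi).

(** Restriction to the generic line of the cone over the curve. The new variable records the degree,
    so that factors of [H] that are not known to be homogeneous can be tested component by
    component. *)
Let cone A : {poly L} := mmap (polyC \o iota) (fun i => (xi i)%:P * 'X) A.

Let cone_coef A k : (cone A)`_k = mmap iota xi (pihomog mdeg k A).
Proof.
rewrite /cone {1}/mmap coef_sum pihomogE raddf_sum /= [RHS]big_mkcond /=.
apply: eq_bigr => m _; rewrite /mmap1.
have -> : \prod_(i < 3) ((xi i)%:P * 'X) ^+ m i =
    (\prod_(i < 3) xi i ^+ m i)%:P * 'X^(mdeg m).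
  rewrite mdegE -prodrXr rmorph_prod -big_split /=.
  by apply: eq_bigr => i _; rewrite exprMn rmorphXn.
rewrite mulrA -polyCM coefCM coefXn eq_sym.
by case: eqP => _; rewrite ?mulr1 ?mulr0 // mmapZ mmapX /mmap1.
Qed.

Let cone_eq0 A : cone A = 0 -> divides H A.
Proof.
move=> A0; rewrite (pihomog_partitionE (leqnn (msize A))).
elim/big_ind: _ => [|B C|i _]; [exact: divides0|exact: dividesD|].
have [_ h _] := ff; apply/(h i); first exact: pihomogP.
by rewrite -cone_coef A0 coef0.
Qed.

(** [cone] takes values in a domain and its kernel consists of multiples of [H]. Hence one factor of
    [H] is itself a multiple of [H], and the other is a unit. *)
Lemma function_field_irreducible : irreducible H.
Proof.
have [[i xi0] h _] := ff.
have Hxi : mmap iota xi H = 0 by apply/(h d) => //; apply: divides_refl.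
split=> // [|A B e].
  apply/negP => /unitrPr[G HG]; move/eqP: xi0; apply.
  have <- : mmap iota xi 'X_i = xi i by rewrite mmapX mmap1U.
  apply/(h 1%N); first by rewrite dhomogX /= mdeg1.
  by exists ('X_i * G); rewrite -mulrA [G * H]mulrC HG mulr1.
have : cone A * cone B = 0.
  rewrite -[LHS](rmorphM (mmap _ _)) -e; apply/polyP => k; rewrite coef0 cone_coef.
  have [->|kd] := eqVneq k d; first by rewrite pihomog_dE.
  by rewrite (@pihomog_ne0 _ _ mdeg d) ?mmap0 // eq_sym.
move=> /eqP; rewrite mulf_eq0 => /orP[]/eqP/cone_eq0[C eC]; [right|left].
  apply/unitrPr; exists C; apply: (mulfI H0).
  by rewrite mulr1 {2}e eC; ring.
apply/unitrPr; exists C; apply: (mulfI H0).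
by rewrite mulr1 {2}e eC; ring.
Qed.

End Irreducible.

(** The field stays the same and the generic point is moved by [Q']. The nonvanishing of [h'] and
    [g] says that neither curve is contracted, and [strip] that [H'] shares no factor with [h]. *)
Lemma function_field_transport (H H' g h h' : {mpoly K[3]})
    (Q Q' : 3.-tuple {mpoly K[3]}) (d e e' : nat) xi :
  let xi' i := mmap iota xi (tnth Q' i) in
  is_function_field H iota xi -> H \is d.-homog ->
  (0 < e)%N -> (forall i, tnth Q i \is e.-homog) -> (forall i, tnth Q' i \is e'.-homog) ->
  (forall i, tnth Q i \mPo Q' = h' * 'X_i) -> (forall i, tnth Q' i \mPo Q = h * 'X_i) ->
  H \mPo Q = g * H' ->
  mmap iota xi h' != 0 -> mmap iota xi' g != 0 ->
  (forall A k, divides H' (h ^+ k * A) -> divides H' A) ->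
  is_function_field H' iota xi'.
Proof.
move=> xi' [[i0 xi0] ffH ffL] hH e0 hQ hQ' QQ' Q'Q eH h'0 g0 strip.
have Qxi' i : mmap iota xi' (tnth Q i) = mmap iota xi h' * xi i.
  by rewrite -mmap_comp QQ' rmorphM /= mmapX mmap1U.
have comp_xi' (k : nat) A : A \is k.-homog ->
    mmap iota xi' (A \mPo Q) = mmap iota xi h' ^+ k * mmap iota xi A.
  move=> hA; rewrite mmap_comp -(mmap_scale _ _ _ hA).
  exact: mmap_eq.
split.
- apply: contrapT => n; move/eqP: xi0; apply; apply: (mulfI h'0).
  rewrite mulr0 -Qxi'.
  have -> : mmap iota xi' (tnth Q i0) = mmap iota (fun i => 0 * xi' i) (tnth Q i0).
    apply: mmap_eq => i; rewrite mul0r; apply: contrapT => /eqP h0.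
    by apply: n; exists i.
  by rewrite (mmap_scale _ _ _ (hQ i0)) expr0n gtn_eqF // mul0r.
- move=> a A hA; split=> [A0|[C ->]]; last first.
    suff -> : mmap iota xi' (C * H') = mmap iota xi' C * mmap iota xi' H'.
      suff -> : mmap iota xi' H' = 0 by rewrite mulr0.
      apply: (mulfI g0); rewrite mulr0 -rmorphM /= -eH (comp_xi' d) //.
      by rewrite (ffH d H hH).2 ?mulr0 //; apply: divides_refl.
    by rewrite rmorphM.
  (* Composition with [Q] turns [A \mPo Q'] into a power of [h] times [A]; [strip] then removes this
     power. *)
  have [C eC] : divides H (A \mPo Q').
    by apply/(ffH _ _ (dhomog_comp hA hQ')); rewrite mmap_comp.
  apply: (strip A a); exists ((C \mPo Q) * g).
  by rewrite -mulrA -eH -rmorphM /= -eC (comp_comp_scale hA Q'Q).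
- move=> f; have [a [A [B [hA hB B0 ->]]]] := ffL f.
  exists (a * e)%N, (A \mPo Q), (B \mPo Q); split; try exact: dhomog_comp.
    by rewrite (comp_xi' a) // mulf_neq0 ?expf_neq0.
  by rewrite !(comp_xi' a) // -mulf_div divff ?mul1r ?expf_neq0.
Qed.

End FunctionFields.

(** * The plane cubic y^2 z = x^3 - z^3 *)

Section Weierstrass.
Variable K : numClosedFieldType.
Implicit Types (A B C : {mpoly K[3]}).
Local Notation x := (vx K).
Local Notation y := (vy K).
Local Notation z := (vz K).
Local Notation ix := (@Ordinal 3 0 isT).
Local Notation iy := (@Ordinal 3 1 isT).
Local Notation iz := (@Ordinal 3 2 isT).

Definition weierstrass : {mpoly K[3]} := y ^+ 2 * z - (x ^+ 3 - z ^+ 3).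

Definition cf_point (i : 'I_3) : cubic_field K :=
  tnth [tuple cf_u K; cf_v K; 1] i.

Local Notation cf_eval := (mmap (@cf_const K) cf_point).

Lemma mpolyX3 (m : 'X_{1..3}) :
  'X_[m] = x ^+ m ix * y ^+ m iy * z ^+ m iz :> {mpoly K[3]}.
Proof.
rewrite mpolyXE_id !big_ord_recl big_ord0 mulr1 -!mulrA /vx /vy /vz.
by congr (_ * (_ * _)); congr ('X_[_] ^+ m _); do ?congr U_(_)%MM; apply: val_inj.
Qed.

Lemma mdeg3 (m : 'X_{1..3}) : mdeg m = (m ix + m iy + m iz)%N.
Proof.
rewrite mdegE !big_ord_recl big_ord0 addn0 -addnA.
by congr (_ + (_ + _))%N; congr (m _); apply: val_inj.
Qed.

Lemma cf_eval_var : [/\ cf_eval x = cf_u K, cf_eval y = cf_v K & cf_eval z = 1].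
Proof. by rewrite /vx /vy /vz !mmapX !mmap1U. Qed.

Lemma cf_eval_weierstrass : cf_eval weierstrass = 0.
Proof.
have [ex ey ez] := cf_eval_var.
rewrite /weierstrass !(rmorphB, rmorphM, rmorphXn) /= ex ey ez.
have := chart_eq (cf_chart K); rewrite /cubic !evE expr2 => e.
by rewrite mulr1 e; ring.
Qed.

(** In characteristic 0 this means that [A] belongs to K[x, z]. *)
Definition y_free A := mderiv iy A = 0.

Lemma y_freeP A m : y_free A -> m \in msupp A -> m iy = 0%N.
Proof.
move=> hA; rewrite mcoeff_msupp; apply: contraNeq => m0.
have := congr1 (mcoeff (m - U_(iy))%MM) hA.
rewrite mcoeff_mderiv mcoeff0 submK ?lep1mP // => /eqP.
by rewrite mulrn_eq0 /= => /eqP->.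
Qed.

Lemma y_freeM A B : y_free A -> y_free B -> y_free (A * B).
Proof. by rewrite /y_free mderivM => -> ->; rewrite mul0r mulr0 addr0. Qed.

Lemma y_freeX A n : y_free A -> y_free (A ^+ n).
Proof.
move=> hA; elim: n => [|n IH]; last by rewrite exprS; apply: y_freeM.
by rewrite expr0 /y_free -mpolyC1 mderivC.
Qed.

Lemma y_free_sum (I : Type) (s : seq I) (P : pred I) (F : I -> {mpoly K[3]}) :
  (forall i, y_free (F i)) -> y_free (\sum_(i <- s | P i) F i).
Proof. by move=> h; rewrite /y_free raddf_sum big1 // => i _; apply: h. Qed.

Lemma y_freeZ c A : y_free A -> y_free (c *: A).
Proof. by rewrite /y_free mderivZ => ->; rewrite scaler0. Qed.

Lemma y_free_x : y_free x. Proof. by rewrite /y_free mderiv_var. Qed.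
Lemma y_free_z : y_free z. Proof. by rewrite /y_free mderiv_var. Qed.

Definition dehomogenize A : {poly K} := \sum_(m <- msupp A) A@_m *: 'X^(m ix).

Lemma cf_eval_y_free A : y_free A ->
  cf_eval A = ev (@cf_const K) (cf_u K) (dehomogenize A).
Proof.
move=> hA; rewrite /mmap /dehomogenize /ev raddf_sum horner_sum.
apply: eq_big_seq => m mA; rewrite /= map_polyZ hornerZ map_polyXn hornerXn.
congr (_ * _); have -> : mmap1 cf_point m = cf_eval 'X_[m] by rewrite mmapX.
rewrite mpolyX3 (y_freeP hA mA) expr0 mulr1.
have [ex ey ez] := cf_eval_var.
by rewrite rmorphM !rmorphXn /= ex ez expr1n mulr1.
Qed.

Lemma dehomogenize_eq0 A N : A \is N.-homog -> y_free A -> dehomogenize A = 0 -> A = 0.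
Proof.
move=> hA fA d0; apply/mpolyP => m; rewrite mcoeff0; apply/eqP.
apply: contra_eqT (congr1 (fun p : {poly K} => p`_(m ix)) d0) => mA.
have {}mA : m \in msupp A by rewrite mcoeff_msupp.
rewrite coef0 coef_sum (bigD1_seq m) //= big1_seq => [|m' /andP[m'm m'A]].
  by rewrite coefZ coefXn eqxx mulr1 addr0 -mcoeff_msupp.
rewrite coefZ coefXn; case: eqP => [e|_]; last by rewrite mulr0.
case/eqP: m'm; apply/mnmP => i.
have := dhomog_mf hA mA; have := dhomog_mf hA m'A; rewrite /= !mdeg3.
rewrite (y_freeP fA mA) (y_freeP fA m'A) -e => <- /eqP; rewrite !addn0 eqn_add2l => /eqP ez.
case: i => [[|[|[|i]]] hi] //.
- by have -> : Ordinal hi = ix by apply: val_inj.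
- have -> : Ordinal hi = iy by apply: val_inj.
  by rewrite (y_freeP fA mA) (y_freeP fA m'A).
- by have -> : Ordinal hi = iz by apply: val_inj.
Qed.

Lemma dvd_sub_exp (R : comNzRingType) (a b : R) n : exists c, a ^+ n - b ^+ n = c * (a - b).
Proof. by rewrite subrXX mulrC; eexists. Qed.

(* Modulo the curve, z^(mdeg m) times the monomial m is reduced_monomial m
   times y if m iy is odd. *)
Definition reduced_monomial (m : 'X_{1..3}) : {mpoly K[3]} :=
  x ^+ m ix * (x ^+ 3 - z ^+ 3) ^+ (m iy)./2 * z ^+ (mdeg m + m iz - (m iy)./2).

Lemma reduced_monomial_y_free m : y_free (reduced_monomial m).
Proof.
have xf := y_free_x; have zf := y_free_z.
apply: y_freeM; last exact: y_freeX.
apply: y_freeM; first exact: y_freeX.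
by apply: y_freeX; rewrite /y_free mderivB (y_freeX 3 xf) (y_freeX 3 zf) subrr.
Qed.

Lemma var_homog i : ('X_i : {mpoly K[3]}) \is 1.-homog.
Proof. by rewrite dhomogX /= mdeg1. Qed.

Lemma var_exp_homog i n : ('X_i ^+ n : {mpoly K[3]}) \is n.-homog.
Proof. by rewrite -{2}[n]mul1n; apply/dhomogMn/var_homog. Qed.

Lemma reduced_monomial_homog m :
  reduced_monomial m \is (mdeg m * 2 - odd (m iy)).-homog.
Proof.
have -> : (mdeg m * 2 - odd (m iy))%N =
    (m ix + 3 * (m iy)./2 + (mdeg m + m iz - (m iy)./2))%N.
  have := odd_double_half (m iy); rewrite mdeg3; lia.
apply: dhomogM; last exact: var_exp_homog.
apply: dhomogM; first exact: var_exp_homog.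
by apply: dhomogMn; apply: rpredB; apply: var_exp_homog.
Qed.

Lemma reduced_monomial_divides m : divides weierstrass
  (z ^+ mdeg m * 'X_[m] - reduced_monomial m * y ^+ odd (m iy)).
Proof.
have [c e] := dvd_sub_exp (y ^+ 2 * z) (x ^+ 3 - z ^+ 3) (m iy)./2.
exists (x ^+ m ix * y ^+ odd (m iy) * z ^+ (mdeg m + m iz - (m iy)./2) * c).
rewrite -mulrA -/weierstrass -e mpolyX3 /reduced_monomial.
have ey : m iy = (odd (m iy) + 2 * (m iy)./2)%N.
  by rewrite mul2n odd_double_half.
have ez : z ^+ mdeg m * z ^+ m iz =
    z ^+ (mdeg m + m iz - (m iy)./2) * z ^+ (m iy)./2.
  rewrite -!exprD subnK //; move: ey; rewrite mdeg3; lia.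
rewrite {1}ey exprD exprM mulrBr; congr (_ - _); last by ring.
rewrite [in RHS]exprMn.
transitivity (x ^+ m ix * (y ^+ odd (m iy) * (y ^+ 2) ^+ (m iy)./2) *
   (z ^+ mdeg m * z ^+ m iz)); first by ring.
by rewrite ez; ring.
Qed.

Lemma weierstrass_homog : weierstrass \is 3.-homog.
Proof.
apply: rpredB; last by apply: rpredB; apply: var_exp_homog.
by apply: (@dhomogM _ _ _ 2 _ 1); [apply: var_exp_homog|apply: var_homog].
Qed.

(** Extra powers of [z] allow every [y^2 z] to be replaced modulo the curve, which leaves
    [part false + part true * y] with both parts in K[x, z]. Its value [p + q v] vanishes only if
    [p] and [q] do; setting [z = 1] loses nothing on homogeneous polynomials, and the prime [z] is
    removed at the end. *)
Lemma weierstrass_vanish A d : A \is d.-homog -> cf_eval A = 0 -> divides weierstrass A.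
Proof.
move=> hA A0; have [ex ey ez] := cf_eval_var.
pose part (b : bool) : {mpoly K[3]} :=
  \sum_(m <- msupp A | odd (m iy) == b) A@_m *: reduced_monomial m.
have part_free b : y_free (part b).
  by apply: y_free_sum => m; apply/y_freeZ/reduced_monomial_y_free.
have part_homog b : part b \is (d * 2 - b).-homog.
  rewrite /part big_seq_cond; apply: rpred_sum => m /andP[mA /eqP <-].
  by apply: rpredZ; rewrite -(dhomog_mf hA mA); apply: reduced_monomial_homog.
have [C eC] : divides weierstrass (z ^+ d * A - (part false + part true * y)).
  have -> : z ^+ d * A - (part false + part true * y) = \sum_(m <- msupp A)
      A@_m *: (z ^+ d * 'X_[m] - reduced_monomial m * y ^+ odd (m iy)).
    rewrite {1}(mpolyE A) mulr_sumr /part mulr_suml.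
    have -> : \sum_(m <- msupp A | odd (m iy) == false) A@_m *: reduced_monomial m +
        \sum_(m <- msupp A | odd (m iy) == true) A@_m *: reduced_monomial m * y =
        \sum_(m <- msupp A) A@_m *: (reduced_monomial m * y ^+ odd (m iy)).
      rewrite [RHS](bigID (fun m : 'X_{1..3} => odd (m iy) == false)) /=; congr (_ + _).
        by apply: eq_bigr => m /eqP->; rewrite mulr1.
      apply: eq_big => [m|m /eqP->]; first by case: (odd _).
      by rewrite -scalerAl.
    by rewrite -sumrB; apply: eq_bigr => m _; rewrite -scalerAr scalerBr.
  rewrite big_seq; elim/big_ind: _ => [|B C|m mA]; [exact: divides0|exact: dividesD|].
  by apply: dividesZ; rewrite -(dhomog_mf hA mA); apply: reduced_monomial_divides.
have : cf_eval (part false) + cf_eval (part true) * cf_v K = 0.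
  have := congr1 cf_eval eC; rewrite rmorphB rmorphD !rmorphM /=.
  rewrite cf_eval_weierstrass ey A0 !mulr0 sub0r => /eqP.
  by rewrite oppr_eq0 => /eqP.
rewrite !cf_eval_y_free // => /(chart_inj (cf_chart K))[h1 h2].
move: eC; rewrite (dehomogenize_eq0 (part_homog false) (part_free false) h1).
rewrite (dehomogenize_eq0 (part_homog true) (part_free true) h2) mul0r addr0 subr0 => eC.
apply: (@divides_strip_prod _ (nseq d z)); last first.
  by rewrite big_nseq iter_mulr_1; exists C.
move=> l; rewrite mem_nseq => /andP[_ /eqP->]; split; first exact: var_prime.
case=> D /(congr1 (meval (fun i => (i == ix)%:R))).
rewrite /weierstrass !(rmorphB, rmorphM, rmorphXn) /= !mevalXU /=.
rewrite !(mulr0, mulr1, sub0r, subr0) => /eqP.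
by rewrite oppr_eq0 oner_eq0.
Qed.

Lemma homogenize (A : {poly K}) n : (size A <= n.+1)%N -> exists B : {mpoly K[3]},
  B \is n.-homog /\ cf_eval B = ev (@cf_const K) (cf_u K) A.
Proof.
have [ex ey ez] := cf_eval_var; move=> sA.
exists (\sum_(i < n.+1) A`_i *: (x ^+ i * z ^+ (n - i))); split.
  apply: rpred_sum => i _; apply: rpredZ.
  have := dhomogM (var_exp_homog ix i) (var_exp_homog iz (n - i)).
  by rewrite subnKC // -ltnS.
rewrite raddf_sum /ev (@horner_coef_wide _ n.+1) ?size_map_poly //=.
apply: eq_bigr => i _; rewrite mmapZ coef_map /=; congr (_ * _).
by rewrite rmorphM !rmorphXn /= ex ez expr1n mulr1.
Qed.

Lemma weierstrass_function_field : is_function_field weierstrass (@cf_const K) cf_point.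
Proof.
have [ex ey ez] := cf_eval_var.
split.
- by exists iz; apply: oner_neq0.
- move=> d A hA; split; first exact: weierstrass_vanish hA.
  by case=> C ->; rewrite rmorphM /= cf_eval_weierstrass mulr0.
- move=> f; have [A [B [C [C0 e]]]] := chart_gen (cf_chart K) f.
  pose n := maxn (size A) (maxn (size B) (size C)).
  have [|A' [hA eA]] := @homogenize A n; first by rewrite leqW ?leq_maxl.
  have [|B' [hB eB]] := @homogenize B n; first by rewrite leqW // !leq_max leqnn orbT.
  have [|C' [hC eC]] := @homogenize C n; first by rewrite leqW // !leq_max leqnn !orbT.
  have hz : z \is 1.-homog := var_homog _; have hy : y \is 1.-homog := var_homog _.
  exists (n + 1)%N, (A' * z + B' * y), (C' * z); split.
  + by apply: rpredD; apply: dhomogM.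
  + exact: dhomogM.
  + by rewrite rmorphM /= ez mulr1 eC (ev_neq0 (cf_chart K)).
  + rewrite rmorphD !rmorphM /= ey ez !mulr1 eA eB eC.
    by rewrite -/(el _ _ _ A B) -e mulfK // (ev_neq0 (cf_chart K)).
Qed.

End Weierstrass.

(** * Pencils without base points after blowing up finitely many points *)

Section Generic.
Variable K : numClosedFieldType.
Implicit Types (S T : K -> K -> Prop).

(** The quantifier of [for_generic_element] on coefficients instead of elements, so that
    corresponding elements of two pencils can be compared. *)
Definition generically S :=
  exists2 E : seq (K * K), (0, 0) \notin E &
    forall c1 c2 : K, (c1, c2) != (0, 0) ->
      (forall e, e \in E -> c1 * e.2 != c2 * e.1) -> S c1 c2.

Lemma genericallyW S T : (forall c1 c2, S c1 c2 -> T c1 c2) ->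
  generically S -> generically T.
Proof. by move=> ST [E E0 h]; exists E => // c1 c2 c0 cE; apply/ST/h. Qed.

Lemma generically_and S T : generically S -> generically T ->
  generically (fun c1 c2 => S c1 c2 /\ T c1 c2).
Proof.
move=> [E E0 hE] [F F0 hF]; exists (E ++ F); first by rewrite mem_cat negb_or E0.
move=> c1 c2 c0 h; split; [apply: hE|apply: hF] => // e he; apply: h;
  by rewrite mem_cat he ?orbT.
Qed.

Lemma generically_true S : (forall c1 c2, (c1, c2) != (0, 0) -> S c1 c2) -> generically S.
Proof. by move=> h; exists [::] => // c1 c2 c0 _; apply: h. Qed.

Lemma generically_nonzero : generically (fun c1 c2 => (c1, c2) != (0, 0)).
Proof. exact: generically_true. Qed.

(** A proper subspace lies on one line through the origin, which is the single point to exclude. By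
    Cramer's rule, a vector off that line would put both basis vectors into the subspace. *)
Lemma generically_subspace S :
  (forall a b c d s t, S a b -> S c d -> S (s * a + t * c) (s * b + t * d)) ->
  ~ (S 1 0 /\ S 0 1) -> generically (fun c1 c2 => ~ S c1 c2).
Proof.
move=> lin nS; have [[e1 [e2 [e0 he]]]|h] :=
    pselect (exists e1 e2, (e1, e2) != (0, 0) /\ S e1 e2); last first.
  by apply: generically_true => c1 c2 c0 hc; apply: h; exists c1, c2.
exists [:: (e1, e2)] => [|c1 c2 c0 /(_ (e1, e2))]; first by rewrite inE eq_sym.
rewrite inE eqxx /= => /(_ isT); rewrite -subr_eq0 => det hc; apply: nS; split.
  have := lin _ _ _ _ (e2 / (c1 * e2 - c2 * e1)) (- c2 / (c1 * e2 - c2 * e1)) hc he.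
  by congr S; field.
have := lin _ _ _ _ (- e1 / (c1 * e2 - c2 * e1)) (c1 / (c1 * e2 - c2 * e1)) hc he.
by congr S; field.
Qed.

Lemma not_in_seq (s : seq K) : exists k, k \notin s.
Proof.
apply: contrapT => h; pose t : seq K := [seq n%:R | n <- iota 0 (size s).+1].
have ut : uniq t.
  rewrite map_inj_uniq ?iota_uniq // => i j /eqP; by rewrite eqr_nat => /eqP.
have st : {subset t <= s}.
  by move=> x _; apply: contrapT => /negP xs; apply: h; exists x.
by have := uniq_leq_size ut st; rewrite size_map size_iota ltnn.
Qed.

Lemma generically_exists S (bad : seq K) : generically S ->
  exists2 k, k \notin bad & S 1 k.
Proof.
move=> [E E0 h]; have [k] := not_in_seq (bad ++ [seq e.2 / e.1 | e <- E]).
rewrite mem_cat negb_or => /andP[kbad kE]; exists k => //; apply: h.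
  by rewrite xpair_eqE oner_eq0.
move=> e eE; apply: contraNneq kE; rewrite mul1r => e2.
have e1 : e.1 != 0.
  apply: contraNneq E0 => e1; move: eE; rewrite (surjective_pairing e) e2 e1.
  by rewrite mulr0.
by apply/mapP; exists e => //; rewrite e2 mulfK.
Qed.

End Generic.

(** * Points of the projective plane and maps that are inverse up to a factor *)

Section Points.
Variable K : numClosedFieldType.
Implicit Types (p q : 'rV[K]_3) (Q : 3.-tuple {mpoly K[3]}) (A : {mpoly K[3]}).

Definition point_map Q p : 'rV[K]_3 := \row_i (tnth Q i).@[p 0].

Lemma point_mapE Q p : (point_map Q p) 0 =1 fun i => (tnth Q i).@[p 0].
Proof. by move=> i; rewrite mxE. Qed.

Lemma meval_point_map Q p A : (A \mPo Q).@[p 0] = A.@[(point_map Q p) 0].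
Proof.
by rewrite comp_mpoly_meval; apply: meval_eq => i; rewrite point_mapE.
Qed.

Lemma rv_scaleE (c : K) p : (c *: p) 0 =1 fun i => c * p 0 i.
Proof. by move=> i; rewrite mxE. Qed.

Lemma meval_scale_point d (c : K) p A :
  A \is d.-homog -> A.@[(c *: p) 0] = c ^+ d * A.@[p 0].
Proof. by move=> hA; rewrite (meval_eq _ (rv_scaleE c p)) (meval_scale _ _ hA). Qed.

Lemma point_map_scale e (c : K) p Q : (forall i, tnth Q i \is e.-homog) ->
  point_map Q (c *: p) = c ^+ e *: point_map Q p.
Proof.
by move=> hQ; apply/rowP => i; rewrite !mxE (meval_scale_point _ _ (hQ i)).
Qed.

Lemma same_point_sym p q : same_point p q -> same_point q p.
Proof.
by move=> [c c0 ->]; exists c^-1; rewrite ?invr_neq0 // scalerA mulVf ?scale1r.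
Qed.

Lemma same_point_trans p q s : same_point p q -> same_point q s -> same_point p s.
Proof.
by move=> [c c0 ->] [d d0 ->]; exists (c * d); rewrite ?mulf_neq0 // scalerA.
Qed.

Lemma order_ge_same_point r d p q A : A \is d.-homog -> same_point p q ->
  order_ge r (q 0) A -> order_ge r (p 0) A.
Proof.
move=> hA [c c0 ->] h; apply: order_ge_ext (order_ge_scale c hA h) => i.
by rewrite mxE.
Qed.

End Points.

Section BirationalPairs.
Variable K : numClosedFieldType.
Implicit Types (p q : 'rV[K]_3) (A B : {mpoly K[3]}).

(** The two instances below are linear changes of coordinates, with constant factors, and the
    standard quadratic map, with [h = h' = xyz]. Points with [h != 0] are those where [Q] is a local
    isomorphism. *)
Record birational_pair (Q Q' : 3.-tuple {mpoly K[3]}) (h h' : {mpoly K[3]})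
    (e e' : nat) : Prop := {
  bp_pos : (0 < e)%N;
  bp_pos' : (0 < e')%N;
  bp_homog : forall i, tnth Q i \is e.-homog;
  bp_homog' : forall i, tnth Q' i \is e'.-homog;
  bp_left : forall i, tnth Q' i \mPo Q = h * 'X_i;
  bp_right : forall i, tnth Q i \mPo Q' = h' * 'X_i;
  bp_regular : forall p, h.@[p 0] != 0 -> h'.@[(point_map Q p) 0] != 0 }.

Variables (Q Q' : 3.-tuple {mpoly K[3]}) (h h' : {mpoly K[3]}) (e e' : nat).
Hypothesis bp : birational_pair Q Q' h h' e e'.

Lemma point_mapK p : point_map Q' (point_map Q p) = h.@[p 0] *: p.
Proof.
apply/rowP => i; rewrite !mxE -meval_point_map (bp_left bp).
by rewrite mevalM mevalXU.
Qed.

Lemma point_map_inj p q : h.@[p 0] != 0 -> h.@[q 0] != 0 ->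
  same_point (point_map Q p) (point_map Q q) -> same_point p q.
Proof.
move=> hp hq [c c0 /(congr1 (point_map Q'))].
rewrite (point_map_scale _ _ (bp_homog' bp)) !point_mapK => E.
exists (h.@[p 0]^-1 * (c ^+ e' * h.@[q 0])).
  by rewrite !mulf_neq0 ?invr_neq0 ?expf_neq0.
by rewrite -scalerA -[_ *: q]scalerA -E scalerA mulVf ?scale1r.
Qed.

Lemma point_map_neq0 p : h.@[p 0] != 0 -> p != 0 -> point_map Q p != 0.
Proof.
move=> hp; apply: contra_neq => Qp0.
have := point_map_scale 0 (point_map Q p) (bp_homog' bp).
rewrite scale0r -{1}Qp0 point_mapK expr0n gtn_eqF ?(bp_pos' bp) // scale0r.
by move=> /eqP; rewrite scaler_eq0 (negPf hp) => /eqP.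
Qed.

Section Local.
Variables (A A' g : {mpoly K[3]}) (d d' r : nat) (p : 'rV[K]_3).
Hypotheses (hA : A \is d.-homog) (hA' : A' \is d'.-homog) (AQ : A \mPo Q = g * A').
Hypotheses (hp : h.@[p 0] != 0) (gp : g.@[p 0] != 0).

Lemma local_order : order_ge r ((point_map Q p) 0) A -> order_ge r (p 0) A'.
Proof.
move=> hr; apply: (order_ge_cancel gp); rewrite -AQ.
exact/order_ge_comp/(order_ge_ext (@point_mapE _ Q p)).
Qed.

Definition differential_map (v : 'I_3 -> K) (i : 'I_3) : K :=
  \sum_j v j * (mderiv j (tnth Q i)).@[p 0].

Lemma local_leading v : order_ge r ((point_map Q p) 0) A ->
  leading r (p 0) v A' = 0 ->
  leading r ((point_map Q p) 0) (differential_map v) A = 0.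
Proof.
move=> hr h0; rewrite (leading_ext _ _ _ (@point_mapE _ Q p)).
rewrite -leading_comp; last exact: (order_ge_ext (@point_mapE _ Q p)).
by rewrite AQ leadingMl ?h0 ?mulr0 //; apply: local_order.
Qed.

Lemma local_order_inv : order_ge r (p 0) A' -> order_ge r ((point_map Q p) 0) A.
Proof.
move=> hr; have hQA : A \mPo Q \is (d * e).-homog := dhomog_comp hA (bp_homog bp).
have := bp_regular bp hp => h'q.
have h'd : (h' ^+ d).@[(point_map Q p) 0] != 0 by rewrite rmorphXn expf_neq0.
apply: (order_ge_cancel h'd); rewrite -(comp_comp_scale hA (bp_right bp)).
apply: order_ge_comp; apply: (order_ge_ext (@point_mapE _ Q' (point_map Q p))).
apply: (order_ge_same_point hQA (q := p)); first by rewrite point_mapK; exists h.@[p 0].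
by rewrite AQ; apply: order_geMl.
Qed.

End Local.

(** The differential of [Q] at a regular point is injective modulo the radial directions. This
    follows by differentiating the relation [Q' o Q = h * id]. *)
Lemma differential_map_along p v c : h.@[p 0] != 0 ->
  differential_map p v =1 (fun i => c * (point_map Q p) 0 i) ->
  exists c', v =1 fun i => c' * p 0 i.
Proof.
move=> hp E; pose s := \sum_j v j * (mderiv j h).@[p 0].
(* The differential of [Q'] applied to that of [Q] gives [s p + h v] by the chain rule and
   [c e' h p] by Euler's identity; the factor comes from solving for [v]. *)
exists ((c * e'%:R * h.@[p 0] - s) / h.@[p 0]) => k.
have E1 : \sum_i differential_map p v i *
    (mderiv i (tnth Q' k)).@[(point_map Q p) 0] = s * p 0 k + h.@[p 0] * v k.
  transitivity (\sum_j v j * (mderiv j (tnth Q' k \mPo Q)).@[p 0]).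
    under eq_bigr => i _ do rewrite /differential_map mulr_suml.
    rewrite exchange_big; apply: eq_bigr => j _.
    rewrite mderiv_comp raddf_sum mulr_sumr; apply: eq_bigr => i _ /=.
    by rewrite mevalM meval_point_map; ring.
  rewrite (bp_left bp) /s mulr_suml.
  have -> : h.@[p 0] * v k = \sum_j v j * (h.@[p 0] * (j == k)%:R).
    rewrite (bigD1 k) //= eqxx big1 => [|j jk]; first by rewrite addr0 mulr1 mulrC.
    by rewrite (negPf jk) !mulr0.
  rewrite -big_split; apply: eq_bigr => j _ /=.
  rewrite mderivM mevalD !mevalM mevalXU mderiv_var (rmorph_nat (meval _)).
  ring.
have E2 : \sum_i differential_map p v i *
    (mderiv i (tnth Q' k)).@[(point_map Q p) 0] = c * e'%:R * (h.@[p 0] * p 0 k).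
  have := congr1 (meval ((point_map Q p) 0)) (euler (bp_homog' bp k)).
  rewrite raddf_sum mevalZ /= -meval_point_map (bp_left bp) mevalM mevalXU => eu.
  rewrite -mulrA -eu mulr_sumr; apply: eq_bigr => i _.
  by rewrite E mevalM mevalXU mulrA.
apply: (mulfI hp); rewrite mulrA mulrCA divff // mulr1.
apply: (addrI (s * p 0 k)); rewrite -E1 E2; ring.
Qed.

End BirationalPairs.

Section GoodPencils.
Variable K : numClosedFieldType.
Implicit Types (P : pencil K) (C : seq ('rV[K]_3 * nat)) (u : 'rV[K]_3 * nat).

Definition elem P (c1 c2 : K) := c1 *: P.1 + c2 *: P.2.

(* Blowing up the points of C, with multiplicities at least the prescribed
   ones, makes the pencil base point free, and its generic element becomes a
   smooth curve of genus one. *)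
Record good P (d : nat) C : Prop := Good {
  good_homog : P.1 \is d.-homog /\ P.2 \is d.-homog;
  good_indep : forall c1 c2, elem P c1 c2 = 0 -> (c1, c2) = (0, 0);
  good_base : forall p : 'rV[K]_3, p != 0 -> P.1.@[p 0] = 0 -> P.2.@[p 0] = 0 ->
    exists2 u, u \in C & same_point p u.1;
  good_neq0 : forall u, u \in C -> u.1 != 0;
  good_order : forall u, u \in C ->
    order_ge u.2 (u.1 0) P.1 /\ order_ge u.2 (u.1 0) P.2;
  good_tangent : forall u, u \in C -> forall v,
    leading u.2 (u.1 0) v P.1 = 0 -> leading u.2 (u.1 0) v P.2 = 0 ->
    exists c, v =1 fun i => c * u.1 0 i;
  good_smooth : generically (fun c1 c2 => forall p : 'rV[K]_3, p != 0 ->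
    order_ge 2 (p 0) (elem P c1 c2) -> exists2 u, u \in C & same_point p u.1);
  good_genus : generically (fun c1 c2 => geometric_genus (elem P c1 c2) 1) }.

Lemma elem_homog P d c1 c2 : P.1 \is d.-homog /\ P.2 \is d.-homog ->
  elem P c1 c2 \is d.-homog.
Proof. by case=> h1 h2; apply: rpredD; apply: rpredZ. Qed.

Section Transport.
Variables (P P' : pencil K) (d d' : nat) (C C' : seq ('rV[K]_3 * nat)).
Variables (Q Q' : 3.-tuple {mpoly K[3]}) (h h' g : {mpoly K[3]}) (e e' : nat).
Hypotheses (gP : good P d C) (bp : birational_pair Q Q' h h' e e').
Hypotheses (hP' : P'.1 \is d'.-homog /\ P'.2 \is d'.-homog).
Hypotheses (eQ1 : P.1 \mPo Q = g * P'.1) (eQ2 : P.2 \mPo Q = g * P'.2).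
Hypothesis hg : forall p : 'rV[K]_3, h.@[p 0] != 0 -> g.@[p 0] != 0.
Hypothesis h'_neq0 : h' != 0.
Hypothesis C'_neq0 : forall u, u \in C' -> u.1 != 0.
Hypothesis C_C' : forall u, u \in C ->
  (exists2 u', u' \in C' & h.@[u'.1 0] != 0 /\ same_point (point_map Q u'.1) u.1) \/
  (forall p : 'rV[K]_3, h.@[p 0] != 0 -> ~ same_point (point_map Q p) u.1).
Hypothesis C'_C : forall u', u' \in C' ->
  (h.@[u'.1 0] != 0 /\
    exists2 u, u \in C & same_point (point_map Q u'.1) u.1 /\ u'.2 = u.2) \/
  [/\ order_ge u'.2 (u'.1 0) P'.1, order_ge u'.2 (u'.1 0) P'.2
    & forall v, leading u'.2 (u'.1 0) v P'.1 = 0 -> leading u'.2 (u'.1 0) v P'.2 = 0 ->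
      exists c, v =1 fun i => c * u'.1 0 i].
Hypothesis base_irregular : forall p : 'rV[K]_3, p != 0 -> h.@[p 0] = 0 ->
  P'.1.@[p 0] = 0 -> P'.2.@[p 0] = 0 -> exists2 u, u \in C' & same_point p u.1.
Hypothesis smooth_irregular : generically (fun c1 c2 => forall p : 'rV[K]_3, p != 0 ->
    h.@[p 0] = 0 -> order_ge 2 (p 0) (elem P' c1 c2) ->
    exists2 u, u \in C' & same_point p u.1).
Hypothesis genus_transport : generically (fun c1 c2 =>
  forall (L : fieldType) (iota : {rmorphism K -> L}) (xi : 'I_3 -> L),
    is_function_field (elem P c1 c2) iota xi ->
    is_function_field (elem P' c1 c2) iota (fun i => mmap iota xi (tnth Q' i))).

Let elemQ c1 c2 : elem P c1 c2 \mPo Q = g * elem P' c1 c2.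
Proof.
by rewrite /elem comp_mpolyD !comp_mpolyZ eQ1 eQ2 mulrDr -!scalerAr.
Qed.

Let regular_point u (p : 'rV[K]_3) : u \in C -> h.@[p 0] != 0 ->
  same_point (point_map Q p) u.1 -> exists2 u', u' \in C' & same_point p u'.1.
Proof.
move=> uC hp pu; case: (C_C' uC) => [[u' u'C' [hu' u'u]]|n]; last by case: (n p).
exists u' => //; apply: (point_map_inj bp hp hu').
exact: same_point_trans (same_point_sym u'u).
Qed.

Let elem_h c1 c2 : elem P c1 c2 \is d.-homog := elem_homog c1 c2 (good_homog gP).

(** Where [h] is nonzero, orders, leading forms and base points correspond under the local
    isomorphism [Q]. On [h = 0] the clauses come from [base_irregular], [smooth_irregular] and the
    second case of [C'_C]. *)
Lemma good_transport : good P' d' C'.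
Proof.
split=> //.
- move=> c1 c2 E0; apply: (good_indep gP); apply: (mulfI (expf_neq0 d h'_neq0)).
  by rewrite -(comp_comp_scale (elem_h c1 c2) (bp_right bp)) elemQ E0 !mulr0 comp_mpoly0.
- move=> p p0 F0 G0; have [hp|hp] := eqVneq h.@[p 0] 0; first exact: base_irregular.
  have [||u uC pu] := good_base gP (point_map_neq0 bp hp p0).
  + by rewrite -meval_point_map eQ1 mevalM F0 mulr0.
  + by rewrite -meval_point_map eQ2 mevalM G0 mulr0.
  exact: regular_point uC hp pu.
- move=> u' u'C'; case: (C'_C u'C') => [[hu' [u uC [u'u ->]]]|[]//].
  have [o1 o2] := good_order gP uC; have [h1 h2] := good_homog gP.
  split; [apply: (local_order eQ1 (hg hu'))|apply: (local_order eQ2 (hg hu'))].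
    exact: order_ge_same_point h1 u'u o1.
  exact: order_ge_same_point h2 u'u o2.
- move=> u' u'C' v; case: (C'_C u'C') => [[hu' [u uC [u'u ->]]]|[_ _ h3]]; last exact: h3.
  have [o1 o2] := good_order gP uC; have [h1 h2] := good_homog gP.
  have [hp1 hp2] := hP'.
  have q1 := order_ge_same_point h1 u'u o1; have q2 := order_ge_same_point h2 u'u o2.
  move=> /(local_leading eQ1 (hg hu') q1) l1 /(local_leading eQ2 (hg hu') q2) l2.
  have [c c0 ec] := u'u; have eu : (point_map Q u'.1) 0 =1 fun i => c * u.1 0 i.
    by move=> i; rewrite ec mxE.
  rewrite (leading_ext _ _ _ eu) in l1; rewrite (leading_ext _ _ _ eu) in l2.
  have [k ek] := good_tangent gP uC (leading_scale_point o1 h1 c0 l1) (leading_scale_point o2 h2 c0 l2).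
  apply: (differential_map_along bp hu' (c := k / c)) => i.
  by rewrite ek eu mulrA divfK.
- apply: genericallyW (generically_and (good_smooth gP) smooth_irregular) => c1 c2 [s1 s2] p p0 o2.
  have [hp|hp] := eqVneq h.@[p 0] 0; first exact: s2.
  have [|u uC pu] := s1 _ (point_map_neq0 bp hp p0).
    exact: (local_order_inv bp (elem_h c1 c2) (elemQ c1 c2) hp).
  exact: regular_point uC hp pu.
- apply: genericallyW (generically_and (good_genus gP) genus_transport) => c1 c2.
  move=> [[L [iota [xi [ff gen]]]] t].
  by exists L, iota, (fun i => mmap iota xi (tnth Q' i)); split=> //; apply: t.
Qed.

End Transport.
End GoodPencils.

(** * Linear changes of coordinates *)

Section LinearTransport.
Variable K : numClosedFieldType.
Implicit Types (A B : 'M[K]_3) (P : pencil K) (C : seq ('rV[K]_3 * nat)).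

Definition linear_map A : 3.-tuple {mpoly K[3]} := [tuple linear_form (A i) | i < 3].

Lemma linear_map_comp A B i :
  tnth (linear_map A) i \mPo linear_map B = linear_form ((A *m B) i).
Proof.
rewrite tnth_mktuple /linear_form raddf_sum /=.
under eq_bigr => j _.
  rewrite comp_mpolyZ comp_mpolyXU -tnth_nth tnth_mktuple /linear_form scaler_sumr.
  over.
rewrite exchange_big; apply: eq_bigr => k _ /=; rewrite mxE scaler_suml.
by apply: eq_bigr => j _; rewrite scalerA.
Qed.

Lemma linear_form_scalar (c : K) i : linear_form ((c%:M : 'M_3) i) = c%:MP * 'X_i.
Proof.
rewrite /linear_form (bigD1 i) //= big1 => [|j ji]; rewrite mxE.
  by rewrite eqxx mulr1n addr0 mul_mpolyC.
by rewrite eq_sym (negPf ji) mulr0n scale0r.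
Qed.

Lemma linear_birational A B c : A *m B = c%:M -> c != 0 ->
  birational_pair (linear_map A) (linear_map B) c%:MP c%:MP 1 1.
Proof.
move=> AB c0; have BA : B *m A = c%:M.
  have h : (c^-1 *: A) *m B = 1%:M.
    by rewrite -scalemxAl AB -mul_scalar_mx -scalar_mxM mulVf.
  have := mulmx1C h; rewrite -scalemxAr => /(congr1 (fun X => c *: X)).
  by rewrite scalerA divff // scale1r scalemx1.
split=> // [i|i|i|i|p _]; try by rewrite tnth_mktuple; apply: linear_form_homog.
- by rewrite linear_map_comp BA linear_form_scalar.
- by rewrite linear_map_comp AB linear_form_scalar.
- by rewrite mevalC.
Qed.

Lemma point_map_linear A (p : 'rV[K]_3) : point_map (linear_map A) p = p *m A^T.
Proof.
apply/rowP => i; rewrite !mxE tnth_mktuple /linear_form raddf_sum /=.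
by apply: eq_bigr => j _; rewrite mevalZ mevalXU mxE mulrC.
Qed.

Lemma good_linear P d C C' A B c : good P d C -> A *m B = c%:M -> c != 0 ->
  (forall u, u \in C' -> u.1 != 0) ->
  (forall u, u \in C -> exists2 u', u' \in C' & same_point (u'.1 *m A^T) u.1) ->
  (forall u', u' \in C' -> exists2 u, u \in C &
    same_point (u'.1 *m A^T) u.1 /\ u'.2 = u.2) ->
  good (P.1 \mPo linear_map A, P.2 \mPo linear_map A) d C'.
Proof.
move=> gP AB c0 C'0 CC' C'C; have bp := linear_birational AB c0.
have [h1 h2] := good_homog gP.
have hc (p : 'rV[K]_3) : c%:MP.@[p 0] != 0 by rewrite mevalC.
have lh i : tnth (linear_map A) i \is 1.-homog by rewrite tnth_mktuple; apply: linear_form_homog.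
have hl (F : {mpoly K[3]}) : F \is d.-homog -> F \mPo linear_map A \is d.-homog.
  by move=> hF; rewrite -[d]muln1; apply: dhomog_comp.
apply: (good_transport (g := 1) gP bp) => //=; rewrite ?mul1r //.
- by split; apply: hl.
- by move=> p _; rewrite meval1 oner_neq0.
- by rewrite mpolyC_eq0.
- move=> u uC; left; have [u' u'C' e] := CC' u uC.
  by exists u' => //; rewrite point_map_linear.
- move=> u' u'C'; left; have [u uC [e1 e2]] := C'C u' u'C'; split=> //.
  by exists u => //; rewrite point_map_linear.
- by move=> p p0 /eqP; rewrite mevalC (negPf c0).
- by apply: generically_true => c1 c2 _ p p0 /eqP; rewrite mevalC (negPf c0).
- apply: generically_true => c1 c2 _ L iota xi ff.
  apply: (function_field_transport (H' := elem _ c1 c2) (g := 1) ff (elem_homog c1 c2 (good_homog gP))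
    (bp_pos bp) (bp_homog bp) (bp_homog' bp) (bp_right bp) (bp_left bp)).
  + by rewrite mul1r /elem comp_mpolyD !comp_mpolyZ.
  + by rewrite mmapC fmorph_eq0.
  + by rewrite rmorph1 oner_neq0.
  + move=> F k [D e]; exists ((c ^- k)%:MP * D); rewrite -mulrA -e mulrA.
    by rewrite -rmorphXn -rmorphM mulVf ?expf_neq0 // rmorph1 mul1r.
Qed.

End LinearTransport.

(** * The standard quadratic map *)

Section PencilsOnTheLine.
Variable K : numClosedFieldType.
Implicit Types (f g : {poly K}).

(* Double roots are zeros of the Wronskian, each of which lies on a single
   element of the pencil. *)
Lemma pencil_generic_squarefree f g :
  (forall l, l != 0 -> f.[l] = 0 -> g.[l] != 0) ->
  generically (fun c1 c2 => forall l, l != 0 ->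
    (c1 *: f + c2 *: g).[l] = 0 -> (c1 *: f + c2 *: g)^`().[l] != 0).
Proof.
move=> fg; pose W := f * g^`() - f^`() * g.
have nz l : l != 0 -> (g.[l], - f.[l]) != (0, 0).
  move=> l0; apply/eqP => -[g0 /eqP]; rewrite oppr_eq0 => /eqP /(fg l l0).
  by rewrite g0 eqxx.
(* In this case [f] and [g] are proportional. Excluding the element that vanishes at 1 keeps [k]
   nonzero. One of the generators, [r], does not vanish at [l] and satisfies [k r' = k' r];
   comparing orders at [l] shows that [k] does not vanish there either. *)
have [W0|W0] := eqVneq W 0.
  exists [:: (g.[1], - f.[1])] => [|c1 c2 c0 /(_ (g.[1], - f.[1]))].
    by rewrite inE eq_sym nz ?oner_neq0.
  rewrite inE eqxx => /(_ isT) /= hE l l0 kl; apply/eqP => k'l.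
  set k := c1 *: f + c2 *: g in kl k'l hE.
  have k0 : k != 0.
    apply: contraNneq hE => /(congr1 (fun p : {poly K} => p.[1])) /eqP.
    rewrite /k !hornerE /= addr_eq0 => /eqP e; rewrite mulrN e opprK; apply/eqP; ring.
  have [r [rW rl]] : exists r : {poly K}, k * r^`() = k^`() * r /\ r.[l] != 0.
    have [fl|fl] := eqVneq f.[l] 0; [exists g|exists f]; split; rewrite ?fg //; apply/eqP;
      rewrite -subr_eq0 /k derivD !derivZ; apply/eqP.
      transitivity (c1 *: W); last by rewrite W0 scaler0.
      by rewrite /W -!mul_polyC; ring.
    transitivity (- c2 *: W); last by rewrite W0 scaler0.
    by rewrite /W -!mul_polyC polyCN; ring.
  have [n [q]] := multiplicity_XsubC k l; rewrite k0 /= => ql ek.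
  case: n ek => [|n] ek.
    by move: kl ql; rewrite ek expr0 mulr1 rootE => ->; rewrite eqxx.
  have X0 : ('X - l%:P) ^+ n != 0 by rewrite expf_neq0 // polyXsubC_eq0.
  have E : ('X - l%:P) * q * r^`() = (q *+ n.+1 + ('X - l%:P) * q^`()) * r.
    apply: (mulfI X0); transitivity (k * r^`()); first by rewrite ek exprS; ring.
    rewrite rW ek derivM deriv_exp derivXsubC mul1r exprS /=; ring.
  have := congr1 (fun p : {poly K} => p.[l]) E.
  rewrite !(hornerXsubC, hornerM, hornerD, hornerMn) subrr !mul0r addr0 => /esym/eqP.
  by rewrite mulf_eq0 (negPf rl) orbF mulrn_eq0 /= -rootE (negPf ql).
have [rs ers] := closed_field_poly_normal W.
exists [seq (g.[l], - f.[l]) | l <- rs & l != 0].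
  apply/negP => /mapP[l]; rewrite mem_filter => /andP[/nz/eqP h _] e.
  by apply: h; rewrite -e.
move=> c1 c2 c0 hE l l0 kl; apply/eqP => k'l.
have Wl : W.[l] = 0.
  move: kl k'l c0; rewrite derivD !derivZ /W !hornerE => h1 h2.
  rewrite xpair_eqE negb_and => /orP[c10|c20]; [apply: (mulfI c10)|apply: (mulfI c20)].
    rewrite mulr0 -[RHS](_ : (c1 * f.[l] + c2 * g.[l]) * g^`().[l] -
       (c1 * f^`().[l] + c2 * g^`().[l]) * g.[l] = 0); last by rewrite h1 h2 !mul0r subr0.
    by ring.
  rewrite mulr0 -[RHS](_ : (c1 * f^`().[l] + c2 * g^`().[l]) * f.[l] -
     (c1 * f.[l] + c2 * g.[l]) * f^`().[l] = 0); last by rewrite h1 h2 !mul0r subr0.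
  by ring.
have lrs : l \in rs.
  move: Wl; rewrite ers hornerZ => /eqP; rewrite mulf_eq0 lead_coef_eq0 (negPf W0) /=.
  by rewrite -rootE root_prod_XsubC.
have := hE (g.[l], - f.[l]); rewrite map_f ?mem_filter ?l0 // => /(_ isT) /=.
move: kl; rewrite !hornerE => /eqP; rewrite addr_eq0 => /eqP e.
by rewrite mulrN e opprK eqxx.
Qed.

End PencilsOnTheLine.

Section Indices.

Lemma third_index (a b : 'I_3) : a != b -> exists2 c, c != a & c != b.
Proof.
case: a b => [[|[|[|a]]] ha] [[|[|[|b]]] hb] //= _;
  first [by exists (@Ordinal 3 2 isT)|by exists (@Ordinal 3 1 isT)|by exists (@Ordinal 3 0 isT)].
Qed.

Lemma index_cases (a b c : 'I_3) : a != b -> c != a -> c != b ->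
  forall i, [\/ i = a, i = b | i = c].
Proof.
move=> ab ca cb i; have := subset_leq_card (subsetT [set a; b; c; i]).
rewrite cardsT card_ord; case: (eqVneq i a) => [->|ia]; first by constructor.
case: (eqVneq i b) => [->|ib]; first by constructor.
case: (eqVneq i c) => [->|ic]; first by constructor.
rewrite -setUA -setUA cardsU1 !inE (negPf ab) (eq_sym a c) (negPf ca) (eq_sym a i) (negPf ia) /=.
rewrite cardsU1 !inE (eq_sym b c) (negPf cb) (eq_sym b i) (negPf ib) /= cards2 (eq_sym c i).
by rewrite ic.
Qed.

Lemma big_indices (R : Type) (idx : R) (op : Monoid.com_law idx) (a b c : 'I_3) (F : 'I_3 -> R) :
  a != b -> c != a -> c != b -> \big[op/idx]_i F i = op (F a) (op (F b) (F c)).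
Proof.
move=> ab ca cb; rewrite (bigD1 a) //= (bigD1 b) 1?eq_sym //= (bigD1 c) ?ca //=.
rewrite big1 ?Monoid.mulm1 // => i /andP[/andP[ia ib] ic].
by case: (index_cases ab ca cb i) => e; move: ia ib ic; rewrite e eqxx.
Qed.

End Indices.

Lemma generically_index (K : numClosedFieldType) (S : 'I_3 -> K -> K -> Prop) :
  (forall a, generically (S a)) -> generically (fun c1 c2 => forall a, S a c1 c2).
Proof.
move=> h; pose a : 'I_3 := ord0.
have [b ab] : exists b, a != b by exists (lift a ord0); rewrite neq_lift.
have [c ca cb] := third_index ab.
apply: genericallyW (generically_and (h a) (generically_and (h b) (h c))).
by move=> c1 c2 [ha [hb hc]] i; case: (index_cases ab ca cb i) => ->.
Qed.

Section StandardMap.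
Variable K : numClosedFieldType.
Implicit Types (F G : {mpoly K[3]}) (a b c i j : 'I_3) (p : 'rV[K]_3).

Definition standard_map : 3.-tuple {mpoly K[3]} :=
  [tuple vy K * vz K; vx K * vz K; vx K * vy K].

Definition xyz : {mpoly K[3]} := \prod_i 'X_i.

Lemma standard_map_mul a : tnth standard_map a * 'X_a = xyz.
Proof.
have e3 : xyz = vx K * (vy K * vz K).
  by rewrite /xyz (big_indices _ _ (a := @Ordinal 3 0 isT) (b := @Ordinal 3 1 isT)
    (c := @Ordinal 3 2 isT)).
rewrite e3; case: a => [[|[|[|a]]] ha] //; rewrite (tnth_nth 0) /=.
- rewrite (_ : 'X_(Ordinal ha) = vx K); last by congr 'X_[U_(_)]; apply: val_inj.
  by ring.
- rewrite (_ : 'X_(Ordinal ha) = vy K); last by congr 'X_[U_(_)]; apply: val_inj.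
  by ring.
- rewrite (_ : 'X_(Ordinal ha) = vz K); last by congr 'X_[U_(_)]; apply: val_inj.
  by ring.
Qed.

Lemma mpolyX_neq0 (m : 'X_{1..3}) : 'X_[m] != 0 :> {mpoly K[3]}.
Proof.
by apply/eqP => /(congr1 (mcoeff m)) /eqP; rewrite mcoeffX eqxx mcoeff0 oner_eq0.
Qed.

Lemma standard_mapE a b c : a != b -> c != a -> c != b ->
  tnth standard_map a = 'X_b * 'X_c.
Proof.
move=> ab ca cb; apply: (mulIf (mpolyX_neq0 U_(a))).
by rewrite standard_map_mul /xyz (big_indices _ _ ab ca cb) /=; ring.
Qed.

Definition ones : 'X_{1..3} := [multinom 1%N | i < 3].

Lemma xyzE : xyz = 'X_[ones].
Proof.
rewrite mpolyXE_id; apply: eq_bigr => i _.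
by rewrite mnmE.
Qed.

Lemma onesMn m i : (ones *+ m)%MM i = m.
Proof. by rewrite mulmnE mnmE mul1n. Qed.

Lemma mdeg_onesMn m : mdeg (ones *+ m)%MM = (3 * m)%N.
Proof. by rewrite mdeg3 !onesMn; lia. Qed.

Lemma xyzXn m : xyz ^+ m = 'X_[ones *+ m].
Proof. by rewrite xyzE mpolyXn. Qed.

(* The action of the quadratic map on exponents. *)
Definition swap (m : 'X_{1..3}) : 'X_{1..3} := [multinom (mdeg m - m i)%N | i < 3].

Lemma swapE m i : swap m i = (mdeg m - m i)%N. Proof. exact: mnmE. Qed.

Lemma leq_mdeg (m : 'X_{1..3}) i : (m i <= mdeg m)%N.
Proof. by rewrite mdegE (bigD1 i) //= leq_addr. Qed.

Lemma swapD m : (swap m + m)%MM = (ones *+ mdeg m)%MM.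
Proof. by apply/mnmP => i; rewrite mnmDE swapE onesMn subnK ?leq_mdeg. Qed.

Lemma mdeg_swap m : mdeg (swap m) = (2 * mdeg m)%N.
Proof. by have := congr1 mdeg (swapD m); rewrite mdegD mdeg_onesMn; lia. Qed.

Lemma swap_inj : injective swap.
Proof.
move=> m n e; have dmn : mdeg m = mdeg n by have := congr1 mdeg e; rewrite !mdeg_swap; lia.
apply/mnmP => i; have := congr1 (fun k : 'X_{1..3} => k i) e; rewrite /= !swapE dmn.
by have := leq_mdeg m i; have := leq_mdeg n i; rewrite dmn; lia.
Qed.

Lemma comp_monomial m : 'X_[m] \mPo standard_map = 'X_[swap m].
Proof.
apply: (mulIf (mpolyX_neq0 m)); rewrite -mpolyXD swapD -xyzXn comp_mpolyX.
rewrite [X in _ * X]mpolyXE_id -big_split /= mdegE -prodrXr.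
by apply: eq_bigr => i _; rewrite -exprMn standard_map_mul.
Qed.

Lemma comp_standard_map F :
  F \mPo standard_map = \sum_(m <- msupp F) F@_m *: 'X_[swap m].
Proof.
by rewrite comp_mpolyEX; apply: eq_bigr => m _; rewrite comp_monomial.
Qed.

Lemma mcoeff_comp F m : (F \mPo standard_map)@_(swap m) = F@_m.
Proof.
rewrite comp_standard_map raddf_sum /=.
have [mF|mF] := boolP (m \in msupp F).
  rewrite (bigD1_seq m) //= mcoeffZ mcoeffX eqxx mulr1 big1 ?addr0 // => n nm.
  by rewrite mcoeffZ mcoeffX (inj_eq swap_inj) (negPf nm) mulr0.
rewrite big1_seq => [|n /andP[_ nF]]; first by rewrite memN_msupp_eq0.
rewrite mcoeffZ mcoeffX (inj_eq swap_inj).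
by case: eqP nF mF => [->->|_ _ _] //; rewrite mulr0.
Qed.

Lemma mcoeff_xyz_mul F m n : (xyz ^+ m * F)@_(ones *+ m + n) = F@_n.
Proof. by rewrite xyzXn mulrC mcoeffMX. Qed.

Lemma mcoeff_xyz_small F m (n : 'X_{1..3}) i : (n i < m)%N -> (xyz ^+ m * F)@_n = 0.
Proof.
move=> nm; rewrite xyzXn mulrC; apply: memN_msupp_eq0.
rewrite (perm_mem (msuppMX F _)); apply/mapP => -[k _ e].
by move: nm; rewrite e mnmDE onesMn ltnNge leq_addr.
Qed.

(** An exponent [n i] becomes [d - n i], so divisibility of the image by the m-th power of [xyz] is
    the bound [n i <= d - m], that is, multiplicity at least [m] at the vertices. *)
Lemma quadratic_image F d m : F \is d.-homog ->
  (forall n, n \in msupp F -> forall i, (n i + m <= d)%N) ->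
  exists F', F' \is (2 * d - 3 * m).-homog /\ F \mPo standard_map = xyz ^+ m * F'.
Proof.
move=> hF hm.
have le n : n \in msupp F -> (ones *+ m <= swap n)%MM.
  move=> nF; apply/mnm_lepP => i; rewrite onesMn swapE (dhomog_mf hF nF) /=.
  by have := hm n nF i; lia.
exists (\sum_(n <- msupp F) F@_n *: 'X_[swap n - ones *+ m]); split.
  rewrite big_seq; apply: rpred_sum => n nF; apply: rpredZ.
  rewrite dhomogX /=; apply/eqP; have := congr1 mdeg (submK (le n nF)).
  by rewrite mdegD mdeg_onesMn mdeg_swap (dhomog_mf hF nF) /=; lia.
rewrite comp_standard_map xyzXn mulr_sumr; apply: eq_big_seq => n nF.
by rewrite -scalerAr -mpolyXD addmC submK // le.
Qed.

Lemma standard_map_homog i : tnth standard_map i \is 2.-homog.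
Proof.
have [j ij] : exists j, i != j.
  by exists (lift i ord0); rewrite neq_lift.
have [c ci cj] := third_index ij; rewrite (standard_mapE ij ci cj).
by apply: (@dhomogM _ _ _ 1 _ 1); apply: var_homog.
Qed.

Lemma standard_map_involutive i : tnth standard_map i \mPo standard_map = xyz * 'X_i.
Proof.
have [j ij] : exists j, i != j.
  by exists (lift i ord0); rewrite neq_lift.
have [c ci cj] := third_index ij; rewrite (standard_mapE ij ci cj) rmorphM /=.
rewrite !comp_mpolyXU -!tnth_nth /xyz (big_indices _ _ ij ci cj).
have ji : j != i by rewrite eq_sym.
have jc : j != c by rewrite eq_sym.
by rewrite (standard_mapE ji cj ci) (standard_mapE ci jc ji) /=; ring.
Qed.

Lemma xyz_neq0 : xyz != 0. Proof. by rewrite xyzE mpolyX_neq0. Qed.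

Lemma xyz_comp : xyz \mPo standard_map = xyz ^+ 2.
Proof.
rewrite {1}/xyz rmorph_prod /=; apply: (mulIf xyz_neq0).
transitivity (\prod_(i < 3) xyz); last by rewrite prodr_const card_ord exprSr.
rewrite {1}/xyz -big_split /=; apply: eq_bigr => i _.
by rewrite comp_mpolyXU -tnth_nth standard_map_mul.
Qed.

Lemma quadratic_image_inv F F' d m : F \is d.-homog -> (2 * m <= d)%N ->
  F \mPo standard_map = xyz ^+ m * F' ->
  F' \mPo standard_map = xyz ^+ (d - 2 * m) * F.
Proof.
move=> hF md e; have := comp_comp_scale hF standard_map_involutive.
rewrite e rmorphM rmorphXn /= xyz_comp -exprM => E.
apply: (mulfI (expf_neq0 (2 * m) xyz_neq0)).
by rewrite E mulrA -exprD subnKC.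
Qed.

Lemma xyz_eval p : xyz.@[p 0] = \prod_i p 0 i.
Proof. by rewrite rmorph_prod /=; apply: eq_bigr => i _; rewrite mevalXU. Qed.

Definition vertex a : 'rV[K]_3 := delta_mx 0 a.

Lemma vertexE a i : vertex a 0 i = (i == a)%:R.
Proof. by rewrite mxE eqxx. Qed.

Lemma vertex_neq0 a : vertex a != 0.
Proof.
by apply/eqP => /rowP/(_ a)/eqP; rewrite vertexE eqxx mxE oner_eq0.
Qed.

Lemma meval_vertex F d a : F \is d.-homog -> F.@[vertex a 0] = F@_(U_(a) *+ d).
Proof.
move=> hF; rewrite mevalE.
have term m : m \in msupp F -> m != (U_(a) *+ d)%MM -> \prod_i vertex a 0 i ^+ m i = 0.
  move=> mF mn; have [i ia mi] : exists2 i, i != a & m i != 0%N.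
    apply/exists_inP; apply: contraNT mn; rewrite negb_exists_in => /forall_inP h.
    apply/eqP/mnmP => j; rewrite mulmnE mnm1E.
    have m0 i : i != a -> m i = 0%N by move=> /h; rewrite negbK => /eqP.
    case: (eqVneq a j) => [<-|aj]; last by rewrite mul0n m0 // eq_sym.
    rewrite mul1n -(dhomog_mf hF mF) /= mdegE (bigD1 a) //= big1 ?addn0 // => i; exact: m0.
  by rewrite (bigD1 i) //= vertexE (negPf ia) expr0n (negPf mi) mul0r.
have pure : \prod_i vertex a 0 i ^+ (U_(a) *+ d)%MM i = 1.
  apply: big1 => i _; rewrite vertexE mulmnE mnm1E eq_sym.
  by case: eqP; rewrite ?expr1n // mul0n expr0.
have [dF|dF] := boolP ((U_(a) *+ d)%MM \in msupp F).
  rewrite (bigD1_seq (U_(a) *+ d)%MM) //= pure mulr1 big1_seq ?addr0 // => m /andP[mn mF].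
  by rewrite term ?mulr0.
rewrite memN_msupp_eq0 // big1_seq // => m /andP[_ mF].
by rewrite term ?mulr0 //; apply: contraNneq dF => <-.
Qed.

(** A monomial other than the pure power of the variable [a] contains another variable [b]; the
    derivative in [b] keeps the exponent [n a] and lowers both [d] and [r] by one. The pure power is
    excluded by the value at the vertex. *)
Lemma vertex_order_msupp F d r a : F \is d.-homog -> order_ge r (vertex a 0) F ->
  forall n, n \in msupp F -> (n a + r <= d)%N.
Proof.
elim: r d F => [|r IH] d F hF.
  by move=> _ n nF; rewrite addn0 -(dhomog_mf hF nF) leq_mdeg.
move=> /order_geSP[F0 Fr] n nF.
case: d hF => [|d] hF.
  have n0 : n = 0%MM by apply/eqP; rewrite -mdeg_eq0; apply/eqP; apply: dhomog_mf hF _ nF.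
  move: nF; rewrite n0 mcoeff_msupp; have := F0; rewrite (meval_vertex _ hF) mulm0n => ->.
  by rewrite eqxx.
have [/exists_inP[b ba nb]|] := boolP [exists b in predC1 a, n b != 0%N].
  have nF' : (n - U_(b))%MM \in msupp (mderiv b F).
    rewrite mcoeff_msupp mcoeff_mderiv submK ?lep1mP // mulrn_eq0 /= -mcoeff_msupp.
    exact: nF.
  have := IH d _ (mderiv_homog b hF) (Fr b) _ nF'.
  by rewrite mnmBE mnm1E (negPf ba) subn0 addnS.
rewrite negb_exists_in => /forall_inP h.
have : n = (U_(a) *+ d.+1)%MM.
  apply/mnmP => j; rewrite mulmnE mnm1E.
  have m0 i : i != a -> n i = 0%N by move=> /h; rewrite negbK => /eqP.
  case: (eqVneq a j) => [<-|aj]; last by rewrite mul0n m0 // eq_sym.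
  rewrite mul1n -(dhomog_mf hF nF) /= mdegE (bigD1 a) //= big1 ?addn0 // => i; exact: m0.
by move=> e; move: nF; rewrite mcoeff_msupp e -(meval_vertex a hF) F0 eqxx.
Qed.

Lemma vertex_order_var a i n : i != a -> order_ge n (vertex a 0) ('X_i ^+ n : {mpoly K[3]}).
Proof.
move=> ia; elim: n => [//|n IH]; rewrite exprS; apply: (@order_geM _ 1 n) => //.
by split=> //; rewrite mevalXU vertexE (negPf ia).
Qed.

Lemma vertex_order F d r a : F \is d.-homog ->
  (forall n, n \in msupp F -> (n a + r <= d)%N) -> order_ge r (vertex a 0) F.
Proof.
move=> hF h; rewrite (mpolyE F) big_seq.
elim/big_ind: _ => [|A B|n nF]; [exact: order_ge0|exact: order_geD|].
apply: order_geZ; have [b ab] : exists b, a != b by exists (lift a ord0); rewrite neq_lift.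
have [c ca cb] := third_index ab.
apply: (@order_ge_le _ (n b + n c)); last first.
  rewrite mpolyXE_id (big_indices _ _ ab ca cb); apply: order_geMl.
  by apply: order_geM; apply: vertex_order_var => //; rewrite eq_sym.
have := h n nF; rewrite -(dhomog_mf hF nF) /= mdegE (big_indices _ _ ab ca cb) /=; lia.
Qed.

End StandardMap.

(** * Points of a contracted line as directions at the opposite vertex *)

Section StandardMapLocal.
Variable K : numClosedFieldType.
Implicit Types (F G : {mpoly K[3]}) (a b c i j : 'I_3) (p : 'rV[K]_3).

(** The direction at the vertex [a] that corresponds to a point [p] of the line opposite to it. As
    the inverse of 0 is 0, its component along the vertex vanishes. *)
Definition inverse_direction p (i : 'I_3) : K := (p 0 i)^-1.

(** The line through [p] towards the vertex [a] is mapped to [k = p_b p_c] times the line through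
    that vertex in the direction inverse to [p], and [xyz] restricts to [k X] on it. *)
Lemma line_poly_standard F F' d m a p : F \is d.-homog ->
  F \mPo standard_map K = xyz K ^+ m * F' ->
  p 0 a = 0 -> (forall i, i != a -> p 0 i != 0) ->
  exists2 k : K, k != 0 &
    k ^+ d *: line_poly (vertex K a 0) (inverse_direction p) F =
    k ^+ m *: ('X^m * line_poly (p 0) (vertex K a 0) F').
Proof.
move=> hF e pa pi0; have [b ab] : exists b, a != b by exists (lift a ord0); rewrite neq_lift.
have [c ca cb] := third_index ab.
have pb : p 0 b != 0 by rewrite pi0 // eq_sym.
have pc := pi0 c ca; exists (p 0 b * p 0 c); first by rewrite mulf_neq0.
set k := p 0 b * p 0 c.
pose arc i : {poly K} := (p 0 i)%:P + vertex K a 0 i *: 'X.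
have arc_a : arc a = 'X by rewrite /arc pa polyC0 add0r vertexE eqxx scale1r.
have arc_ne i : i != a -> arc i = (p 0 i)%:P.
  by move=> ia; rewrite /arc vertexE (negPf ia) scale0r addr0.
have arc_b : arc b = (p 0 b)%:P by rewrite arc_ne // eq_sym.
have arc_c := arc_ne c ca.
have ev_var i : mmap (@polyC K) arc 'X_i = arc i by rewrite mmapX mmap1U.
have ba : b != a by rewrite eq_sym.
have bc : b != c by rewrite eq_sym.
have ac : a != c by rewrite eq_sym.
have ev_map i : mmap (@polyC K) arc (tnth (standard_map K) i) =
    k%:P * ((vertex K a 0 i)%:P + inverse_direction p i *: 'X).
  rewrite /inverse_direction vertexE; case: (index_cases ab ca cb i) => ->.
  - rewrite (standard_mapE K ab ca cb) rmorphM /= !ev_var arc_b arc_c pa invr0 scale0r.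
    by rewrite eqxx addr0 mulr1 polyCM.
  - rewrite (standard_mapE K ba cb ca) rmorphM /= !ev_var arc_a arc_c (negPf ba) polyC0 add0r.
    by rewrite -mul_polyC mulrA -polyCM /k mulrAC divff // mul1r mulrC.
  - rewrite (standard_mapE K ca bc ba) rmorphM /= !ev_var arc_a arc_b (negPf ca) polyC0 add0r.
    by rewrite -mul_polyC mulrA -polyCM /k mulfK // mulrC.
have := congr1 (mmap (@polyC K) arc) e.
rewrite mmap_comp (mmap_eq _ _ ev_map) (mmap_scale _ _ _ hF).
have -> : mmap (@polyC K) arc (xyz K ^+ m * F') =
    mmap (@polyC K) arc (xyz K) ^+ m * mmap (@polyC K) arc F'.
  by rewrite rmorphM rmorphXn.
have -> : mmap (@polyC K) arc (xyz K) = k%:P * 'X.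
  rewrite /xyz rmorph_prod /= (big_indices _ _ ab ca cb) /= !ev_var arc_a arc_b arc_c.
  by rewrite -polyCM mulrC.
by rewrite exprMn -!rmorphXn /= -!mul_polyC mulrA.
Qed.

Lemma leading_standard F F' d m a p : F \is d.-homog ->
  F \mPo standard_map K = xyz K ^+ m * F' ->
  p 0 a = 0 -> (forall i, i != a -> p 0 i != 0) ->
  leading m (vertex K a 0) (inverse_direction p) F = 0 <-> F'.@[p 0] = 0.
Proof.
move=> hF e pa pi0; have [k k0 E] := line_poly_standard hF e pa pi0.
have := congr1 (fun q : {poly K} => q`_m) E.
rewrite !coefZ coefXnM ltnn subnn -horner_coef0 line_poly_horner.
have -> : F'.@[fun i => p 0 i + 0 * vertex K a 0 i] = F'.@[p 0].
  by apply: meval_eq => i; rewrite mul0r addr0.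
rewrite -line_poly_coef => E'; split=> /eqP.
  rewrite mulrn_eq0 -leqn0 leqNgt fact_gt0 /= => /eqP l0; move/esym/eqP: E'.
  by rewrite l0 mulr0 mulf_eq0 expf_eq0 (negPf k0) andbF => /eqP.
move=> /eqP F0; move/eqP: E'; rewrite F0 mulr0 mulf_eq0 expf_eq0 (negPf k0) andbF /=.
by move=> /eqP->; rewrite mul0rn.
Qed.

Lemma line_poly_vertices F d a b k : F \is d.-homog -> a != b -> (k <= d)%N ->
  (line_poly (vertex K a 0) (vertex K b 0) F)`_k = F@_(U_(a) *+ (d - k) + U_(b) *+ k).
Proof.
move=> hF ab kd; have [c ca cb] := third_index ab.
have ba : b != a by rewrite eq_sym.
set n0 := (_ + _)%MM.
have n0E i : n0 i = ((a == i) * (d - k) + (b == i) * k)%N.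
  by rewrite mnmDE !mulmnE !mnm1E.
have term n : n \in msupp F ->
    (mmap1 (fun i => (vertex K a 0 i)%:P + vertex K b 0 i *: 'X) n)`_k = (n == n0)%:R :> K.
  move=> nF; rewrite /mmap1 (big_indices _ _ ab ca cb) /= !vertexE !eqxx (negPf ab) (negPf ba).
  rewrite (negPf ca) (negPf cb) !scale0r !scale1r !polyC0 !addr0 !add0r expr1n mul1r.
  have [nc|nc] := posnP (n c).
    rewrite nc expr0 mulr1 coefXn; suff -> : (k == n b) = (n == n0) by [].
    apply/eqP/eqP => [kb|->]; last first.
      by rewrite n0E (negPf ab) eqxx mul0n mul1n.
    have da : (n a + k)%N = d.
      by rewrite -(dhomog_mf hF nF) /= mdegE (big_indices _ _ ab ca cb) /= nc addn0 kb.
    apply/mnmP => i; rewrite n0E.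
    case: (index_cases ab ca cb i) => ->; rewrite ?eqxx ?(negPf ab) ?(negPf ba).
    - by rewrite mul1n mul0n addn0 -da addnK.
    - by rewrite mul1n mul0n add0n.
    - by rewrite eq_sym (negPf ca) eq_sym (negPf cb) !mul0n.
  rewrite expr0n gtn_eqF // mulr0 coef0; case: eqP => // e.
  by move: nc; rewrite e n0E eq_sym (negPf ca) eq_sym (negPf cb) !mul0n.
rewrite /line_poly /mmap coef_sum.
have [n0F|n0F] := boolP (n0 \in msupp F).
  rewrite (bigD1_seq n0) //= coefCM term // eqxx mulr1 big1_seq ?addr0 // => n /andP[nn nF].
  by rewrite coefCM term // (negPf nn) mulr0.
rewrite memN_msupp_eq0 // big1_seq // => n /andP[_ nF].
rewrite coefCM term //; case: eqP => [e|_]; last by rewrite mulr0.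
by move: n0F; rewrite -e nF.
Qed.

(* The tangent direction of the line through two vertices is read off the
   monomials supported on that line. *)
Lemma leading_vertices F F' d m a b c : a != b -> c != a -> c != b ->
  F \is d.-homog -> F' \is (2 * d - 3 * m).-homog -> (2 * m <= d)%N ->
  F \mPo standard_map K = xyz K ^+ m * F' ->
  leading (d - 2 * m) (vertex K a 0) (vertex K b 0) F' = 0 ->
  leading m (vertex K c 0) (vertex K b 0) F = 0.
Proof.
move=> ab ca cb hF hF' md e.
rewrite -!line_poly_coef (line_poly_vertices hF') //; last by lia.
rewrite (line_poly_vertices hF) //; last by lia.
set n' := (_ + _)%MM; set n := (_ + _)%MM.
suff -> : F'@_n' = F@_n.
  by move=> /eqP; rewrite mulrn_eq0 -leqn0 leqNgt fact_gt0 /= => /eqP->; rewrite mul0rn.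
rewrite -(mcoeff_xyz_mul F' m) -e -(mcoeff_comp F n); congr (_@__).
have ba : b != a by rewrite eq_sym.
have bc : b != c by rewrite eq_sym.
have ac : a != c by rewrite eq_sym.
have dn : mdeg n = d by rewrite mdegD !mdegMn !mdeg1; lia.
apply/mnmP => i; rewrite swapE dn !mnmDE onesMn !mulmnE !mnm1E.
case: (index_cases ab ca cb i) => ->;
  rewrite ?eqxx ?(negPf ab) ?(negPf ba) ?(negPf ca) ?(negPf cb) ?(negPf ac) ?(negPf bc); lia.
Qed.

Lemma strip_xyz (H A : {mpoly K[3]}) k : (forall i, ~ divides 'X_i H) ->
  divides H (xyz K ^+ k * A) -> divides H A.
Proof.
move=> nH; elim: k => [|k IH]; first by rewrite mul1r.
rewrite exprS -mulrA => h; apply: IH.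
apply: (divides_strip_prod (ls := [seq 'X_i | i <- enum 'I_3])).
  by move=> l /mapP[i _ ->]; split=> //; apply: var_prime.
by rewrite big_map big_enum.
Qed.

End StandardMapLocal.

(** * Transport of good pencils by the standard map *)

Section StandardTransport.
Variable K : numClosedFieldType.
Implicit Types (P : pencil K) (T : seq ('rV[K]_3 * nat)) (p : 'rV[K]_3).

Definition vertices (m : nat) : seq ('rV[K]_3 * nat) :=
  [seq (vertex K a, m) | a <- enum 'I_3].

Definition standard_image T : seq ('rV[K]_3 * nat) :=
  [seq (point_map (standard_map K) u.1, u.2) | u <- T].

Lemma verticesP m u : u \in vertices m <-> exists a, u = (vertex K a, m).
Proof.
split=> [/mapP[a _ ->]|[a ->]]; first by exists a.
by apply/mapP; exists a; rewrite // mem_enum.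
Qed.

Lemma vertex_or_edge p : p != 0 -> (xyz K).@[p 0] = 0 ->
  (exists a, same_point p (vertex K a)) \/
  (exists a, p 0 a = 0 /\ forall i, i != a -> p 0 i != 0).
Proof.
move=> p0; rewrite xyz_eval => /eqP/prodf_eq0[a _ /eqP pa].
have [b ab] : exists b, a != b by exists (lift a ord0); rewrite neq_lift.
have [c ca cb] := third_index ab.
have single i j : j != i -> (forall k, k != i -> k != j -> p 0 k = 0) -> p 0 j = 0 ->
    same_point p (vertex K i).
  move=> ji hk pj; have E : p = p 0 i *: vertex K i.
    apply/rowP => k; rewrite !mxE eqxx; case: (eqVneq k i) => [->|ki]; first by rewrite mulr1.
    by rewrite mulr0; case: (eqVneq k j) => [->//|kj]; apply: hk.
  exists (p 0 i) => //; apply: contraNneq p0 => pi0.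
  by rewrite E pi0 scale0r.
have ba : b != a by rewrite eq_sym.
have [pb|pb] := eqVneq (p 0 b) 0.
  left; exists c; apply: (single c b) => [|k kc kb|] //; first by rewrite eq_sym.
  by case: (index_cases ab ca cb k) => e; [rewrite e|move: kb; rewrite e eqxx|move: kc; rewrite e eqxx].
have [pc|pc] := eqVneq (p 0 c) 0.
  left; exists b; apply: (single b c) => [|k kb kc|] //.
  by case: (index_cases ab ca cb k) => e; [rewrite e|move: kb; rewrite e eqxx|move: kc; rewrite e eqxx].
right; exists a; split=> // i ia.
by case: (index_cases ab ca cb i) => e; [move: ia; rewrite e eqxx|rewrite e|rewrite e].
Qed.

Lemma xyz_map p : (xyz K).@[point_map (standard_map K) p 0] = (xyz K).@[p 0] ^+ 2.
Proof. by rewrite -meval_point_map xyz_comp rmorphXn. Qed.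

Lemma standard_birational :
  birational_pair (standard_map K) (standard_map K) (xyz K) (xyz K) 2 2.
Proof.
split=> //; try exact: standard_map_homog; try exact: standard_map_involutive.
by move=> p hp; rewrite xyz_map expf_neq0.
Qed.

Lemma torusP p : (xyz K).@[p 0] != 0 <-> forall i, p 0 i != 0.
Proof.
rewrite xyz_eval prodf_seq_neq0; split=> [/allP h i|h].
  by apply: h; rewrite mem_index_enum.
by apply/allP => i _; apply: h.
Qed.

Lemma torus_not_vertex p a : (xyz K).@[p 0] != 0 -> ~ same_point p (vertex K a).
Proof.
move=> /torusP h [c _ e].
have [b ba] : exists b, b != a by exists (lift a ord0); rewrite eq_sym neq_lift.
by have := h b; rewrite e mxE vertexE (negPf ba) mulr0 eqxx.
Qed.

Section Image.
Variables (P P' : pencil K) (d m : nat) (T : seq ('rV[K]_3 * nat)).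
Hypothesis gP : good P d (vertices m ++ T).
Hypothesis torus : forall u, u \in T -> (xyz K).@[u.1 0] != 0.

Let no_base_edge a p : p 0 a = 0 -> (forall i, i != a -> p 0 i != 0) ->
  P.1.@[p 0] = 0 -> P.2.@[p 0] = 0 -> False.
Proof.
move=> pa pi0 h1 h2; have [b ab] : exists b, a != b by exists (lift a ord0); rewrite neq_lift.
have [c ca cb] := third_index ab.
have p0 : p != 0.
  by apply: contraNneq (pi0 _ ca) => ->; rewrite mxE.
have [u] := good_base gP p0 h1 h2.
rewrite mem_cat => /orP[/verticesP[i ->] [k k0 /= e]|/torus/torusP tu [k k0 e]]; last first.
  by have := pa; rewrite e mxE => /eqP; rewrite mulf_eq0 (negPf k0) (negPf (tu a)).
have hb := pi0 b; have hc := pi0 c.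
have : (b == i) && (c == i).
  apply/andP; split.
    have : p 0 b != 0 by rewrite hb // eq_sym.
    by rewrite e mxE vertexE; case: (b == i); rewrite // mulr0 eqxx.
  have : p 0 c != 0 by rewrite hc.
  by rewrite e mxE vertexE; case: (c == i); rewrite // mulr0 eqxx.
by case/andP => /eqP bi /eqP ci; move: cb; rewrite bi ci eqxx.
Qed.

Lemma edge_point a : exists p : 'rV[K]_3, p 0 a = 0 /\ (forall i, i != a -> p 0 i != 0).
Proof.
exists (\row_i (i != a)%:R); split=> [|i ia]; first by rewrite mxE eqxx.
by rewrite mxE ia oner_neq0.
Qed.

Lemma divides_eval l (F : {mpoly K[3]}) p : divides l F -> l.@[p 0] = 0 -> F.@[p 0] = 0.
Proof. by case=> C -> l0; rewrite mevalM l0 mulr0. Qed.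

Lemma not_divides_edge (R : pencil K) a :
  (forall p, p 0 a = 0 -> (forall i, i != a -> p 0 i != 0) ->
    R.1.@[p 0] = 0 -> R.2.@[p 0] = 0 -> False) ->
  generically (fun c1 c2 => ~ divides 'X_a (elem R c1 c2)).
Proof.
move=> nb; apply: generically_subspace => [s t s' t' k l h h'|[]].
  have -> : elem R (k * s + l * s') (k * t + l * t') =
      k *: elem R s t + l *: elem R s' t'.
    by rewrite /elem -!mul_mpolyC !mpolyCD !mpolyCM; ring.
  by apply: dividesD; apply: dividesZ.
rewrite /elem scale1r scale0r addr0 scale0r scale1r add0r => h1 h2.
have [p [pa pi0]] := edge_point a; apply: (nb p pa pi0).
  by apply: divides_eval h1 _; rewrite mevalXU.
by apply: divides_eval h2 _; rewrite mevalXU.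
Qed.

(** Some generator is nonzero at a chosen point with [p 0 a = 0], so it contains a monomial with
    [n a = 0]. Its two other exponents add up to [d] and are at most [d - m] each. *)
Lemma vertex_multiplicity_bound : (2 * m <= d)%N.
Proof.
have [h1 h2] := good_homog gP.
pose a : 'I_3 := ord0; have [b ab] : exists b, a != b by exists (lift a ord0); rewrite neq_lift.
have [c ca cb] := third_index ab; have [p [pa pi0]] := edge_point a.
suff bound F : F \is d.-homog -> (forall i, order_ge m (vertex K i 0) F) ->
    F.@[p 0] <> 0 -> (2 * m <= d)%N.
  have o i : (vertex K i, m) \in vertices m ++ T by rewrite mem_cat; apply/orP; left; apply/verticesP; exists i.
  have [F0|F0] := eqVneq P.1.@[p 0] 0.
    have [G0|G0] := eqVneq P.2.@[p 0] 0; first by case: (no_base_edge pa pi0 F0 G0).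
    by apply: bound h2 _ (elimN eqP G0) => i; case: (good_order gP (o i)).
  by apply: bound h1 _ (elimN eqP F0) => i; case: (good_order gP (o i)).
move=> hF hm F0; have [n nF na] : exists2 n, n \in msupp F & n a = 0%N.
  apply: contrapT => h; apply: F0; rewrite mevalE big1_seq // => n /andP[_ nF].
  rewrite (bigD1 a) //= pa expr0n; case: eqP => [na|]; last by rewrite mul0r mulr0.
  by case: h; exists n.
have := vertex_order_msupp hF (hm b) nF; have := vertex_order_msupp hF (hm c) nF.
by have := dhomog_mf hF nF; rewrite /= mdegE (big_indices _ _ ab ca cb) /= na; lia.
Qed.

Hypotheses (hP' : P'.1 \is (2 * d - 3 * m).-homog /\ P'.2 \is (2 * d - 3 * m).-homog).
Hypotheses (e1 : P.1 \mPo standard_map K = xyz K ^+ m * P'.1)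
  (e2 : P.2 \mPo standard_map K = xyz K ^+ m * P'.2).

Let vertex_in a : (vertex K a, m) \in vertices m ++ T.
Proof. by rewrite mem_cat; apply/orP; left; apply/verticesP; exists a. Qed.

Let md := vertex_multiplicity_bound.
Let r1 := quadratic_image_inv (good_homog gP).1 md e1.
Let r2 := quadratic_image_inv (good_homog gP).2 md e2.

(** A base point here would be a common zero of the leading forms of the old pencil at the vertex
    [a], in a direction that is not radial. *)
Let no_base_edge' a p : p 0 a = 0 -> (forall i, i != a -> p 0 i != 0) ->
  P'.1.@[p 0] = 0 -> P'.2.@[p 0] = 0 -> False.
Proof.
move=> pa pi0 h1 h2; have [hh1 hh2] := good_homog gP.
have l1 := (leading_standard hh1 e1 pa pi0).2 h1.
have l2 := (leading_standard hh2 e2 pa pi0).2 h2.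
have [c ec] := good_tangent gP (vertex_in a) l1 l2.
have [b ba] : exists b, b != a by exists (lift a ord0); rewrite eq_sym neq_lift.
have pb : p 0 b != 0 by rewrite pi0.
have /eqP := ec b; rewrite vertexE (negPf ba) mulr0 /inverse_direction.
by rewrite invr_eq0 (negPf pb).
Qed.

Let vertex_order' F F' a : F \is d.-homog -> F' \is (2 * d - 3 * m).-homog ->
  F' \mPo standard_map K = xyz K ^+ (d - 2 * m) * F ->
  order_ge (d - 2 * m) (vertex K a 0) F'.
Proof.
move=> hF hF' e; apply: (vertex_order hF') => n nF'.
rewrite leqNgt; apply/negP => hn; have dn := dhomog_mf hF' nF'.
move: (nF'); rewrite mcoeff_msupp.
rewrite -mcoeff_comp e (mcoeff_xyz_small _ (i := a)) ?eqxx // swapE.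
by move: dn hn (leq_mdeg n a) => /= -> ; lia.
Qed.

(** Subtract from [v] its component along the vertex to get [w]. If the two other components are
    nonzero, [w] is the direction of a point on an edge of the old plane, where there is no base
    point. If only one is nonzero, [w] points along a coordinate line, and the old tangent clause at
    the vertex off the direction applies through [leading_vertices]. *)
Let tangent' a v : leading (d - 2 * m) (vertex K a 0) v P'.1 = 0 ->
  leading (d - 2 * m) (vertex K a 0) v P'.2 = 0 ->
  exists c, v =1 fun i => c * vertex K a 0 i.
Proof.
move=> l1 l2; have [hh1 hh2] := good_homog gP; have [hp1 hp2] := hP'.
pose w i := v i + - v a * vertex K a 0 i.
have {}l1 : leading (d - 2 * m) (vertex K a 0) w P'.1 = 0.
  by rewrite (leading_along _ _ hp1) //; apply: vertex_order' r1.
have {}l2 : leading (d - 2 * m) (vertex K a 0) w P'.2 = 0.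
  by rewrite (leading_along _ _ hp2) //; apply: vertex_order' r2.
have wa : w a = 0 by rewrite /w vertexE eqxx mulr1 subrr.
have edge b : b != a -> w b != 0 -> (forall i, i != a -> i != b -> w i = 0) -> False.
  move=> ba wb wi; have ab : a != b by rewrite eq_sym.
  have [c ca cb] := third_index ab.
  have we : w =1 fun i => w b * vertex K b 0 i.
    move=> i; rewrite vertexE; case: (index_cases ab ca cb i) => ->.
    - by rewrite wa (negPf ab) mulr0.
    - by rewrite eqxx mulr1.
    - by rewrite (wi c ca cb) (negPf cb) mulr0.
  have key F : leading (d - 2 * m) (vertex K a 0) w F = 0 ->
      leading (d - 2 * m) (vertex K a 0) (vertex K b 0) F = 0.
    rewrite (leading_ext_dir _ _ _ we) leading_scale_dir => /eqP.
    by rewrite mulf_eq0 expf_eq0 (negPf wb) andbF => /eqP.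
  have k1 := leading_vertices ab ca cb hh1 hp1 md e1 (key _ l1).
  have k2 := leading_vertices ab ca cb hh2 hp2 md e2 (key _ l2).
  have [k ek] := good_tangent gP (vertex_in c) k1 k2.
  have bc : b != c by rewrite eq_sym.
  by have /eqP := ek b; rewrite !vertexE eqxx (negPf bc) mulr0 oner_eq0.
exists (v a) => i; apply/eqP; rewrite -subr_eq0 -mulNr -/(w i); apply/eqP.
apply: contrapT => /eqP wi; have ia : i != a by apply: contraNneq wi => ->; rewrite wa.
have [c ca ci] : exists2 c, c != a & c != i by apply: third_index; rewrite eq_sym.
have ai : a != i by rewrite eq_sym.
have [wc|wc] := eqVneq (w c) 0.
  apply: (edge i ia wi) => j ja ji.
  by case: (index_cases ai ca ci j) => ej; [move: ja; rewrite ej eqxx|move: ji; rewrite ej eqxx|rewrite ej].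
pose p : 'rV[K]_3 := \row_j (w j)^-1.
have pa : p 0 a = 0 by rewrite mxE wa invr0.
have pi0 j : j != a -> p 0 j != 0.
  move=> ja; rewrite mxE invr_eq0.
  by case: (index_cases ai ca ci j) => ej; [move: ja; rewrite ej eqxx|rewrite ej|rewrite ej].
have ed : inverse_direction p =1 w by move=> j; rewrite /inverse_direction mxE invrK.
apply: (no_base_edge pa pi0).
  by apply/(leading_standard hp1 r1 pa pi0); rewrite (leading_ext_dir _ _ _ ed).
by apply/(leading_standard hp2 r2 pa pi0); rewrite (leading_ext_dir _ _ _ ed).
Qed.

(** On the edge the pencil restricts to two polynomials without common zeros off the vertices. A
    singular point of an element would be a double root of its restriction, which does not occur
    generically. *)
Let smooth_edge a : generically (fun c1 c2 => forall p, p 0 a = 0 ->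
  (forall i, i != a -> p 0 i != 0) -> ~ order_ge 2 (p 0) (elem P' c1 c2)).
Proof.
have [b ab] : exists b, a != b by exists (lift a ord0); rewrite neq_lift.
have [c ca cb] := third_index ab; have ba : b != a by rewrite eq_sym.
pose line := line_poly (vertex K b 0) (vertex K c 0).
have lineE F l : (line F).[l] = F.@[(vertex K b + l *: vertex K c) 0].
  by rewrite line_poly_horner; apply: meval_eq => i; rewrite !mxE.
have on_edge l : l != 0 -> let q := vertex K b + l *: vertex K c in
    q 0 a = 0 /\ forall i, i != a -> q 0 i != 0.
  move=> l0 q; have qE i : q 0 i = (i == b)%:R + l * (i == c)%:R.
    by rewrite !mxE eqxx.
  have ac : a != c by rewrite eq_sym.
  have bc : b != c by rewrite eq_sym.
  split=> [|i ia]; first by rewrite qE (negPf ab) (negPf ac) mulr0 addr0.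
  case: (index_cases ab ca cb i) => ei; first by move: ia; rewrite ei eqxx.
    by rewrite qE ei eqxx (negPf bc) mulr0 addr0 oner_neq0.
  by rewrite qE ei eqxx (negPf cb) add0r mulr1.
have := @pencil_generic_squarefree _ (line P'.1) (line P'.2).
have hyp l : l != 0 -> (line P'.1).[l] = 0 -> (line P'.2).[l] != 0.
  move=> l0 f0; have [qa qi] := on_edge l l0; apply/eqP => g0.
  by apply: (no_base_edge' qa qi); rewrite -lineE.
move=> /(_ hyp); apply: genericallyW => c1 c2 sq p pa pi0 o2.
pose l := p 0 c / p 0 b; have pb := pi0 b ba; have pc := pi0 c ca.
have l0 : l != 0 by rewrite mulf_neq0 ?invr_neq0.
have hE := elem_homog c1 c2 hP'.
have eq_line : c1 *: line P'.1 + c2 *: line P'.2 = line (elem P' c1 c2).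
  by rewrite /line /line_poly /elem mmapD !mmapZ !mul_polyC.
have o : order_ge 2 ((vertex K b + l *: vertex K c) 0) (elem P' c1 c2).
  apply: (order_ge_same_point hE _ o2); exists (p 0 b)^-1; first by rewrite invr_neq0.
  have ac : a != c by rewrite eq_sym.
  have bc : b != c by rewrite eq_sym.
  apply/rowP => i; rewrite !mxE eqxx /=.
  case: (index_cases ab ca cb i) => ->; rewrite ?eqxx ?(negPf ab) ?(negPf ac) ?(negPf bc) ?(negPf cb).
  - by rewrite pa !mulr0 addr0.
  - by rewrite mulr0 addr0 mulVf.
  - by rewrite add0r mulr1 mulrC.
have := sq l l0; rewrite eq_line lineE (order_ge_eval o) => /(_ erefl)/eqP; apply.
rewrite /line line_poly_deriv horner_sum big1 // => i _.
by rewrite hornerZ -/line lineE (order_ge_eval ((order_geSP o).2 i)) mulr0.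
Qed.

Lemma good_standard : good P' (2 * d - 3 * m) (vertices (d - 2 * m) ++ standard_image T).
Proof.
have [hh1 hh2] := good_homog gP; have [hp1 hp2] := hP'.
have vin a : (vertex K a, (d - 2 * m)%N) \in vertices (d - 2 * m) ++ standard_image T.
  by rewrite mem_cat; apply/orP; left; apply/verticesP; exists a.
have xyzm p : (xyz K).@[p 0] != 0 -> (xyz K ^+ m).@[p 0] != 0.
  by move=> h; rewrite rmorphXn expf_neq0.
have torus_im u : u \in T -> (xyz K).@[point_map (standard_map K) u.1 0] != 0.
  by move=> uT; rewrite xyz_map expf_neq0 // torus.
have smooth_all : generically (fun c1 c2 => forall a p, p 0 a = 0 ->
    (forall i, i != a -> p 0 i != 0) -> ~ order_ge 2 (p 0) (elem P' c1 c2)).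
  exact: generically_index smooth_edge.
have ndiv_all (R : pencil K) : (forall a p, p 0 a = 0 -> (forall i, i != a -> p 0 i != 0) ->
    R.1.@[p 0] = 0 -> R.2.@[p 0] = 0 -> False) ->
    generically (fun c1 c2 => forall a, ~ divides 'X_a (elem R c1 c2)).
  by move=> nb; apply: generically_index => a; apply/not_divides_edge/nb.
apply: (good_transport gP standard_birational hP' e1 e2 xyzm (xyz_neq0 K)).
- move=> u; rewrite mem_cat => /orP[/verticesP[a ->]|/mapP[u0 u0T ->]] /=.
    exact: vertex_neq0.
  by apply: contraTneq (torus_im _ u0T) => ->; rewrite xyz_eval (bigD1 ord0) //= mxE mul0r eqxx.
- move=> u; rewrite mem_cat => /orP[/verticesP[a ->]|uT]; [right|left].
    move=> p hp; apply: torus_not_vertex; rewrite xyz_map.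
    by rewrite expf_neq0.
  exists (point_map (standard_map K) u.1, u.2).
    by rewrite mem_cat; apply/orP; right; apply/mapP; exists u.
  split; first exact: torus_im.
  rewrite (point_mapK standard_birational); exists (xyz K).@[u.1 0] => //.
  exact: torus.
- move=> u; rewrite mem_cat => /orP[/verticesP[a ->]|/mapP[u0 u0T ->]] /=; [right|left].
    by split; [apply: vertex_order' r1|apply: vertex_order' r2|exact: tangent'].
  split; first exact: torus_im.
  exists u0; first by rewrite mem_cat u0T orbT.
  split=> //; rewrite (point_mapK standard_birational); exists (xyz K).@[u0.1 0] => //.
  exact: torus.
- move=> p p0 hp h1 h2; case: (vertex_or_edge p0 hp) => [[a pa]|[a [pa pi0]]].
    by exists (vertex K a, (d - 2 * m)%N).
  by case: (no_base_edge' pa pi0 h1 h2).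
- apply: genericallyW smooth_all => c1 c2 sm p p0 hp o2.
  case: (vertex_or_edge p0 hp) => [[a pa]|[a [pa pi0]]].
    by exists (vertex K a, (d - 2 * m)%N).
  by case: (sm a p pa pi0).
- have := generically_and (ndiv_all P no_base_edge)
    (generically_and (ndiv_all P' no_base_edge') (generically_nonzero K)).
  apply: genericallyW => c1 c2 [n1 [n2 c0]] L iota xi ff.
  have E0 : elem P c1 c2 != 0 by apply: contra_neq c0; apply: (good_indep gP).
  have hE := elem_homog c1 c2 (good_homog gP).
  have [_ nunit _] := function_field_irreducible E0 hE ff.
  have [_ ffH _] := ff.
  (* If a coordinate vanished on the curve, the equation would divide this prime. It would then be a
     unit or divisible by the coordinate, and both are excluded. *)
  have xi0 i : xi i != 0.
    apply/eqP => xi0; have : divides (elem P c1 c2) 'X_i.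
      by apply/(ffH 1%N); [exact: var_homog|rewrite mmapX mmap1U].
    case=> D eD; have [_ _ /(_ D (elem P c1 c2))] := var_prime K i.
    case=> [|[D' eD']|/n1//]; first by rewrite -eD; apply: divides_refl.
    move/negP: nunit; apply; apply/unitrPr; exists D'.
    apply: (mulIf (mpolyX_neq0 K U_(i))); rewrite mul1r {2}eD eD'; ring.
  have hx : mmap iota xi (xyz K) != 0.
    rewrite rmorph_prod /= prodf_seq_neq0; apply/allP => i _.
    by rewrite mmapX mmap1U xi0.
  apply: (function_field_transport (H' := elem P' c1 c2) (g := xyz K ^+ m) ff hE
    (bp_pos standard_birational) (bp_homog standard_birational)
    (bp_homog' standard_birational) (bp_right standard_birational)
    (bp_left standard_birational)) => //.
  + by rewrite /elem comp_mpolyD !comp_mpolyZ e1 e2 mulrDr -!scalerAr.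
  + by rewrite -mmap_comp rmorphXn /= xyz_comp !rmorphXn /= !expf_neq0.
  + by move=> F k; apply: strip_xyz.
Qed.

End Image.
End StandardTransport.

(** * The twelve points and the quadratic maps in coordinates *)

Definition eadd (a b : eisenstein) : eisenstein := (a.1 + b.1, a.2 + b.2).
(** Multiplication in Z[tau] with [tau^2 = - tau - 1]. *)
Definition emul (a b : eisenstein) : eisenstein :=
  (a.1 * b.1 - a.2 * b.2, a.1 * b.2 + a.2 * b.1 - a.2 * b.2).
Definition eopp (a : eisenstein) : eisenstein := (- a.1, - a.2).

Section Codes.
Variables (K : numClosedFieldType) (tau : K).
Hypothesis tau_eq : tau ^+ 2 + tau + 1 = 0.

Let tau2 : tau ^+ 2 = - tau - 1.
Proof. by apply/eqP; rewrite -subr_eq0 -[X in _ == X]tau_eq; apply/eqP; ring. Qed.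

Lemma eis_valD a b : eis_val tau (eadd a b) = eis_val tau a + eis_val tau b.
Proof. by rewrite /eis_val /= !rmorphD /=; ring. Qed.

Lemma eis_valN a : eis_val tau (eopp a) = - eis_val tau a.
Proof. by rewrite /eis_val /= !rmorphN /=; ring. Qed.

Lemma eis_valM a b : eis_val tau (emul a b) = eis_val tau a * eis_val tau b.
Proof.
rewrite /eis_val /= !(rmorphB, rmorphD, rmorphM) /=.
have -> (x y z t : K) : (x + y * tau) * (z + t * tau) =
  x * z + (x * t + y * z) * tau + y * t * tau ^+ 2 by ring.
by rewrite tau2; ring.
Qed.

(** This makes computation with codes decisive: two codes have the same value only if they are
    equal. *)
Lemma eis_val_eq0 a : (eis_val tau a == 0) = (a == (0, 0)).
Proof.
apply/eqP/eqP => [a0|->]; last by rewrite /eis_val mul0r addr0.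
case: a a0 => m n a0.
(* The second factor is the conjugate of the first, so the product is the norm [m^2 - m n + n^2];
   four times the norm is [(2 m - n)^2 + 3 n^2]. *)
have : eis_val tau (emul (m, n) (m - n, - n)) = 0 by rewrite eis_valM a0 mul0r.
rewrite /emul /eis_val /= (_ : m * - n + n * (m - n) - n * - n = 0); last by ring.
rewrite mul0r addr0 => /eqP; rewrite intr_eq0 => /eqP h.
have : (m * 2 - n) ^+ 2 + n ^+ 2 *+ 3 = 0 by rewrite -[RHS](mul0r (4 : int)) -h; ring.
move=> /eqP; rewrite paddr_eq0 ?sqr_ge0 ?mulrn_wge0 ?sqr_ge0 //.
rewrite mulrn_eq0 /= !expf_eq0 /= => /andP[/eqP h1 /eqP n0].
by move: h1; rewrite n0 subr0 => /eqP; rewrite mulf_eq0 orbF => /eqP->.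
Qed.

Definition ezero : eisenstein := (0, 0).
Definition coord (p : point_code) (i : nat) : eisenstein :=
  if i is 0 then p.1.1 else if i is 1 then p.1.2 else p.2.

Lemma point_valE p (i : 'I_3) : point_val tau p 0 i = eis_val tau (coord p i).
Proof. by rewrite mxE; case: i => [[|[|[|i]]] hi]. Qed.

Definition minor (p q : point_code) i j : eisenstein :=
  eadd (emul (coord p i) (coord q j)) (eopp (emul (coord p j) (coord q i))).

Definition is_point (p : point_code) : bool :=
  [|| coord p 0 != ezero, coord p 1 != ezero | coord p 2 != ezero].

Definition same_code (p q : point_code) : bool :=
  [&& is_point p, is_point q, minor p q 0 1 == ezero, minor p q 0 2 == ezero
    & minor p q 1 2 == ezero].

Lemma point_val_neq0 p : is_point p -> point_val tau p != 0.
Proof.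
move=> h; apply/eqP => /rowP p0.
have e i (hi : (i < 3)%N) : coord p i = ezero.
  apply/eqP; rewrite -eis_val_eq0; have := p0 (Ordinal hi).
  by rewrite point_valE mxE => ->.
by move: h; rewrite /is_point !e.
Qed.

Lemma minor_val p q (i j : 'I_3) : eis_val tau (minor p q i j) =
  point_val tau p 0 i * point_val tau q 0 j - point_val tau p 0 j * point_val tau q 0 i.
Proof. by rewrite !point_valE eis_valD eis_valN !eis_valM. Qed.

Lemma minor_antisym p q i j : minor p q i j = eopp (minor p q j i).
Proof. by rewrite /minor /eadd /eopp /emul /=; congr (_, _); ring. Qed.

Lemma minor_diag p q i : minor p q i i = ezero.
Proof. by rewrite /minor /eadd /eopp /= !subrr. Qed.

Lemma same_codeP p q : is_point p -> is_point q ->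
  same_code p q <-> same_point (point_val tau p) (point_val tau q).
Proof.
move=> hp hq; split=> [/and5P[_ _ /eqP m01 /eqP m02 /eqP m12]|[k k0 e]]; last first.
  have m i j (hi : (i < 3)%N) (hj : (j < 3)%N) : minor p q i j == ezero.
    rewrite -eis_val_eq0; have := minor_val p q (Ordinal hi) (Ordinal hj).
    by rewrite /= => ->; rewrite e !mxE; apply/eqP; ring.
  by rewrite /same_code hp hq !m.
have minor0 (i j : 'I_3) : minor p q i j = ezero.
  have e0 : eopp ezero = ezero by [].
  case: i j => [[|[|[|i]]] hi] [[|[|[|j]]] hj] //=; rewrite ?minor_diag //;
    by rewrite minor_antisym ?m01 ?m02 ?m12 e0.
have cross (i j : 'I_3) : point_val tau p 0 i * point_val tau q 0 j =
    point_val tau p 0 j * point_val tau q 0 i.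
  by apply/eqP; rewrite -subr_eq0 -minor_val minor0 eis_val_eq0.
have [j qj] : exists j, point_val tau q 0 j != 0.
  apply: contrapT => h; have := point_val_neq0 hq; apply/negP; rewrite negbK.
  apply/eqP/rowP => j; rewrite [RHS]mxE; apply: contrapT => /eqP qj.
  by apply: h; exists j.
have pe : point_val tau p = (point_val tau p 0 j / point_val tau q 0 j) *: point_val tau q.
  by apply/rowP => i; rewrite [RHS]mxE; apply: (mulIf qj); rewrite cross; field.
exists (point_val tau p 0 j / point_val tau q 0 j) => //.
by apply: contraNneq (point_val_neq0 hp) => k0; rewrite pe k0 scale0r.
Qed.

End Codes.

Definition idx_eqb (i j : cremona_index) : bool :=
  match i, j with
  | Idx1, Idx1 | IdxTau, IdxTau | IdxTau2, IdxTau2 | IdxInf, IdxInf => true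
  | _, _ => false
  end.

Lemma idx_eqbP : Equality.axiom idx_eqb.
Proof. by case; case; constructor. Qed.

HB.instance Definition _ := hasDecEq.Build cremona_index idx_eqbP.

Definition indices : seq cremona_index := [:: Idx1; IdxTau; IdxTau2; IdxInf].

Definition e0 : eisenstein := (0, 0).
Definition e1 : eisenstein := (1, 0).
Definition et : eisenstein := (0, 1).
Definition et2 : eisenstein := (- 1, - 1).
Definition e3 : eisenstein := (3, 0).

(* The parameter s = 1, tau, tau^2 of an index; the value at IdxInf is unused. *)
Definition idx_s (i : cremona_index) : eisenstein :=
  match i with IdxTau => et | IdxTau2 => et2 | _ => e1 end.

Definition mat_code := (point_code * point_code * point_code)%type.

Definition scalar_code (c : eisenstein) : mat_code :=
  ((c, e0, e0), (e0, c, e0), (e0, e0, c)).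

(* Up to a scalar factor, the map of index i is the standard quadratic map
   between the changes of coordinates target_mat i and source_mat i, which
   move the three points of the class of i to the vertices. *)
Definition target_mat (i : cremona_index) : mat_code :=
  let s := idx_s i in let s2 := emul s s in
  if i is IdxInf then scalar_code e1 else
  ((s, emul s et, emul s et2), (s, s, s), (s2, emul s2 et2, emul s2 et)).

(** Inverse up to the factor 3, which keeps the entries in Z[tau]. For the index infinity the scalar
    3 gives the same product. *)
Definition target_inv (i : cremona_index) : mat_code :=
  let s := idx_s i in let s2 := emul s s in
  if i is IdxInf then scalar_code e3 else
  ((s2, s2, s), (emul et2 s2, s2, emul et s), (emul et s2, s2, emul et2 s)).

Definition source_mat (i : cremona_index) : mat_code :=
  let s := idx_s i in let s2 := emul s s in
  if i is IdxInf then scalar_code e1 else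
  ((e1, e1, s2), (e1, et, emul et2 s2), (e1, et2, emul et s2)).

Definition source_inv (i : cremona_index) : mat_code :=
  let s := idx_s i in
  if i is IdxInf then scalar_code e3 else
  ((e1, e1, e1), (e1, et2, et), (s, emul s et, emul s et2)).

Definition mat_row (A : mat_code) (i : nat) : point_code :=
  if i is 0 then A.1.1 else if i is 1 then A.1.2 else A.2.

Definition dot (p q : point_code) : eisenstein :=
  eadd (emul p.1.1 q.1.1) (eadd (emul p.1.2 q.1.2) (emul p.2 q.2)).

Definition mat_app (A : mat_code) (p : point_code) : point_code :=
  (dot A.1.1 p, dot A.1.2 p, dot A.2 p).

Definition mat_col (A : mat_code) (j : nat) : point_code :=
  (coord A.1.1 j, coord A.1.2 j, coord A.2 j).

Definition std_code (p : point_code) : point_code :=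
  (emul p.1.2 p.2, emul p.1.1 p.2, emul p.1.1 p.1.2).

Definition vertex_code (a : nat) : point_code :=
  (if a is 0 then e1 else e0, if a is 1 then e1 else e0, if a is 2 then e1 else e0).

Definition torus_code (p : point_code) : bool :=
  [&& p.1.1 != e0, p.1.2 != e0 & p.2 != e0].

Definition class_points (i : cremona_index) : seq point_code :=
  let s := idx_s i in
  if i is IdxInf then [:: vertex_code 0; vertex_code 1; vertex_code 2] else
  [:: (e1, e1, s); (e1, et, emul et2 s); (e1, et2, emul et s)].

Definition points : seq (point_code * cremona_index) :=
  [seq (p, i) | i <- indices, p <- class_points i].

(* The map of index i permutes the other three classes. *)
Definition idx_perm (i j : cremona_index) : cremona_index :=
  match i, j with
  | (Idx1 | IdxInf), IdxTau => IdxTau2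
  | (Idx1 | IdxInf), IdxTau2 => IdxTau
  | IdxTau, Idx1 => IdxTau2
  | IdxTau, IdxTau2 => Idx1
  | IdxTau2, Idx1 => IdxTau
  | IdxTau2, IdxTau => Idx1
  | _, _ => j
  end.

Definition next_mult (i : cremona_index) (d : nat) (mu : cremona_index -> nat)
    (j : cremona_index) : nat :=
  if idx_eqb i j then (d - 2 * mu i)%N else mu (idx_perm i j).

Definition mat_inverse_ok (A B : mat_code) : bool :=
  all (fun i => all (fun j => dot (mat_row A i) (mat_col B j) ==
    (if i == j then e3 else e0)) (iota 0 3)) (iota 0 3).

(** All that [good_linear] and [good_standard] ask of the twelve points. The target matrix takes the
    vertices to the class of [i], and the nine other points come from points off the triangle. The
    source matrix takes the class of [i] to the vertices, and every other point to the standard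
    image of one in the class given by [idx_perm]. Each correspondence is tested in both
    directions. *)
Definition step_ok (i : cremona_index) : bool :=
  let N := target_mat i in let N' := target_inv i in let M := source_mat i in
  [&& mat_inverse_ok N N', mat_inverse_ok M (source_inv i),
      all (fun u => is_point u.1) points,
      all (fun u => if u.2 == i then has (fun a => same_code (mat_app N (vertex_code a)) u.1) (iota 0 3)
         else same_code (mat_app N (mat_app N' u.1)) u.1 && torus_code (mat_app N' u.1)) points,
      all (fun a => has (fun u => (u.2 == i) && same_code (mat_app N (vertex_code a)) u.1) points) (iota 0 3),
      all (fun u => if u.2 == i then has (fun a => same_code (mat_app M u.1) (vertex_code a)) (iota 0 3)
         else has (fun w => [&& w.2 != i, w.2 == idx_perm i u.2
           & same_code (mat_app M u.1) (std_code (mat_app N' w.1))]) points) points,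
      all (fun a => has (fun u => (u.2 == i) && same_code (mat_app M u.1) (vertex_code a)) points) (iota 0 3)
    & all (fun w => (w.2 == i) || has (fun u => [&& u.2 != i, w.2 == idx_perm i u.2
           & same_code (mat_app M u.1) (std_code (mat_app N' w.1))]) points) points].

Lemma step_okP i : step_ok i.
Proof. by case: i; vm_compute. Qed.

Opaque points.

Section Steps.
Variables (K : numClosedFieldType) (tau : K).
Hypothesis tau_eq : tau ^+ 2 + tau + 1 = 0.
Implicit Types (P : pencil K) (mu : cremona_index -> nat) (p q : point_code).
Local Notation pval := (point_val tau).

Definition mat_val (A : mat_code) : 'M[K]_3 :=
  \matrix_(i, j) eis_val tau (coord (mat_row A i) j).

Definition config mu : seq ('rV[K]_3 * nat) := [seq (pval u.1, mu u.2) | u <- points].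

Lemma sum3 (F : 'I_3 -> K) :
  \sum_i F i = F (@Ordinal 3 0 isT) + (F (@Ordinal 3 1 isT) + F (@Ordinal 3 2 isT)).
Proof. exact: big_indices. Qed.

Lemma eis_val_dot p q : eis_val tau (dot p q) =
  \sum_(k < 3) eis_val tau (coord p k) * eis_val tau (coord q k).
Proof. by rewrite sum3 /= !(eis_valD, eis_valM tau_eq). Qed.

Lemma point_val_app A p : pval (mat_app A p) = pval p *m (mat_val A)^T.
Proof.
apply/rowP => i; rewrite point_valE mxE.
have -> : coord (mat_app A p) i = dot (mat_row A i) p by case: i => [[|[|[|i]]] hi].
rewrite eis_val_dot; apply: eq_bigr => j _.
by rewrite point_valE !mxE mulrC.
Qed.

Lemma mat_val_mul A B : mat_inverse_ok A B -> mat_val A *m mat_val B = (3%:R)%:M.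
Proof.
move=> /allP ok; apply/matrixP => i j.
have i3 (k : 'I_3) : (k : nat) \in iota 0 3 by rewrite mem_iota /=.
have /allP/(_ _ (i3 j))/eqP e := ok _ (i3 i).
rewrite !mxE; transitivity (eis_val tau (dot (mat_row A i) (mat_col B j))).
  rewrite eis_val_dot; apply: eq_bigr => k _; rewrite !mxE; congr (_ * eis_val _ _).
  by case: k => [[|[|[|k]]] hk].
rewrite e (inj_eq val_inj) /eis_val; case: (i == j) => /=; last by rewrite mul0r addr0.
by rewrite mul0r addr0.
Qed.

Lemma pval_vertex a (ha : (a < 3)%N) : pval (vertex_code a) = vertex K (Ordinal ha).
Proof.
apply/rowP => i; rewrite point_valE vertexE.
by case: a ha => [|[|[|a]]] ha //; case: i => [[|[|[|i]]] hi]; rewrite //= /eis_val ?mul0r ?addr0.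
Qed.

Lemma pval_std p : pval (std_code p) = point_map (standard_map K) (pval p).
Proof.
apply/rowP => i; rewrite point_valE mxE.
by case: i => [[|[|[|i]]] hi] //; rewrite /= (eis_valM tau_eq) (tnth_nth 0) /=
  mevalM !mevalXU !point_valE.
Qed.

Lemma pval_torus p : torus_code p -> (xyz K).@[pval p 0] != 0.
Proof.
move=> /and3P[h0 h1 h2]; apply/torusP => i; rewrite point_valE eis_val_eq0 //.
by case: i => [[|[|[|i]]] hi].
Qed.

Lemma same_code_val p q : same_code p q -> same_point (pval p) (pval q).
Proof. by move=> h; case/and3P: (h) => hp hq _; apply/(same_codeP tau_eq hp hq). Qed.

Lemma configP mu u : u \in config mu <->
  exists p j, (p, j) \in points /\ u = (pval p, mu j).
Proof.
split=> [/mapP[[p j] h ->]|[p [j [h ->]]]]; first by exists p, j.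
by apply/mapP; exists (p, j).
Qed.

Definition target_map i := linear_map (mat_val (target_mat i)).
Definition source_map i := linear_map (mat_val (source_mat i)).

Lemma target_mul i : mat_val (target_mat i) *m mat_val (target_inv i) = (3%:R)%:M.
Proof. by apply: mat_val_mul; case/and5P: (step_okP i). Qed.

Lemma source_mul i : mat_val (source_mat i) *m mat_val (source_inv i) = (3%:R)%:M.
Proof. by apply: mat_val_mul; case/and5P: (step_okP i). Qed.

Let three_neq0 : 3%:R != 0 :> K. Proof. by rewrite pnatr_eq0. Qed.

Let iota3 (a : nat) : a \in iota 0 3 -> (a < 3)%N.
Proof. by rewrite mem_iota. Qed.

Let torus_points i mu : seq ('rV[K]_3 * nat) :=
  [seq (pval (mat_app (target_inv i) u.1), mu u.2) | u <- points & u.2 != i].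

Lemma good_target i P d mu : good P d (config mu) ->
  good (P.1 \mPo target_map i, P.2 \mPo target_map i) d
    (vertices K (mu i) ++ torus_points i mu).
Proof.
have /and5P[_ _ /allP ok1 /allP ok2 /and4P[/allP ok3 _ _ _]] := step_okP i.
move=> gP; apply: (good_linear gP (target_mul i) three_neq0).
- move=> u; rewrite mem_cat => /orP[/verticesP[a ->]|/mapP[[p j]]] /=.
    exact: vertex_neq0.
  rewrite mem_filter /= => /andP[ji pj] ->.
  have := ok2 _ pj; simpl fst; simpl snd; rewrite (negPf ji) => /andP[/and3P[h _ _] /andP[t0 _]].
  by apply: point_val_neq0 => //; rewrite /is_point /= t0.
- move=> u /configP[p [j [pj ->]]]; have := ok2 _ pj; simpl fst; simpl snd.
  case: eqVneq => [_|ji].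
    move=> /hasP[a /iota3 a3 /same_code_val]; rewrite point_val_app (pval_vertex a3) => h.
    exists (vertex K (Ordinal a3), mu i) => //.
    by rewrite mem_cat; apply/orP; left; apply/verticesP; exists (Ordinal a3).
  move=> /andP[/same_code_val h _]; exists (pval (mat_app (target_inv i) p), mu j).
    by rewrite mem_cat; apply/orP; right; apply/mapP; exists (p, j); rewrite // mem_filter /= ji.
  by rewrite /= -point_val_app.
- move=> u; rewrite mem_cat => /orP[/verticesP[[a a3] ->]|/mapP[[p j]]] /=.
    have /ok3/hasP[[p j] pj /andP[/eqP /= ji /same_code_val]] : a \in iota 0 3 by rewrite mem_iota.
    rewrite point_val_app (pval_vertex a3) => h.
    by exists (pval p, mu j); [apply/configP; exists p, j|rewrite /= ji].
  rewrite mem_filter /= => /andP[ji pj] ->.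
  have := ok2 _ pj; simpl fst; simpl snd; rewrite (negPf ji) => /andP[/same_code_val + _].
  rewrite point_val_app => h.
  by exists (pval p, mu j); [apply/configP; exists p, j|].
Qed.

Lemma good_source i (A : pencil K) d e mu :
  good A e (vertices K (d - 2 * mu i) ++ standard_image (torus_points i mu)) ->
  good (A.1 \mPo source_map i, A.2 \mPo source_map i) e (config (next_mult i d mu)).
Proof.
have /and5P[_ _ /allP ok1 /allP ok2 /and4P[_ /allP ok4 /allP ok5 /allP ok6]] := step_okP i.
have next_i : next_mult i d mu i = (d - 2 * mu i)%N.
  by rewrite /next_mult; case: (idx_eqbP i i).
have next_ne j : j != i -> next_mult i d mu j = mu (idx_perm i j).
  by rewrite /next_mult; case: (idx_eqbP i j) => [->|]; rewrite ?eqxx.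
move=> gA; apply: (good_linear gA (source_mul i) three_neq0).
- move=> u /configP[p [j [pj ->]]] /=.
  by apply: point_val_neq0 => //; apply: ok1 pj.
- move=> u; rewrite mem_cat => /orP[/verticesP[[a a3] ->]|/mapP[u0 /mapP[[p j]]]] /=.
    have /ok5/hasP[[p j] pj /andP[/eqP /= ji /same_code_val]] : a \in iota 0 3 by rewrite mem_iota.
    rewrite point_val_app (pval_vertex a3) => h.
    by exists (pval p, next_mult i d mu j); [apply/configP; exists p, j|].
  rewrite mem_filter /= => /andP[ji pj] -> ->.
  have := ok6 _ pj; rewrite /= (negPf ji) /= => /hasP[[q k] qk /and3P[/= ki /eqP jk /same_code_val]].
  rewrite point_val_app pval_std => h.
  by exists (pval q, next_mult i d mu k); [apply/configP; exists q, k|].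
- move=> u /configP[p [j [pj ->]]]; have := ok4 _ pj; simpl fst; simpl snd.
  case: eqVneq => [->|ji].
    move=> /hasP[a /iota3 a3 /same_code_val]; rewrite point_val_app (pval_vertex a3) => h.
    exists (vertex K (Ordinal a3), (d - 2 * mu i)%N); last by rewrite next_i.
    by rewrite mem_cat; apply/orP; left; apply/verticesP; exists (Ordinal a3).
  move=> /hasP[[q k] qk /and3P[/= ki /eqP kj /same_code_val]].
  rewrite point_val_app pval_std => h.
  exists (point_map (standard_map K) (pval (mat_app (target_inv i) q)), mu k).
    rewrite mem_cat; apply/orP; right; apply/mapP.
    exists (pval (mat_app (target_inv i) q), mu k) => //.
    by apply/mapP; exists (q, k); rewrite // mem_filter /= ki.
  by rewrite next_ne // kj.
Qed.

Lemma good_step i P d mu : good P d (config mu) -> exists A : pencil K,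
  [/\ A.1 \is (2 * d - 3 * mu i).-homog /\ A.2 \is (2 * d - 3 * mu i).-homog,
      (P.1 \mPo target_map i) \mPo standard_map K = xyz K ^+ mu i * A.1,
      (P.2 \mPo target_map i) \mPo standard_map K = xyz K ^+ mu i * A.2
    & good (A.1 \mPo source_map i, A.2 \mPo source_map i) (2 * d - 3 * mu i)
        (config (next_mult i d mu))].
Proof.
move=> gP; have gB := good_target i gP; have [h1 h2] := good_homog gB.
have vin a : (vertex K a, mu i) \in vertices K (mu i) ++ torus_points i mu.
  by rewrite mem_cat; apply/orP; left; apply/verticesP; exists a.
have [A1 [hA1 eA1]] := quadratic_image h1
  (fun n nF a => vertex_order_msupp h1 (good_order gB (vin a)).1 nF).
have [A2 [hA2 eA2]] := quadratic_image h2
  (fun n nF a => vertex_order_msupp h2 (good_order gB (vin a)).2 nF).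
exists (A1, A2); split=> //; apply: (good_source (d := d)).
apply: (good_standard gB) => // u /mapP[[p j]]; rewrite mem_filter /= => /andP[ji pj] ->.
have /and5P[_ _ _ /allP ok2 _] := step_okP i.
have := ok2 _ pj; simpl fst; simpl snd; rewrite (negPf ji) => /andP[_ t].
exact: pval_torus.
Qed.

End Steps.

(** * Arithmetic of polynomial codes *)

Definition exponents := (nat * nat * nat)%type.
Definition term_code := (eisenstein * exponents)%type.

Definition tc_mul (u w : term_code) : term_code :=
  (emul u.1 w.1, (u.2.1.1 + w.2.1.1, u.2.1.2 + w.2.1.2, u.2.2 + w.2.2)%N).

Definition pc_mul (P Q : poly_code) : poly_code :=
  foldr (fun u acc => map (tc_mul u) Q ++ acc) [::] P.

Definition pc_const (c : eisenstein) : poly_code := [:: (c, (0, 0, 0)%N)].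

Definition pc_exp (P : poly_code) (n : nat) : poly_code :=
  nat_rect (fun=> poly_code) (pc_const e1) (fun _ acc => pc_mul P acc) n.

Definition pc_subst (P A B C : poly_code) : poly_code :=
  foldr (fun u acc =>
    pc_mul (pc_const u.1)
      (pc_mul (pc_mul (pc_exp A u.2.1.1) (pc_exp B u.2.1.2)) (pc_exp C u.2.2)) ++ acc)
    [::] P.

Definition pc_linear (r : point_code) : poly_code :=
  [:: (r.1.1, (1, 0, 0)%N); (r.1.2, (0, 1, 0)%N); (r.2, (0, 0, 1)%N)].

Definition pc_map (A : mat_code) (P : poly_code) : poly_code :=
  pc_subst P (pc_linear A.1.1) (pc_linear A.1.2) (pc_linear A.2).

(* Composition with the standard map followed by division by (xyz)^m: the
   terms not divisible by (xyz)^m cancel and are dropped. *)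
Definition tc_std (m : nat) (u : term_code) : poly_code :=
  let e := u.2 in
  if (m <= e.1.2 + e.2)%N && ((m <= e.1.1 + e.2)%N && (m <= e.1.1 + e.1.2)%N) then
    [:: (u.1, (e.1.2 + e.2 - m, e.1.1 + e.2 - m, e.1.1 + e.1.2 - m)%N)]
  else [::].

Definition pc_std (m : nat) (P : poly_code) : poly_code :=
  foldr (fun u acc => tc_std m u ++ acc) [::] P.

Definition pc_step (i : cremona_index) (m : nat) (P : poly_code) : poly_code :=
  pc_map (source_mat i) (pc_std m (pc_map (target_mat i) P)).

Definition pc_coeff (P : poly_code) (e : exponents) : eisenstein :=
  foldr (fun u acc => if u.2 == e then eadd u.1 acc else acc) e0 P.

(** Codes are not normalized, as terms may repeat or cancel; coefficients are therefore collected at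
    every exponent that occurs. *)
Definition pc_eq (P Q : poly_code) : bool :=
  all (fun e => pc_coeff P e == pc_coeff Q e) (undup (map snd (P ++ Q))).

Section PolyCodes.
Variables (K : numClosedFieldType) (tau : K).
Hypothesis tau_eq : tau ^+ 2 + tau + 1 = 0.
Local Notation x := (vx K).
Local Notation y := (vy K).
Local Notation z := (vz K).
Local Notation val := (poly_val tau).
Implicit Types (P Q A B C : poly_code).

Lemma poly_val_cat P Q : val (P ++ Q) = val P + val Q.
Proof. exact: big_cat. Qed.

Lemma poly_val_cons u P :
  val (u :: P) = eis_val tau u.1 *: (x ^+ u.2.1.1 * y ^+ u.2.1.2 * z ^+ u.2.2) + val P.
Proof. exact: big_cons. Qed.

Lemma poly_val_nil : val [::] = 0. Proof. exact: big_nil. Qed.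

Lemma poly_val_map_mul u Q :
  val (map (tc_mul u) Q) = val [:: u] * val Q.
Proof.
elim: Q => [|w Q IH]; first by rewrite /= poly_val_nil mulr0.
rewrite /= !poly_val_cons poly_val_nil addr0 IH poly_val_cons poly_val_nil addr0 mulrDr.
congr (_ + _); rewrite /= (eis_valM tau_eq) !exprD -!mul_mpolyC mpolyCM; ring.
Qed.

Lemma poly_val_mul P Q : val (pc_mul P Q) = val P * val Q.
Proof.
elim: P => [|u P IH]; first by rewrite /= poly_val_nil mul0r.
by rewrite /= poly_val_cat poly_val_map_mul IH !poly_val_cons poly_val_nil addr0 mulrDl.
Qed.

Lemma poly_val_const c : val (pc_const c) = (eis_val tau c)%:MP.
Proof.
by rewrite /pc_const poly_val_cons poly_val_nil addr0 /= !mulr1 alg_mpolyC.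
Qed.

Lemma eis_val1 : eis_val tau e1 = 1. Proof. by rewrite /eis_val mul0r addr0. Qed.

Lemma poly_val_exp P n : val (pc_exp P n) = val P ^+ n.
Proof.
elim: n => [|n IH]; first by rewrite /pc_exp /= poly_val_const eis_val1.
by rewrite /pc_exp /= poly_val_mul -/(pc_exp P n) IH exprS.
Qed.

Lemma poly_val_subst P A B C (T : 3.-tuple {mpoly K[3]}) :
  tnth T (@Ordinal 3 0 isT) = val A -> tnth T (@Ordinal 3 1 isT) = val B ->
  tnth T (@Ordinal 3 2 isT) = val C -> val (pc_subst P A B C) = val P \mPo T.
Proof.
move=> hA hB hC; elim: P => [|u P IH]; first by rewrite /= poly_val_nil comp_mpoly0.
rewrite -[pc_subst _ _ _ _]/(pc_mul (pc_const u.1) (pc_mul (pc_mul (pc_exp A u.2.1.1)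
  (pc_exp B u.2.1.2)) (pc_exp C u.2.2)) ++ pc_subst P A B C).
rewrite poly_val_cat IH poly_val_cons comp_mpolyD comp_mpolyZ; congr (_ + _).
rewrite !poly_val_mul poly_val_const !poly_val_exp mul_mpolyC.
by rewrite !rmorphM !rmorphXn /= !comp_mpolyXU -!tnth_nth hA hB hC.
Qed.

Lemma poly_val_linear (M : mat_code) (i : 'I_3) :
  val (pc_linear (mat_row M i)) = tnth (linear_map (mat_val tau M)) i.
Proof.
rewrite /pc_linear !poly_val_cons poly_val_nil addr0 tnth_mktuple /linear_form.
rewrite (big_indices _ _ (a := @Ordinal 3 0 isT) (b := @Ordinal 3 1 isT)
    (c := @Ordinal 3 2 isT)) //= !mxE.
by rewrite !expr0 !expr1 !mulr1 !mul1r; case: i => [[|[|[|i]]] hi].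
Qed.

Lemma poly_val_pc_map M P : val (pc_map M P) = val P \mPo linear_map (mat_val tau M).
Proof.
by apply: poly_val_subst; rewrite -poly_val_linear.
Qed.

Lemma mcoeff_monomial (e : exponents) (m : 'X_{1..3}) :
  (x ^+ e.1.1 * y ^+ e.1.2 * z ^+ e.2)@_m =
  (e == (m (@Ordinal 3 0 isT), m (@Ordinal 3 1 isT), m (@Ordinal 3 2 isT)))%:R :> K.
Proof.
case: e => [[i j] k] /=; pose n : 'X_{1..3} := [multinom [tuple i; j; k]].
have -> : x ^+ i * y ^+ j * z ^+ k = 'X_[n] by rewrite mpolyX3.
rewrite mcoeffX; congr (nat_of_bool _)%:R; apply/eqP/eqP => [<-|[ei ej ek]].
  by [].
apply/mnmP => -[[|[|[|a]]] ha] //.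
- by rewrite (_ : Ordinal ha = @Ordinal 3 0 isT); [exact: ei|apply: val_inj].
- by rewrite (_ : Ordinal ha = @Ordinal 3 1 isT); [exact: ej|apply: val_inj].
- by rewrite (_ : Ordinal ha = @Ordinal 3 2 isT); [exact: ek|apply: val_inj].
Qed.

Lemma poly_val_coeff P (m : 'X_{1..3}) : (val P)@_m = eis_val tau
  (pc_coeff P (m (@Ordinal 3 0 isT), m (@Ordinal 3 1 isT), m (@Ordinal 3 2 isT))).
Proof.
elim: P => [|u P IH]; first by rewrite poly_val_nil mcoeff0 /eis_val mul0r addr0.
rewrite poly_val_cons mcoeffD mcoeffZ mcoeff_monomial IH /=.
by case: eqP => _; rewrite ?mulr1 ?mulr0 ?add0r // eis_valD.
Qed.

Lemma pc_coeff_notin P e : e \notin map snd P -> pc_coeff P e = e0.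
Proof.
elim: P => [//|u P IH]; rewrite /= inE negb_or => /andP[ue eP].
by rewrite eq_sym (negPf ue) IH.
Qed.

Lemma pc_eqP P Q : pc_eq P Q -> val P = val Q.
Proof.
move=> /allP h; apply/mpolyP => m; rewrite !poly_val_coeff.
set e := (_, _); congr (eis_val _ _); apply/eqP.
have [|] := boolP (e \in map snd (P ++ Q)); first by rewrite -mem_undup => /h.
rewrite map_cat mem_cat negb_or => /andP[eP eQ].
by rewrite !pc_coeff_notin.
Qed.

(** The images of the dropped terms add up to a multiple of the m-th power of [xyz], while each of
    them has some exponent below [m]. The sum is therefore zero. *)
Lemma poly_val_std m P (A : {mpoly K[3]}) :
  val P \mPo standard_map K = xyz K ^+ m * A -> val (pc_std m P) = A.
Proof.
move=> e; pose bad (R : poly_code) := [seq u <- R | tc_std m u == [::]].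
pose img (u : term_code) : term_code :=
  (u.1, (u.2.1.2 + u.2.2, u.2.1.1 + u.2.2, u.2.1.1 + u.2.1.2)%N).
have step u : val [:: u] \mPo standard_map K = val [:: img u].
  rewrite !poly_val_cons poly_val_nil !addr0 comp_mpolyZ; congr (_ *: _).
  rewrite !rmorphM !rmorphXn /= !comp_mpolyXU -!tnth_nth !(tnth_nth 0) /=.
  by rewrite !exprMn !exprD; ring.
have xyz3 : xyz K = x * y * z.
  by rewrite /xyz (big_indices _ _ (a := @Ordinal 3 0 isT) (b := @Ordinal 3 1 isT)
    (c := @Ordinal 3 2 isT)) //= mulrA.
have good_term u : tc_std m u != [::] -> val [:: img u] = xyz K ^+ m * val (tc_std m u).
  rewrite /tc_std; case: ifP => // /and3P[h1 h2 h3] _.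
  rewrite !poly_val_cons poly_val_nil !addr0 -scalerAr; congr (_ *: _) => /=.
  rewrite xyz3 !exprMn; transitivity (x ^+ (m + (u.2.1.2 + u.2.2 - m)) *
    y ^+ (m + (u.2.1.1 + u.2.2 - m)) * z ^+ (m + (u.2.1.1 + u.2.1.2 - m))).
    by rewrite !subnKC.
  by rewrite !exprD; ring.
have split R : val R \mPo standard_map K =
    xyz K ^+ m * val (pc_std m R) + val (map img (bad R)).
  rewrite /bad; elim: R => [|u R IH].
    by rewrite /= poly_val_nil comp_mpoly0 mulr0 addr0.
  rewrite -cat1s poly_val_cat comp_mpolyD IH step /= poly_val_cat mulrDr.
  have [hu|hu] := eqVneq (tc_std m u) [::].
    by rewrite hu poly_val_nil mulr0 add0r !poly_val_cons poly_val_nil addr0 addrCA.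
  by rewrite good_term // addrA.
have bad0 : xyz K ^+ m * (A - val (pc_std m P)) = val (map img (bad P)).
  by rewrite mulrBr -e split addrC addKr.
apply/eqP; rewrite eq_sym -subr_eq0; apply/eqP.
apply: (mulfI (expf_neq0 m (xyz_neq0 K))); rewrite mulr0.
apply/mpolyP => n; rewrite mcoeff0.
have [/existsP[i ni]|] := boolP [exists i, (n i < m)%N].
  exact: mcoeff_xyz_small ni.
rewrite negb_exists => /forallP hn; rewrite bad0 poly_val_coeff pc_coeff_notin.
  by rewrite /eis_val mul0r addr0.
rewrite -map_comp; apply/mapP => -[u]; rewrite mem_filter => /andP[hu _] [n0 n1 n2].
move: hu; rewrite /tc_std; case: ifP => // /negP[]; rewrite -n0 -n1 -n2.
have hm i : (m <= n i)%N by rewrite leqNgt hn.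
by rewrite !hm.
Qed.

End PolyCodes.

(** * The foliations have isolated singularities *)

Section CommonFactors.
Variables (K : numClosedFieldType) (tau : K).
Hypothesis tau_eq : tau ^+ 2 + tau + 1 = 0.
Implicit Types (A B D : {mpoly K[3]}) (i j k : 'I_3) (w : K).

Lemma tau_cube : tau ^+ 3 = 1.
Proof.
apply/eqP; rewrite -subr_eq0 (_ : _ - 1 = (tau - 1) * (tau ^+ 2 + tau + 1)); last by ring.
by rewrite tau_eq mulr0.
Qed.

Lemma cube_roots w : w ^+ 3 = 1 -> w \in [:: 1; tau; tau ^+ 2].
Proof.
move=> w3; have : (w - 1) * (w - tau) * (w - tau ^+ 2) = 0.
  transitivity (w ^+ 3 - 1 - (w ^+ 2 - w * tau) * (tau ^+ 2 + tau + 1)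
     - (tau ^+ 3 - 1)); first by ring.
  by rewrite tau_eq tau_cube w3 !subrr mulr0 !subr0.
by move=> /eqP; rewrite !mulf_eq0 !subr_eq0 !inE -orbA.
Qed.

Definition line i j w : {mpoly K[3]} := 'X_i - w *: 'X_j.

Lemma line_prime i j w : i != j -> prime_polynomial (line i j w).
Proof.
move=> ij; have -> : line i j w = linear_form (fun k => (k == i)%:R - w * (k == j)%:R).
  rewrite /line /linear_form !varE /linear_form scaler_sumr -sumrB.
  by apply: eq_bigr => k _; rewrite scalerBl scalerA.
by apply: (linear_form_prime (j := i)); rewrite eqxx (negPf ij) mulr0 subr0 oner_neq0.
Qed.

Lemma cubes_factor i j : 'X_i ^+ 3 - 'X_j ^+ 3 =
  line i j 1 * (line i j tau * line i j (tau ^+ 2)) :> {mpoly K[3]}.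
Proof.
rewrite /line scale1r -!mul_mpolyC rmorphXn /=.
have e : (tau%:MP ^+ 2 + tau%:MP + 1 : {mpoly K[3]}) = 0.
  by rewrite -rmorphXn -mpolyC1 -!mpolyCD tau_eq.
set T := tau%:MP in e *; set X := 'X_i; set Y := 'X_j.
apply/eqP; rewrite eq_sym -subr_eq0; apply/eqP.
transitivity ((T ^+ 2 + T + 1) * (X * Y ^+ 2 * T - X ^+ 2 * Y - Y ^+ 3 * (T - 1))); first by ring.
by rewrite e mul0r.
Qed.

Lemma strip_cubes i j A B D : i != j ->
  divides D (('X_i ^+ 3 - 'X_j ^+ 3) * A) -> divides D B ->
  (forall w, w ^+ 3 = 1 -> ~ divides (line i j w) B) -> divides D A.
Proof.
move=> ij; rewrite cubes_factor -!mulrA => h hB n.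
have s1 := divides_strip (line_prime 1 ij) h hB (n 1 (expr1n _ _)).
have s2 := divides_strip (line_prime tau ij) s1 hB (n _ tau_cube).
apply: (divides_strip (line_prime (tau ^+ 2) ij) s2 hB); apply: n.
by rewrite -exprM mulnC exprM tau_cube expr1n.
Qed.

Lemma not_divides_line i j w A (p : 'I_3 -> K) :
  p i = w * p j -> A.@[p] != 0 -> ~ divides (line i j w) A.
Proof.
move=> pij Ap [C e]; move: Ap; rewrite e mevalM mevalB mevalZ !mevalXU pij subrr mulr0.
by rewrite eqxx.
Qed.

Lemma not_divides_var i A (p : 'I_3 -> K) : p i = 0 -> A.@[p] != 0 -> ~ divides 'X_i A.
Proof. by move=> pi0 Ap [C e]; move: Ap; rewrite e mevalM mevalXU pi0 mulr0 eqxx. Qed.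

Lemma divides1_unit D : divides D 1 -> D \is a GRing.unit.
Proof. by move=> h; apply: divides_unit h (unitr1 _). Qed.

(** The free coordinate of the test points on the lines below: it avoids the zeros of the other
    cubic factor and of the quadric. *)
Lemma avoid_value (a b : K) : exists c : K, c ^+ 3 - 1 != 0 /\ (a != 0 -> a * c - b != 0).
Proof.
have [c] := not_in_seq [:: 1; tau; tau ^+ 2; b / a].
rewrite !inE !negb_or => /and4P[c1 c2 c3 c4]; exists c; split.
  apply: contraNneq c1 => /eqP; rewrite subr_eq0 => /eqP/cube_roots.
  by rewrite !inE (negPf c2) (negPf c3) !orbF.
by move=> a0; apply: contraNneq c4 => /eqP; rewrite subr_eq0 => /eqP <-; rewrite mulrC mulKf.
Qed.

Local Notation x := (vx K).
Local Notation y := (vy K).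
Local Notation z := (vz K).
Local Notation ix := (@Ordinal 3 0 isT).
Local Notation iy := (@Ordinal 3 1 isT).
Local Notation iz := (@Ordinal 3 2 isT).

Definition pt (a b c : K) (i : 'I_3) : K := nth 0 [:: a; b; c] i.

Lemma mevalx (p : 'I_3 -> K) : [/\ x.@[p] = p ix, y.@[p] = p iy & z.@[p] = p iz].
Proof. by rewrite /vx /vy /vz !mevalXU. Qed.

Lemma lins_neto_coefs (t : K) :
  [/\ tnth (lins_neto (Some t)) ix = (y ^+ 3 - z ^+ 3) * (y * z - t *: x ^+ 2),
      tnth (lins_neto (Some t)) iy = - ((x ^+ 3 - z ^+ 3) * (x * z - t *: y ^+ 2))
    & tnth (lins_neto (Some t)) iz = (x ^+ 3 - y ^+ 3) * (x * y - t *: z ^+ 2)].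
Proof. by split; rewrite tnth_mktuple !(tnth_nth 0) /= -!mul_mpolyC; ring. Qed.

Lemma dividesN D A : divides D (- A) -> divides D A.
Proof. by move=> [C e]; exists (- C); rewrite mulNr -e opprK. Qed.

(** Each coefficient is a product of three lines and a quadric. Test points on the lines show that
    they do not divide the other coefficient in play, so a common factor divides the quadrics, and
    these are coprime. *)
Lemma lins_neto_no_common_factor (t : option K) : no_common_factor (tnth (lins_neto t)).
Proof.
case: t => [t|] D hD; apply: divides1_unit.
  have [e1 e2 e3] := lins_neto_coefs t.
  have := hD ix; have := hD iy; have := hD iz; rewrite e1 e2 e3 => dz /dividesN dy dx.
  have da : divides D (y * z - t *: x ^+ 2).
    apply: (strip_cubes (i := iy) (j := iz) _ dx dy) => // w w3.
    have [c [c1 /(_ (oner_neq0 _)) c2]] := avoid_value 1 (t * w ^+ 2).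
    apply: (not_divides_line (p := pt c w 1)); first by rewrite /pt /= mulr1.
    have [ex ey ez] := mevalx (pt c w 1).
    rewrite !(mevalM, mevalB, rmorphXn, mevalZ) /= ex ey ez /pt /=.
    rewrite (_ : _ * _ = (c ^+ 3 - 1) * (1 * c - t * w ^+ 2)); last by ring.
    exact: mulf_neq0.
  have db : divides D (x * z - t *: y ^+ 2).
    apply: (strip_cubes (i := ix) (j := iz) _ dy dx) => // w w3.
    have [c [c1 /(_ (oner_neq0 _)) c2]] := avoid_value 1 (t * w ^+ 2).
    apply: (not_divides_line (p := pt w c 1)); first by rewrite /pt /= mulr1.
    have [ex ey ez] := mevalx (pt w c 1).
    rewrite !(mevalM, mevalB, rmorphXn, mevalZ) /= ex ey ez /pt /=.
    rewrite (_ : _ * _ = (c ^+ 3 - 1) * (1 * c - t * w ^+ 2)); last by ring.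
    exact: mulf_neq0.
  have [t0|t0] := eqVneq t 0.
    rewrite t0 !scale0r !subr0 in da db.
    have dc : divides D (x * y).
      move: dz; rewrite t0 scale0r subr0 => dz.
      apply: (strip_cubes (i := ix) (j := iy) _ dz da) => // w w3.
      apply: (not_divides_line (p := pt w 1 1)); first by rewrite /pt /= mulr1.
      have [ex ey ez] := mevalx (pt w 1 1).
      by rewrite !mevalM ey ez /pt /= mulr1 oner_neq0.
    have d1 : divides D z.
      apply: (divides_strip (var_prime K iy) da db).
      apply: (not_divides_var (p := pt 1 0 1)) => //.
      by have [ex ey ez] := mevalx (pt 1 0 1); rewrite mevalM ex ez /pt /= mulr1 oner_neq0.
    apply: (divides_strip (var_prime K iz) (A := 1) (B := x * y)) => //; first by rewrite mulr1.
    apply: (not_divides_var (p := pt 1 1 0)) => //.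
    by have [ex ey ez] := mevalx (pt 1 1 0); rewrite mevalM ex ey /pt /= mulr1 oner_neq0.
  apply: (strip_cubes (i := ix) (j := iy) (B := x * z - t *: y ^+ 2)) => // [|w w3].
    (* For nonzero [t] the difference of the cubes of [x] and [y] is a combination of the two
       quadrics, so once more three lines remain to be excluded. *)
    have -> : ('X_ix ^+ 3 - 'X_iy ^+ 3) * 1 = t^-1 *: (y * (x * z - t *: y ^+ 2) - x * (y * z - t *: x ^+ 2)).
      rewrite -/x -/y mulr1 -[LHS]scale1r -(mulVf t0) -scalerA; congr (_ *: _).
      by rewrite -!mul_mpolyC; ring.
    by apply: dividesZ; apply: dividesD; [apply: divides_mull|rewrite -mulNr; apply: divides_mull].
  have w0 : w != 0 by apply: contraTneq (oner_neq0 K) => w0; rewrite -w3 w0 expr0n eqxx.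
  have [c [_ /(_ w0) c2]] := avoid_value w t.
  apply: (not_divides_line (p := pt w 1 c)); first by rewrite /pt /= mulr1.
  have [ex ey ez] := mevalx (pt w 1 c).
  rewrite !(mevalM, mevalB, rmorphXn, mevalZ) /= ex ey ez /pt /=.
  by rewrite (_ : _ - _ = w * c - t) //; ring.
have := hD ix; have := hD iy; rewrite !(tnth_nth 0) /= => dy /dividesN dx.
have d1 : divides D (x * x).
  have dx' : divides D ((y ^+ 3 - z ^+ 3) * (x * x)) by rewrite mulrC -expr2.
  apply: (strip_cubes (i := iy) (j := iz) _ dx' dy) => // w w3.
  have w0 : w != 0 by apply: contraTneq (oner_neq0 K) => w0; rewrite -w3 w0 expr0n eqxx.
  have [c [c1 _]] := avoid_value 0 0.
  apply: (not_divides_line (p := pt c w 1)); first by rewrite /pt /= mulr1.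
  have [ex ey ez] := mevalx (pt c w 1).
  rewrite !(mevalM, mevalB, rmorphXn) /= ex ey ez /pt /=.
  rewrite (_ : _ * _ = w ^+ 2 * (c ^+ 3 - 1)); last by ring.
  by rewrite mulf_neq0 ?expf_neq0.
have d2 : divides D (y * y).
  have dy' : divides D ((x ^+ 3 - z ^+ 3) * (y * y)) by rewrite mulrC -expr2.
  apply: (strip_cubes (i := ix) (j := iz) _ dy' dx) => // w w3.
  have w0 : w != 0 by apply: contraTneq (oner_neq0 K) => w0; rewrite -w3 w0 expr0n eqxx.
  have [c [c1 _]] := avoid_value 0 0.
  apply: (not_divides_line (p := pt w c 1)); first by rewrite /pt /= mulr1.
  have [ex ey ez] := mevalx (pt w c 1).
  rewrite !(mevalM, mevalB, rmorphXn) /= ex ey ez /pt /=.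
  rewrite (_ : _ * _ = w ^+ 2 * (c ^+ 3 - 1)); last by ring.
  by rewrite mulf_neq0 ?expf_neq0.
have nxy : ~ divides x (y * y).
  apply: (not_divides_var (p := pt 0 1 0)) => //.
  by have [ex ey ez] := mevalx (pt 0 1 0); rewrite mevalM ey /pt /= mulr1 oner_neq0.
have d3 := divides_strip (var_prime K ix) d1 d2 nxy.
by apply: (divides_strip (var_prime K ix) _ d2 nxy); rewrite mulr1.
Qed.

End CommonFactors.

(** * The generic element of a pencil *)

Lemma generically_all (K : numClosedFieldType) (C : seq ('rV[K]_3 * nat))
    (S : 'rV[K]_3 * nat -> K -> K -> Prop) :
  (forall u, u \in C -> generically (S u)) ->
  generically (fun c1 c2 => forall u, u \in C -> S u c1 c2).
Proof.
elim: C => [|u s IH] h; first by apply: generically_true.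
have h1 := h u (mem_head _ _); have h2 : generically (fun c1 c2 => forall v, v \in s -> S v c1 c2).
  by apply: IH => v vs; apply: h; rewrite inE vs orbT.
apply: genericallyW (generically_and h1 h2) => c1 c2 [s1 s2] v.
by rewrite inE => /orP[/eqP->|/s2].
Qed.

Section GenericElement.
Variables (K : numClosedFieldType) (P : pencil K) (d : nat) (C : seq ('rV[K]_3 * nat)).
Hypothesis gP : good P d C.

Lemma good_elem_neq0 c1 c2 : (c1, c2) != (0, 0) -> elem P c1 c2 != 0.
Proof. by apply: contra_neq; apply: (good_indep gP). Qed.

Lemma good_irreducible : generically (fun c1 c2 => irreducible (elem P c1 c2)).
Proof.
apply: genericallyW (generically_and (good_genus gP) (generically_nonzero K)) => c1 c2.
move=> [[L [iota [xi [ff _]]]] c0].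
exact: (function_field_irreducible (good_elem_neq0 c0) (elem_homog c1 c2 (good_homog gP)) ff).
Qed.

Lemma good_elliptic : elliptic P.
Proof. exact: generically_and good_irreducible (good_genus gP). Qed.

Lemma good_degree : generic_degree P d.
Proof.
apply: generically_true => c1 c2 c0; split; first exact: good_elem_neq0.
exact: elem_homog (good_homog gP).
Qed.

Lemma elem_linear a b c e k l : elem P (k * a + l * c) (k * b + l * e) =
  k *: elem P a b + l *: elem P c e.
Proof. by rewrite /elem -!mul_mpolyC !mpolyCD !mpolyCM; ring. Qed.

(** A common factor divides two distinct irreducible elements. Were it not a unit, both would be
    constant multiples of it and hence proportional. *)
Lemma good_no_common_factor : no_common_factor (gen P).
Proof.
have [k1 _ [_ _ irr1]] := generically_exists [::] good_irreducible.
have [k2 k21 [_ _ irr2]] := generically_exists [:: k1] good_irreducible.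
move=> A hA; have A1 := hA true; have A2 := hA false.
have dA c1 c2 : divides A (elem P c1 c2) by apply: dividesD; apply: dividesZ.
have [D1 e1] := dA 1 k1; have [D2 e2] := dA 1 k2.
case: (irr1 _ _ e1) => [u1|//]; case: (irr2 _ _ e2) => [u2|//].
have unitE (D : {mpoly K[3]}) : D \is a GRing.unit -> exists2 a : K, a != 0 & D = a%:MP.
  by move=> u; have [/eqP DE u0] := andP u; exists D@_0; rewrite -?unitfE.
have [a a0 Da] := unitE _ u1; have [b b0 Db] := unitE _ u2.
have e : elem P (b * 1 + - a * 1) (b * k1 + - a * k2) = 0.
  by rewrite elem_linear e1 e2 Da Db -!mul_mpolyC mpolyCN; ring.
have := good_indep gP e => -[] /eqP; rewrite !mulr1 subr_eq0 => /eqP -> /eqP.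
rewrite mulNr -mulrBr mulf_eq0 (negPf a0) subr_eq0 => /eqP k12.
by rewrite k12 inE eqxx in k21.
Qed.

(** Elements of larger order at a point form a subspace. If it contained both generators, the
    leading forms would vanish in every direction, against the tangent clause applied to a direction
    that is not radial. *)
Lemma good_exact_order : generically (fun c1 c2 => forall u, u \in C ->
  ~ order_ge u.2.+1 (u.1 0) (elem P c1 c2)).
Proof.
apply: generically_all => u uC; apply: generically_subspace => [a b c e k l h1 h2|[]].
  by rewrite elem_linear; apply: order_geD; apply: order_geZ.
rewrite /elem scale1r scale0r addr0 scale0r scale1r add0r => h1 h2.
have [i ui] : exists i, u.1 0 i != 0.
  apply: contrapT => h; have /eqP := good_neq0 gP uC; apply; apply/rowP => i.
  by rewrite mxE; apply: contrapT => /eqP ui; apply: h; exists i.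
have [j ij] : exists j, i != j by exists (lift i ord0); rewrite neq_lift.
have [c ec] := good_tangent gP uC (leading_order (fun k => (k == j)%:R) h1)
  (leading_order (fun k => (k == j)%:R) h2).
have := ec i; have := ec j; rewrite eqxx (negPf ij) => ecj /esym/eqP.
rewrite mulf_eq0 (negPf ui) orbF => /eqP c0; move/eqP: ecj.
by rewrite c0 mul0r oner_eq0.
Qed.

Lemma good_multiplicities : for_generic_element P (fun H =>
  forall (p : 'rV[K]_3) (r : nat), p != 0 -> (1 < r)%N ->
    (multiplicity H p r <-> exists q, (q, r) \in C /\ same_point p q)).
Proof.
apply: genericallyW (generically_and good_exact_order (good_smooth gP)) => c1 c2 [ex sm] p r p0 r1.
have hE : elem P c1 c2 \is d.-homog := elem_homog c1 c2 (good_homog gP).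
have ord u : u \in C -> order_ge u.2 (u.1 0) (elem P c1 c2).
  by move=> uC; have [o1 o2] := good_order gP uC; apply: order_geD; apply: order_geZ.
rewrite multiplicityP; split=> [[o no]|[q [qC pq]]]; last first.
  split; first exact: order_ge_same_point hE pq (ord _ qC).
  by move=> o; apply: (ex _ qC); apply: order_ge_same_point hE (same_point_sym pq) o.
have [u uC pu] := sm p p0 (order_ge_le r1 o).
suff ur : u.2 = r by exists u.1; rewrite -ur -surjective_pairing.
have o' := order_ge_same_point hE (same_point_sym pu) o.
apply/eqP; rewrite eqn_leq; apply/andP; split; rewrite leqNgt; apply/negP => h.
  by apply: no; apply: order_ge_same_point hE pu _; apply: order_ge_le h (ord _ uC).
by apply: (ex _ uC); apply: order_ge_le h o'.
Qed.

End GenericElement.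

(** * The quadratic maps acting on pencils and forms *)

Definition pc_deriv (k : nat) (P : poly_code) : poly_code :=
  map (fun u : term_code => let: (c, (a, b, e)) := u in
    if k is 0 then (emul (Posz a, 0) c, (a.-1, b, e))
    else if k is 1 then (emul (Posz b, 0) c, (a, b.-1, e))
    else (emul (Posz e, 0) c, (a, b, e.-1))) P.

Definition cremona_code (i : cremona_index) (j : nat) : poly_code :=
  let s := idx_s i in let n := eopp e1 in
  if i is IdxInf then
    match j with
    | 0 => [:: (e1, (0, 1, 1)%N)]
    | 1 => [:: (e1, (1, 0, 1)%N)]
    | _ => [:: (e1, (1, 1, 0)%N)]
    end
  else
    match j with
    | 0 => [:: (s, (0, 2, 0)%N); (n, (1, 0, 1)%N)]
    | 1 => [:: (s, (2, 0, 0)%N); (n, (0, 1, 1)%N)]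
    | _ => [:: (e1, (0, 0, 2)%N); (eopp (emul s s), (1, 1, 0)%N)]
    end.

Definition omega_code (j : nat) : poly_code :=
  let n := eopp e1 in
  match j with
  | 0 => [:: (e1, (0, 4, 1)%N); (n, (0, 1, 4)%N)]
  | 1 => [:: (n, (4, 0, 1)%N); (e1, (1, 0, 4)%N)]
  | _ => [:: (e1, (4, 1, 0)%N); (n, (1, 4, 0)%N)]
  end.

Definition xi_code (j : nat) : poly_code :=
  let n := eopp e1 in
  match j with
  | 0 => [:: (n, (2, 3, 0)%N); (e1, (2, 0, 3)%N)]
  | 1 => [:: (e1, (3, 2, 0)%N); (n, (0, 2, 3)%N)]
  | _ => [:: (n, (3, 0, 2)%N); (e1, (0, 3, 2)%N)]
  end.

Definition pullback_code (i : cremona_index) (w : nat -> poly_code) (k : nat) : poly_code :=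
  let q := cremona_code i in
  let term j := pc_mul (pc_subst (w j) (q 0) (q 1) (q 2)) (pc_deriv k (q j)) in
  term 0 ++ term 1 ++ term 2.

(* The curve contracted by the map of index i. *)
Definition jacobian_code (i : cremona_index) : poly_code :=
  if i is IdxInf then [:: (e1, (1, 1, 1)%N)] else
  [:: (e1, (3, 0, 0)%N); (e1, (0, 3, 0)%N); (e1, (0, 0, 3)%N);
      (emul (- 3, 0) (emul (idx_s i) (idx_s i)), (1, 1, 1)%N)].

Definition pc_scale (c : eisenstein) (P : poly_code) : poly_code := pc_mul (pc_const c) P.

Definition cremona_scale (i : cremona_index) : eisenstein := if i is IdxInf then e1 else e3.

Lemma cremona_decomposition (i : cremona_index) (j : nat) : (j < 3)%N ->
  pc_eq (pc_map (source_mat i) (pc_std 0 (pc_linear (mat_row (target_mat i) j))))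
        (pc_scale (cremona_scale i) (cremona_code i j)).
Proof. by case: j => [|[|[|j]]] // _; case: i; vm_compute. Qed.

Lemma pullback_omega (i : cremona_index) (k : nat) : i != IdxInf -> (k < 3)%N ->
  pc_eq (pullback_code i omega_code k)
    (pc_mul (pc_exp (jacobian_code i) 2)
      (omega_code k ++ pc_scale (eopp (idx_s i)) (xi_code k))).
Proof.
case: i => [_|_|_|/eqP h]; last (by case: h);
  by case: k => [|[|[|k]]] k3; last discriminate k3; vm_compute.
Qed.

Lemma pullback_xi (i : cremona_index) (k : nat) : (k < 3)%N ->
  pc_eq (pullback_code i xi_code k)
    (pc_scale (eopp e1) (pc_mul (pc_exp (jacobian_code i) 2)
      (if i is IdxInf then omega_code k else xi_code k))).
Proof.
by case: k => [|[|[|k]]] k3; last discriminate k3; case: i; vm_compute.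
Qed.

Section CremonaSteps.
Variables (K : numClosedFieldType) (tau : K).
Hypothesis tau_eq : tau ^+ 2 + tau + 1 = 0.
Local Notation x := (vx K).
Local Notation y := (vy K).
Local Notation z := (vz K).
Local Notation val := (poly_val tau).

Lemma poly_val_deriv (i : 'I_3) P : val (pc_deriv i P) = mderiv i (val P).
Proof.
elim: P => [|[c [[a b] e]] P IH]; first by rewrite /= poly_val_nil mderiv0.
rewrite (_ : pc_deriv i (_ :: P) = pc_deriv i [:: (c, (a, b, e))] ++ pc_deriv i P) //.
rewrite poly_val_cat IH poly_val_cons mderivD; congr (_ + _).
have X3 (u v w : nat) : x ^+ u * y ^+ v * z ^+ w = 'X_[[multinom [tuple u; v; w]]].
  by rewrite mpolyX3.
have eis_nat (n : nat) : eis_val tau (emul (Posz n, 0) c) = n%:R * eis_val tau c.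
  by rewrite (eis_valM tau_eq) /eis_val /= mul0r addr0.
have expE (u v w : nat) (j : 'I_3) : [multinom [tuple u; v; w]] j = nth 0%N [:: u; v; w] j.
  by rewrite multinomE (tnth_nth 0%N).
rewrite X3 mderivZ mderivX scalerA /=.
by move: i {IH} => -[[|[|[|i]]] hi] //; rewrite poly_val_cons poly_val_nil addr0 /= eis_nat X3
  expE /= mulrC; congr (_ *: 'X_[_]); apply/mnmP => j;
  rewrite mnmBE mnm1E !expE; case: j => [[|[|[|j]]] hj] //=; rewrite ?subn0 ?subn1.
Qed.

Lemma idx_s_val (i : cremona_index) : eis_val tau (idx_s i) =
  match i with IdxTau => tau | IdxTau2 => tau ^+ 2 | _ => 1 end.
Proof.
case: i; rewrite /eis_val /= ?mul0r ?addr0 ?mul1r ?add0r //.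
by apply: (addIr (tau + 1)); rewrite [in RHS]addrA tau_eq; ring.
Qed.

Lemma cremona_codeE i (j : 'I_3) : val (cremona_code i j) = tnth (cremona tau i) j.
Proof.
have tau4 : (tau ^+ 2) ^+ 2 = tau.
  by rewrite -exprM (exprD tau 3 1) (tau_cube tau_eq) mul1r.
have et_val : eis_val tau et = tau := idx_s_val IdxTau.
have et2_val : eis_val tau et2 = tau ^+ 2 := idx_s_val IdxTau2.
case: j => [[|[|[|j]]] hj] //; rewrite (tnth_nth 0);
  case: i; rewrite /cremona_code !poly_val_cons poly_val_nil !addr0; simpl fst; simpl snd;
  rewrite ?eis_valN ?(eis_valM tau_eq) ?eis_val1 /= ?et_val ?et2_val
     ?expr0 ?expr1 ?mul1r ?mulr1 ?scaleNr ?scale1r -?expr2 ?tau4 //.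
Qed.


Lemma cremona_composite (i : cremona_index) (j : 'I_3) :
  (tnth (target_map tau i) j \mPo standard_map K) \mPo source_map tau i =
    eis_val tau (cremona_scale i) *: tnth (cremona tau i) j.
Proof.
have := pc_eqP tau (cremona_decomposition i (ltn_ord j)).
rewrite poly_val_pc_map // poly_val_mul // poly_val_const cremona_codeE mul_mpolyC => <-.
rewrite -(poly_val_linear tau); congr (_ \mPo _); apply/esym.
by apply: poly_val_std; rewrite expr0 mul1r.
Qed.

Lemma comp_cremona d (i : cremona_index) (A : {mpoly K[3]}) : A \is d.-homog ->
  ((A \mPo target_map tau i) \mPo standard_map K) \mPo source_map tau i =
    eis_val tau (cremona_scale i) ^+ d *: (A \mPo cremona tau i).
Proof.
move=> hA; rewrite {1}/comp_mpoly 2!mmap_comp.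
rewrite (@mmap_eq _ _ _ _ _ (fun j => (eis_val tau (cremona_scale i))%:MP * tnth (cremona tau i) j)).
  by rewrite (mmap_scale _ _ _ hA) -rmorphXn mul_mpolyC.
by move=> j; rewrite mul_mpolyC -cremona_composite -mmap_comp.
Qed.

Lemma cremona_scale_neq0 (i : cremona_index) : eis_val tau (cremona_scale i) != 0.
Proof. by rewrite (eis_val_eq0 tau_eq); case: i. Qed.

(** The curve of [jacobian_code] given as a product of three linear forms, which exhibits its prime
    factors. *)
Definition contracted (i : cremona_index) : {mpoly K[3]} := xyz K \mPo source_map tau i.

Lemma contractedE (i : cremona_index) :
  contracted i = \prod_(l <- [seq tnth (source_map tau i) j | j : 'I_3]) l.
Proof.
rewrite /contracted /xyz rmorph_prod /= big_image /=; apply: eq_bigr => j _.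
by rewrite comp_mpolyXU -tnth_nth.
Qed.

Lemma source_row_prime (i : cremona_index) (j : 'I_3) :
  prime_polynomial (tnth (source_map tau i) j).
Proof.
rewrite tnth_mktuple.
have [k hk] : exists k, mat_val tau (source_mat i) j k != 0.
  apply: contrapT => h; have := source_mul tau_eq i.
  move=> /matrixP/(_ j j); rewrite !mxE eqxx mulr1n big1 => [/esym/eqP|k _].
    by rewrite pnatr_eq0.
  have -> : mat_val tau (source_mat i) j k = 0; last by rewrite mul0r.
  by apply: contrapT => /eqP hk; apply: h; exists k.
exact: linear_form_prime hk.
Qed.

Lemma contracted_neq0 (i : cremona_index) : contracted i != 0.
Proof.
rewrite contractedE big_image /=; apply/prodf_neq0 => j _.
by case: (source_row_prime i j).
Qed.

Definition next_param (i : cremona_index) (t : option K) : option K :=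
  if t is Some u then Some (- u - eis_val tau (idx_s i)) else Some 0.

(* The map of index infinity is only applied to the foliation F_infinity. *)
Definition admissible (i : cremona_index) (t : option K) : bool :=
  (i == IdxInf) == (t == None).

Lemma poly_val_scale c P : val (pc_scale c P) = eis_val tau c *: val P.
Proof. by rewrite poly_val_mul // poly_val_const mul_mpolyC. Qed.

Lemma omega_codeE (j : 'I_3) : val (omega_code j) = tnth (Omega K) j.
Proof.
by case: j => [[|[|[|j]]] hj] //; rewrite (tnth_nth 0) /omega_code !poly_val_cons poly_val_nil
  !addr0 eis_valN eis_val1 /= ?expr0 ?expr1 ?mul1r ?mulr1 scaleNr !scale1r; ring.
Qed.

Lemma xi_codeE (j : 'I_3) : val (xi_code j) = tnth (Xi K) j.
Proof.
by case: j => [[|[|[|j]]] hj] //; rewrite (tnth_nth 0) /xi_code !poly_val_cons poly_val_nil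
  !addr0 eis_valN eis_val1 /= ?expr0 ?expr1 ?mul1r ?mulr1 scaleNr !scale1r; ring.
Qed.

Lemma pullback_codeE (i : cremona_index) (W : nat -> poly_code) (w : one_form K) (k : 'I_3) :
  (forall j : 'I_3, val (W j) = tnth w j) ->
  val (pullback_code i W k) = pullback_form (cremona tau i) w k.
Proof.
move=> hW; rewrite /pullback_form (big_indices _ _ (a := @Ordinal 3 0 isT) (b := @Ordinal 3 1 isT)
  (c := @Ordinal 3 2 isT)) //.
have term (j : 'I_3) : val (pc_mul (pc_subst (W j) (cremona_code i 0) (cremona_code i 1)
    (cremona_code i 2)) (pc_deriv k (cremona_code i j))) =
    (tnth w j \mPo cremona tau i) * mderiv k (tnth (cremona tau i) j).
  by rewrite poly_val_mul // poly_val_deriv cremona_codeE -hW; congr (_ * _);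
    apply: poly_val_subst => //; rewrite -cremona_codeE.
by rewrite !poly_val_cat -!term.
Qed.

Lemma pullback_lins_neto (i : cremona_index) (t : option K) : admissible i t ->
  exists2 H : {mpoly K[3]}, H != 0 & forall k,
    pullback_form (cremona tau i) (lins_neto t) k = H * tnth (lins_neto (next_param i t)) k.
Proof.
have J0 : val (jacobian_code i) ^+ 2 != 0.
  apply: expf_neq0; apply/eqP => J0.
  (* The polynomial is nonzero because this monomial has coefficient 1. *)
  have : (val (jacobian_code i))@_[multinom (if i is IdxInf then [tuple 1; 1; 1]%N else [tuple 3; 0; 0]%N)] = 0.
    by rewrite J0 mcoeff0.
  rewrite poly_val_coeff // !multinomE !(tnth_nth 0%N).
  by move/eqP; rewrite (eis_val_eq0 tau_eq); case: (i).
have scaled (w : one_form K) u k : pullback_form (cremona tau i)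
    [tuple tnth (Omega K) j + u *: tnth w j | j < 3] k =
    pullback_form (cremona tau i) (Omega K) k + u *: pullback_form (cremona tau i) w k.
  rewrite /pullback_form scaler_sumr -big_split /=; apply: eq_bigr => j _.
  by rewrite tnth_mktuple comp_mpolyD comp_mpolyZ mulrDl scalerAl.
case: t => [t|]; rewrite /admissible /= => /eqP hi.
  have iInf : i != IdxInf by rewrite hi.
  exists (val (jacobian_code i) ^+ 2) => // k; rewrite scaled.
  rewrite -(pullback_codeE _ _ omega_codeE) -(pullback_codeE _ _ xi_codeE).
  rewrite (pc_eqP tau (pullback_omega iInf (ltn_ord k))) (pc_eqP tau (pullback_xi i (ltn_ord k))).
  move: (pc_exp _ 2) (poly_val_exp tau_eq (jacobian_code i) 2) => J2 eJ.
  rewrite poly_val_scale !(poly_val_mul tau_eq J2) poly_val_cat poly_val_scale eJ.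
  have -> (F : poly_code) : val (if i is IdxInf then F else xi_code k) = val (xi_code k).
    by case: (i) iInf.
  rewrite omega_codeE xi_codeE tnth_mktuple !eis_valN eis_val1.
  by rewrite -!mul_mpolyC !mpolyCD !mpolyCN mpolyC1; ring.
move: hi; rewrite eqxx => /eqP hi; exists (- val (jacobian_code i) ^+ 2); first by rewrite oppr_eq0.
move=> k; rewrite -(pullback_codeE _ _ xi_codeE) (pc_eqP tau (pullback_xi i (ltn_ord k))).
move: (pc_exp _ 2) (poly_val_exp tau_eq (jacobian_code i) 2) => J2 eJ.
rewrite poly_val_scale (poly_val_mul tau_eq J2) eJ eis_valN eis_val1 scaleN1r mulNr hi.
by rewrite omega_codeE tnth_mktuple scale0r addr0.
Qed.

Definition is_wronskian (w : one_form K) (P : pencil K) := exists h : {mpoly K[3]},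
  forall i : 'I_3, P.1 * mderiv i P.2 - P.2 * mderiv i P.1 = h * tnth w i.

Lemma wronskian_comp (w : one_form K) (P : pencil K) (Q : 3.-tuple {mpoly K[3]}) :
  is_wronskian w P -> exists h : {mpoly K[3]}, forall i,
    (P.1 \mPo Q) * mderiv i (P.2 \mPo Q) - (P.2 \mPo Q) * mderiv i (P.1 \mPo Q) =
      h * pullback_form Q w i.
Proof.
case=> h eh; exists (h \mPo Q) => i; rewrite !mderiv_comp !mulr_sumr -sumrB.
apply: eq_bigr => j _; have e : (P.1 \mPo Q) * (mderiv j P.2 \mPo Q) - (P.2 \mPo Q) * (mderiv j P.1 \mPo Q) =
    (h \mPo Q) * (tnth w j \mPo Q) by rewrite -!rmorphM -rmorphB /= eh.
by rewrite !mulrA -mulrBl e.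
Qed.

Lemma wronskian_scale (F G g : {mpoly K[3]}) i :
  (g * F) * mderiv i (g * G) - (g * G) * mderiv i (g * F) =
    g ^+ 2 * (F * mderiv i G - G * mderiv i F).
Proof. by rewrite !mderivM; ring. Qed.

(** Removing a common factor from the generators divides the Wronskian by the square of that factor,
    here a product of contracted lines up to a constant. No line divides all coefficients of [w'],
    so the lines divide the cofactor and the quotient is a polynomial. *)
Lemma wronskian_step (i : cremona_index) (w w' : one_form K) (P P' : pencil K) (c : K) m :
  c != 0 -> no_common_factor (tnth w') ->
  (exists H, forall k, pullback_form (cremona tau i) w k = H * tnth w' k) ->
  P.1 \mPo cremona tau i = (c *: contracted i ^+ m) * P'.1 ->
  P.2 \mPo cremona tau i = (c *: contracted i ^+ m) * P'.2 ->
  is_wronskian w P -> is_wronskian w' P'.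
Proof.
move=> c0 ncf [H eH] e1 e2 /(wronskian_comp (cremona tau i))[h eh].
pose ls := flatten (nseq (m * 2) [seq tnth (source_map tau i) j | j : 'I_3]).
have ls_prod : \prod_(l <- ls) l = contracted i ^+ (m * 2).
  rewrite contractedE /ls; elim: (m * 2)%N => [|n IH]; first by rewrite big_nil expr0.
  by rewrite /= big_cat IH exprS.
apply: (@form_quotient _ _ ls ((c ^+ 2)^-1 *: (h * H))).
  move=> l /flattenP[s /nseqP[-> _] /mapP[j _ ->]]; split; first exact: source_row_prime.
  apply: contrapT => hl; have [_ /negP nu _] := source_row_prime i j; apply: nu.
  apply: ncf => k; apply: contrapT => nk; apply: hl; by exists k.
move=> k; have := eh k; rewrite e1 e2 wronskian_scale eH ls_prod exprZn -exprM => e.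
rewrite -scalerAl -mulrA -e -scalerAl scalerA mulVf ?scale1r //.
by rewrite expf_neq0.
Qed.

Record pencil_state (t : option K) (P : pencil K) (d : nat) (mu : cremona_index -> nat) : Prop :=
  PencilState {
    state_good : good P d (config tau mu);
    state_wronskian : is_wronskian (lins_neto t) P }.

Lemma state_step (i : cremona_index) (t : option K) (F G : poly_code) d mu :
  let P := (val F, val G) in
  let P' := (val (pc_step i (mu i) F), val (pc_step i (mu i) G)) in
  admissible i t -> pencil_state t P d mu ->
  [/\ strict_transform_form (cremona tau i) (lins_neto t) (lins_neto (next_param i t)),
      strict_transform_pencil (cremona tau i) P P'
    & pencil_state (next_param i t) P' (2 * d - 3 * mu i)%N (next_mult i d mu)].
Proof.
move=> P P' hi [gP wP]; have [H H0 eH] := pullback_lins_neto hi.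
have ncf := @lins_neto_no_common_factor _ _ tau_eq (next_param i t).
have [A [_ e1 e2 gA]] := good_step tau_eq i gP.
have valA B R : (val B \mPo target_map tau i) \mPo standard_map K = xyz K ^+ mu i * R ->
    val (pc_step i (mu i) B) = R \mPo source_map tau i.
  move=> e; rewrite /pc_step poly_val_pc_map // (@poly_val_std _ _ _ _ R) //.
  by rewrite poly_val_pc_map.
have [h1 h2] := good_homog gP.
pose k := eis_val tau (cremona_scale i) ^+ d.
have k0 : k != 0 by rewrite expf_neq0 ?cremona_scale_neq0.
have eQ B R : val B \is d.-homog ->
    (val B \mPo target_map tau i) \mPo standard_map K = xyz K ^+ mu i * R ->
    val B \mPo cremona tau i = (k^-1 *: contracted i ^+ mu i) * val (pc_step i (mu i) B).
  move=> hB e; rewrite (valA _ _ e) -scalerAl /contracted -rmorphXn -rmorphM /= -e.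
  by rewrite (comp_cremona _ hB) scalerA mulVf ?scale1r.
have eF := eQ _ _ h1 e1; have eG := eQ _ _ h2 e2.
have gP' : good P' (2 * d - 3 * mu i) (config tau (next_mult i d mu)).
  by rewrite /P' (valA _ _ e1) (valA _ _ e2).
split.
- by split=> //; exists H.
- split; first exact: good_no_common_factor gP'.
  exists (k^-1 *: contracted i ^+ mu i) => [|[]//].
  by rewrite scaler_eq0 invr_eq0 (negPf k0) expf_neq0 ?contracted_neq0.
- split=> //; apply: (@wronskian_step i (lins_neto t) _ P P' k^-1 (mu i) _ ncf _ eF eG wP).
    by rewrite invr_eq0.
  by exists H.
Qed.

End CremonaSteps.

(** * The two pencils of cubics *)

Section Diagonal.
Variable K : numClosedFieldType.
Local Notation x := (vx K).
Local Notation y := (vy K).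
Local Notation z := (vz K).

Definition mat3 (r : seq (seq K)) : 'M[K]_3 := \matrix_(i, j) nth 0 (nth [::] r i) j.

Lemma linear_map_mat3 r (i : 'I_3) : tnth (linear_map (mat3 r)) i =
  let s := nth [::] r i in nth 0 s 0 *: x + (nth 0 s 1 *: y + nth 0 s 2 *: z).
Proof.
rewrite tnth_mktuple /linear_form (big_indices _ _ (a := @Ordinal 3 0 isT)
  (b := @Ordinal 3 1 isT) (c := @Ordinal 3 2 isT)) //.
by rewrite !mxE.
Qed.

Definition diagonal_cubic (a b c : K) := a *: x ^+ 3 + b *: y ^+ 3 + c *: z ^+ 3.

(* With a = u^3, b = v^3, c = w^3, S = u x + v y, D = u x - v y one has
   4 (a x^3 + b y^3) = S^3 + 3 S D^2. *)
Lemma diagonal_cubic_genus (a b c : K) : a != 0 -> b != 0 -> c != 0 ->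
  geometric_genus (diagonal_cubic a b c) 1.
Proof.
move=> a0 b0 c0.
have [u eu] : exists u : K, u ^+ 3 = a by exists (3.-root a); rewrite rootCK.
have [v ev] : exists v : K, v ^+ 3 = b by exists (3.-root b); rewrite rootCK.
have [w ew] : exists w : K, w ^+ 3 = 4%:R * c by exists (3.-root (4%:R * c)); rewrite rootCK.
have [s es] : exists s : K, s ^+ 2 = 3%:R by exists (sqrtC 3%:R); rewrite sqrtCK.
have n0 n : n.+1%:R != 0 :> K by rewrite pnatr_eq0.
have u0 : u != 0 by apply: contraNneq a0 => u0; rewrite -eu u0 expr0n.
have v0 : v != 0 by apply: contraNneq b0 => v0; rewrite -ev v0 expr0n.
have w0 : w != 0.
  by apply: contraNneq (mulf_neq0 (n0 3%N) c0) => w0; rewrite -ew w0 expr0n.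
have s0 : s != 0 by apply: contraNneq (n0 2%N) => s0; rewrite -es s0 expr0n.
(* The substitution is [(x, y, z) := (- w z, s D, S)]: it turns [y^2 z - x^3 + z^3] into
   [3 S D^2 + w^3 z^3 + S^3], with [w^3 = 4 c]. *)
pose A := mat3 [:: [:: 0; 0; - w]; [:: s * u; - (s * v); 0]; [:: u; v; 0]].
pose B := mat3 [:: [:: 0; (2%:R * s * u)^-1; (2%:R * u)^-1];
  [:: 0; - (2%:R * s * v)^-1; (2%:R * v)^-1]; [:: - w^-1; 0; 0]].
have AB : A *m B = 1%:M.
  apply/matrixP => i j; rewrite !mxE sum3 !mxE.
  case: i => [[|[|[|i]]] hi] //; case: j => [[|[|[|j]]] hj] //=;
  rewrite ?mulr0n ?mulr1n ?mul0r ?mulr0 ?addr0 ?add0r ?mulrNN ?divff //;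
  by have := n0 1%N => two0; field; rewrite ?u0 ?v0 ?s0.
have bp := linear_birational AB (oner_neq0 K).
have e4 : weierstrass K \mPo linear_map A = 4%:R%:MP * diagonal_cubic a b c.
  rewrite /weierstrass rmorphB rmorphM rmorphB !rmorphXn /= !comp_mpolyXU -!tnth_nth.
  rewrite !linear_map_mat3 /diagonal_cubic /= -eu -ev.
  have -> : c = 4%:R^-1 * w ^+ 3 by rewrite ew mulKf.
  rewrite -!mul_mpolyC (mpolyCM _ 4%:R^-1) !rmorphXn /= !mpolyCN !mpolyCM mpolyC0.
  have eS : (s%:MP ^+ 2 : {mpoly K[3]}) = 3%:R by rewrite -rmorphXn /= es rmorph_nat.
  have e1 : (4%:R%:MP * (4%:R^-1)%:MP : {mpoly K[3]}) = 1 by rewrite -mpolyCM divff.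
  set S := s%:MP in eS *; set U := u%:MP; set V := v%:MP; set W := w%:MP.
  set i4 := (4%:R^-1)%:MP in e1 *.
  transitivity (S ^+ 2 * (U * x - V * y) ^+ 2 * (U * x + V * y) + W ^+ 3 * z ^+ 3
    + (U * x + V * y) ^+ 3); first by ring.
  transitivity (4%:R%:MP * (U ^+ 3 * x ^+ 3 + V ^+ 3 * y ^+ 3) + (4%:R%:MP * i4) * (W ^+ 3 * z ^+ 3)).
    by rewrite e1 eS mpolyC_nat; ring.
  by ring.
pose xi' i := mmap (@cf_const K) (@cf_point K) (tnth (linear_map B) i).
exists (cubic_field K), (@cf_const K), xi'; split; last exact: cubic_field_genus.
apply: (function_field_transport (weierstrass_function_field K) (weierstrass_homog K)
  _ (bp_homog bp) (bp_homog' bp) (bp_right bp) (bp_left bp) e4) => //.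
- by rewrite mmapC fmorph_eq0 oner_eq0.
- by rewrite mmapC fmorph_eq0.
- by move=> D k; rewrite expr1n mul1r.
Qed.

End Diagonal.

(** Each pencil of cubics has nine simple base points, three in every class other than its own. *)
Definition start_mult (s : start) (i : cremona_index) : nat :=
  match s, i with Start1, Idx1 | StartInf, IdxInf => 0 | _, _ => 1 end.

Arguments start_mult : simpl never.

Lemma points_classes : all (fun u : point_code * cremona_index =>
  if u.2 == IdxInf then has (fun k => u.1 == vertex_code k) (iota 0 3)
  else all (fun k => emul (coord u.1 k) (emul (coord u.1 k) (coord u.1 k)) == e1) (iota 0 3))
  points.
Proof. by vm_compute. Qed.

Lemma points_cube_roots : all (fun a => all (fun b =>
  has (fun u : point_code * cremona_index => u.1 == (e1, a, b)) points)
    [:: e1; et; et2]) [:: e1; et; et2].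
Proof. by vm_compute. Qed.

Section Cubics.
Variables (K : numClosedFieldType) (tau : K).
Hypothesis tau_eq : tau ^+ 2 + tau + 1 = 0.
Local Notation x := (vx K).
Local Notation y := (vy K).
Local Notation z := (vz K).
Local Notation ix := (@Ordinal 3 0 isT).
Local Notation iy := (@Ordinal 3 1 isT).
Local Notation iz := (@Ordinal 3 2 isT).

Lemma diagonal_eval (a b c : K) (p : 'I_3 -> K) :
  (diagonal_cubic a b c).@[p] = a * p ix ^+ 3 + b * p iy ^+ 3 + c * p iz ^+ 3.
Proof.
have [ex ey ez] := mevalx p.
by rewrite /diagonal_cubic !(mevalD, mevalZ, rmorphXn) /= ex ey ez.
Qed.

Lemma diagonal_deriv (a b c : K) (p : 'I_3 -> K) (i : 'I_3) :
  (mderiv i (diagonal_cubic a b c)).@[p] = 3%:R * (pt a b c i * p i ^+ 2).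
Proof.
have d (j : 'I_3) : mderiv i ('X_j ^+ 3 : {mpoly K[3]}) = (i == j)%:R * ('X_j ^+ 2 *+ 3).
  by rewrite !exprS expr0 mulr1 !mderivM mderiv_var; move: (_%:R) => D; ring.
have d' j : (mderiv i ('X_j ^+ 3 : {mpoly K[3]})).@[p] = (i == j)%:R * (3%:R * p j ^+ 2).
  by rewrite d mevalM (rmorph_nat (meval _)) expr2 mevalMn mevalM mevalXU [3%:R * _]mulr_natl expr2.
rewrite /diagonal_cubic /vx /vy /vz !mderivD !mderivZ !mevalD !mevalZ !d' {d d'}.
have /or3P[] : [|| i == ix, i == iy | i == iz] by case: i => [[|[|[|i]]] hi].
- by move/eqP->; rewrite /pt /= !mul0r !mulr0 !addr0 mul1r mulrCA.
- by move/eqP->; rewrite /pt /= !mul0r !mulr0 !addr0 add0r mul1r mulrCA.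
- by move/eqP->; rewrite /pt /= !mul0r !mulr0 !add0r mul1r mulrCA.
Qed.

Lemma diagonal_homog (a b c : K) : diagonal_cubic a b c \is 3.-homog.
Proof. by rewrite !rpredD // rpredZ // var_exp_homog. Qed.

Lemma point_cube p j (i : 'I_3) : (p, j) \in points -> j != IdxInf ->
  point_val tau p 0 i ^+ 3 = 1.
Proof.
move=> pj jInf; have := allP points_classes _ pj; simpl fst; simpl snd.
rewrite (negPf jInf) => /allP/(_ i); rewrite mem_iota ltn_ord => /(_ isT)/eqP e.
have := eis_val1 tau; rewrite -e !(eis_valM tau_eq) point_valE => <-.
by rewrite !exprS expr0 mulr1.
Qed.

Lemma point_vertex p : (p, IdxInf) \in points -> exists k, point_val tau p = vertex K k.
Proof.
move=> pj; have := allP points_classes _ pj; simpl fst; simpl snd; rewrite eqxx.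
move=> /hasP[k]; rewrite mem_iota => k3 /eqP->; exists (Ordinal (k3 : (k < 3)%N)).
exact: pval_vertex.
Qed.

Lemma cube_roots_code (w : K) : w ^+ 3 = 1 -> exists2 a, a \in [:: e1; et; et2] & w = eis_val tau a.
Proof.
move=> /(cube_roots tau_eq); rewrite !inE => /or3P[] /eqP->.
- by exists e1; rewrite ?inE ?eqxx // eis_val1.
- by exists et; rewrite ?inE ?eqxx // (idx_s_val tau_eq IdxTau).
- by exists et2; rewrite ?inE ?eqxx ?orbT // (idx_s_val tau_eq IdxTau2).
Qed.

Lemma equal_cubes_point (p : 'rV[K]_3) : p != 0 ->
  p 0 ix ^+ 3 = p 0 iy ^+ 3 -> p 0 iz ^+ 3 = p 0 iy ^+ 3 ->
  exists2 u, u \in points & same_point p (point_val tau u.1).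
Proof.
move=> p0 exy ezy.
have px : p 0 ix != 0.
  apply: contraNneq p0 => px; apply/eqP/rowP => i; rewrite [RHS]mxE.
  have /eqP py : p 0 iy ^+ 3 == 0 by rewrite -exy px expr0n.
  apply/eqP; suff : p 0 i ^+ 3 == 0 by rewrite expf_eq0.
  have /or3P[] : [|| i == ix, i == iy | i == iz] by case: i => [[|[|[|i]]] hi].
  - by move/eqP->; rewrite exy py.
  - by move/eqP->; rewrite py.
  - by move/eqP->; rewrite ezy py.
have root i : p 0 i ^+ 3 = p 0 ix ^+ 3 -> (p 0 i / p 0 ix) ^+ 3 = 1.
  by move=> e; rewrite exprMn e -exprMn divff // expr1n.
have [a ha ea] := cube_roots_code (root iy (esym exy)).
have [b hb eb] := cube_roots_code (root iz (etrans ezy (esym exy))).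
have /allP/(_ b hb)/hasP[u uP /eqP eu] := allP points_cube_roots a ha.
exists u => //; exists (p 0 ix) => //; apply/rowP => i; rewrite [RHS]mxE point_valE eu.
have /or3P[] : [|| i == ix, i == iy | i == iz] by case: i => [[|[|[|i]]] hi].
- by move/eqP->; rewrite /= eis_val1 mulr1.
- by move/eqP->; rewrite /= -ea mulrC divfK.
- by move/eqP->; rewrite /= -eb mulrC divfK.
Qed.

(** The factors [a] and [b] make room for the scalars that appear when this pencil is carried to
    F_1. *)
Lemma good_cubics (a b : K) : a != 0 -> b != 0 ->
  good (a *: (y ^+ 3 - x ^+ 3), b *: (y ^+ 3 - z ^+ 3)) 3 (config tau (start_mult StartInf)).
Proof.
move=> a0 b0.
have e1 : a *: (y ^+ 3 - x ^+ 3) = diagonal_cubic (- a) a 0.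
  by rewrite /diagonal_cubic scale0r addr0 scaleNr scalerBr addrC.
have e2 : b *: (y ^+ 3 - z ^+ 3) = diagonal_cubic 0 b (- b).
  by rewrite /diagonal_cubic scale0r add0r scaleNr scalerBr.
rewrite e1 e2; set P := (_, _).
have elemE c1 c2 : elem P c1 c2 = diagonal_cubic (- (c1 * a)) (c1 * a + c2 * b) (- (c2 * b)).
  rewrite /elem /P /diagonal_cubic; simpl fst; simpl snd.
  by rewrite -!mul_mpolyC mpolyC0 !(mpolyCN, mpolyCD) !mpolyCM; ring.
have three : 3%:R != 0 :> K by rewrite pnatr_eq0.
(* The three excluded elements are those in which a coefficient of the diagonal cubic vanishes, that
   is, the triples of concurrent lines. *)
have nonzero : generically (fun c1 c2 : K => [/\ - (c1 * a) != 0, c1 * a + c2 * b != 0 & - (c2 * b) != 0]).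
  exists [:: (0, 1); (1, 0); (- b, a)] => [|c1 c2 _ h].
    by rewrite !inE !xpair_eqE !(eq_sym 0) (negPf a0) oner_eq0 !andbF.
  have := h (0, 1); have := h (1, 0); have := h (- b, a); rewrite !inE !eqxx !orbT /=.
  rewrite !mulr0 !mulr1 => /(_ isT) h1 /(_ isT) h2 /(_ isT) h3; split.
  - by rewrite oppr_eq0 mulf_neq0.
  - by apply: contraNneq h1 => /eqP; rewrite addr_eq0 mulrN.
  - by rewrite oppr_eq0 mulf_neq0 // eq_sym.
split.
- by split; apply: diagonal_homog.
- move=> c1 c2 E0.
  have ev (i : 'I_3) := congr1 (meval (fun j => (j == i)%:R)) E0.
  have := ev ix; have := ev iz; rewrite elemE !diagonal_eval !meval0 /= !expr1n !expr0n /=.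
  rewrite !mulr0 !mulr1 !addr0 ?add0r => /eqP; rewrite oppr_eq0 mulf_eq0 (negPf b0) orbF => /eqP->.
  by move/eqP; rewrite oppr_eq0 mulf_eq0 (negPf a0) orbF => /eqP->.
- move=> p p0 /=; rewrite !diagonal_eval !mul0r add0r addr0 => /eqP.
  rewrite mulNr addrC subr_eq0 (inj_eq (mulfI a0)) => /eqP exy /eqP.
  rewrite mulNr subr_eq0 (inj_eq (mulfI b0)) => /eqP eyz.
  have [u uP pu] := equal_cubes_point p0 (esym exy) (esym eyz).
  exists (point_val tau u.1, start_mult StartInf u.2) => //.
  by apply/configP; exists u.1, u.2; rewrite -surjective_pairing.
- move=> u /configP[p [j [pj ->]]] /=; apply: (point_val_neq0 tau_eq).
  by case/and5P: (step_okP Idx1) => _ _ /allP/(_ _ pj).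
- move=> u /configP[p [j [pj ->]]]; simpl fst; simpl snd.
  have [->|jInf] := eqVneq j IdxInf; first by [].
  have -> : start_mult StartInf j = 1%N by case: j jInf {pj}.
  by split; split=> //; rewrite diagonal_eval !(point_cube _ pj jInf); ring.
- move=> u /configP[p [j [pj ->]]] v; simpl fst; simpl snd.
  (* At multiplicity 0 the leading form is the value, so the clause says that a vertex is not a base
     point. *)
  have [j_Inf|jInf] := eqVneq j IdxInf.
    rewrite j_Inf in pj *; have [k ek] := point_vertex pj.
    rewrite /start_mult /= !diagonal_eval ek !vertexE.
    by case: k {ek} => [[|[|[|k]]] hk] //=;
      rewrite !expr1n !expr0n /= !mulr0 !mulr1 ?addr0 ?add0r => /eqP h1 /eqP h2;
      move: h1 h2; rewrite ?oppr_eq0 ?(negPf a0) ?(negPf b0).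
  have -> : start_mult StartInf j = 1%N by case: j jInf {pj}.
  have cube i := point_cube i pj jInf; move: cube; set q := point_val tau p 0 => cube.
  have lead (c d e : K) : leading 1 q v (diagonal_cubic c d e) =
      3%:R * (c * (v ix * q ix ^+ 2) + (d * (v iy * q iy ^+ 2) + e * (v iz * q iz ^+ 2))).
    by rewrite /= sum3 !diagonal_deriv /pt /=; ring.
  rewrite !lead !mul0r addr0 add0r => /eqP; rewrite mulf_eq0 (negPf three) /=.
  rewrite mulNr addrC subr_eq0 (inj_eq (mulfI a0)) => /eqP exy /eqP.
  rewrite mulf_eq0 (negPf three) /= mulNr subr_eq0 (inj_eq (mulfI b0)) => /eqP eyz.
  (* Both leading forms vanish only if the [v i * q i ^+ 2] are all equal; since [q i ^+ 3 = 1],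
     their common value is the factor. *)
  exists (v iy * q iy ^+ 2) => i.
  have -> : v iy * q iy ^+ 2 = v i * q i ^+ 2.
    have /or3P[] : [|| i == ix, i == iy | i == iz] by case: i => [[|[|[|i]]] hi].
    - by move/eqP->.
    - by move/eqP->.
    - by move/eqP->.
  by rewrite -mulrA -exprSr cube mulr1.
- apply: genericallyW nonzero => c1 c2 [n1 n2 n3] p p0 /order_geSP[_ h].
  exfalso; move/eqP: p0; apply; apply/rowP => i; rewrite [RHS]mxE.
  have [] := h i; rewrite elemE diagonal_deriv => /eqP; rewrite mulf_eq0 (negPf three) /=.
  rewrite mulf_eq0 expf_eq0 /= => /orP[|/eqP//].
  by case: i => [[|[|[|i]]] hi]; rewrite // /pt /= ?(negPf n1) ?(negPf n2) ?(negPf n3).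
- apply: genericallyW nonzero => c1 c2 [n1 n2 n3]; rewrite elemE.
  exact: diagonal_cubic_genus.
Qed.

End Cubics.

Definition start_code (s : start) : poly_code * poly_code :=
  let n := eopp e1 in let nt := eopp et in let nt2 := eopp et2 in
  let cubic a b c := pc_mul (pc_mul (pc_linear a) (pc_linear b)) (pc_linear c) in
  match s with
  | Start1 => (cubic (n, e1, e0) (n, e0, e1) (e0, e1, n),
               cubic (nt, e1, e0) (nt2, e0, e1) (e0, nt, e1))
  | StartInf => (cubic (n, e1, e0) (nt, e1, e0) (nt2, e1, e0),
                 cubic (e0, e1, n) (e0, e1, nt) (e0, e1, nt2))
  end.

Definition pc_wronskian (k : nat) (P : poly_code * poly_code) : poly_code :=
  pc_mul P.1 (pc_deriv k P.2) ++ pc_scale (eopp e1) (pc_mul P.2 (pc_deriv k P.1)).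

Definition start_form_code (s : start) (k : nat) : poly_code :=
  if s is Start1 then omega_code k ++ xi_code k else xi_code k.

Lemma start_wronskian (s : start) (k : nat) : (k < 3)%N ->
  pc_eq (pc_wronskian k (start_code s))
    (pc_scale (if s is Start1 then (1, -1) else (-3, 0)) (start_form_code s k)).
Proof. by case: k => [|[|[|k]]] k3; last discriminate k3; case: s; vm_compute. Qed.

Definition cubes_code (b : bool) : poly_code :=
  if b then [:: (e1, (0, 3, 0)%N); (eopp e1, (3, 0, 0)%N)]
  else [:: (e1, (0, 3, 0)%N); (eopp e1, (0, 0, 3)%N)].

Lemma start_code_inf : pc_eq (start_code StartInf).1 (cubes_code true) &&
  pc_eq (start_code StartInf).2 (cubes_code false).
Proof. by vm_compute. Qed.

(* The discrete Fourier transform carries the pencil F_infinity to F_1. *)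
Definition fourier : mat_code := ((e1, et2, et), (e1, et, et2), (e1, e1, e1)).
Definition fourier_inv : mat_code := ((e1, e1, e1), (et, et2, e1), (et2, et, e1)).

Lemma start_code_fourier :
  pc_eq (pc_map fourier (cubes_code true)) (pc_scale (3, 6) (start_code Start1).1) &&
  pc_eq (pc_map fourier (cubes_code false)) (pc_scale (-6, -3) (start_code Start1).2).
Proof. by vm_compute. Qed.

(** The Fourier matrix permutes the twelve points and takes the class of index 1 to the vertices,
    which matches the two multiplicity functions of [start_mult]. *)
Lemma fourier_ok : [&& mat_inverse_ok fourier fourier_inv,
  all (fun u => has (fun w => same_code (mat_app fourier w.1) u.1) points) points
  & all (fun w => has (fun u => ((u.2 == IdxInf) == (w.2 == Idx1)) &&
       same_code (mat_app fourier w.1) u.1) points) points].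
Proof. by vm_compute. Qed.

Section Starts.
Variables (K : numClosedFieldType) (tau : K).
Hypothesis tau_eq : tau ^+ 2 + tau + 1 = 0.
Local Notation x := (vx K).
Local Notation y := (vy K).
Local Notation z := (vz K).
Local Notation val := (poly_val tau).

Definition start_val (s : start) : pencil K := (val (start_code s).1, val (start_code s).2).

Lemma start_codeE (s : start) : start_val s = start_pencil tau s.
Proof.
have et_val : eis_val tau et = tau := idx_s_val tau_eq IdxTau.
have et2_val : eis_val tau et2 = tau ^+ 2 := idx_s_val tau_eq IdxTau2.
have zero_val : eis_val tau e0 = 0 by rewrite /eis_val mul0r addr0.
case: s; congr (_, _); rewrite !(poly_val_mul tau_eq) /pc_linear !poly_val_cons poly_val_nil;
  simpl fst; simpl snd; rewrite ?eis_valN ?et_val ?et2_val ?eis_val1 ?zero_val;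
  rewrite -!mul_mpolyC !mpolyCN ?mpolyC0 ?mpolyC1; ring.
Qed.

Lemma cubes_val : (val (cubes_code true), val (cubes_code false)) =
  (y ^+ 3 - x ^+ 3, y ^+ 3 - z ^+ 3).
Proof.
by congr (_, _); rewrite !poly_val_cons poly_val_nil; simpl fst; simpl snd;
  rewrite eis_valN eis_val1 !expr0 !mulr1 !mul1r addr0 scaleN1r scale1r.
Qed.

Lemma good_start (s : start) : good (start_val s) 3 (config tau (start_mult s)).
Proof.
have [cx cz] : val (cubes_code true) = y ^+ 3 - x ^+ 3 /\ val (cubes_code false) = y ^+ 3 - z ^+ 3.
  by case: cubes_val.
case: s; last first.
  have /andP[/(pc_eqP tau) ex /(pc_eqP tau) ez] := start_code_inf.
  rewrite /start_val ex ez cx cz -[_ - x ^+ 3]scale1r -[_ - z ^+ 3]scale1r.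
  by apply: good_cubics => //; apply: oner_neq0.
have /andP[/(pc_eqP tau) ex /(pc_eqP tau) ez] := start_code_fourier.
have /and3P[inv /allP ok1 /allP ok2] := fourier_ok.
have a0 : eis_val tau (3, 6) != 0 by rewrite (eis_val_eq0 tau_eq).
have b0 : eis_val tau (-6, -3) != 0 by rewrite (eis_val_eq0 tau_eq).
have three : 3%:R != 0 :> K by rewrite pnatr_eq0.
move: ex ez; rewrite !(poly_val_pc_map tau_eq) !(poly_val_scale tau_eq) cx cz => ex ez.
have gC := good_cubics tau_eq (invr_neq0 a0) (invr_neq0 b0).
have -> : start_val Start1 =
    (((eis_val tau (3, 6))^-1 *: (y ^+ 3 - x ^+ 3)) \mPo linear_map (mat_val tau fourier),
     ((eis_val tau (-6, -3))^-1 *: (y ^+ 3 - z ^+ 3)) \mPo linear_map (mat_val tau fourier)).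
  by rewrite !comp_mpolyZ ex ez !scalerA !mulVf // !scale1r.
apply: (good_linear gC (mat_val_mul tau_eq inv) three).
- move=> u /configP[p [j [pj ->]]] /=; apply: (point_val_neq0 tau_eq).
  by case/and5P: (step_okP Idx1) => _ _ /allP/(_ _ pj).
- move=> u /configP[p [j [pj ->]]]; have /hasP[[q k] qk /=] := ok1 _ pj.
  move=> /(same_code_val tau_eq); rewrite (point_val_app tau_eq) => h.
  by exists (point_val tau q, start_mult Start1 k) => //; apply/configP; exists q, k.
- move=> u /configP[p [j [pj ->]]]; have /hasP[[q k] qk /andP[/= /eqP kj]] := ok2 _ pj.
  move=> /(same_code_val tau_eq); rewrite (point_val_app tau_eq) => h.
  exists (point_val tau q, start_mult StartInf k); first by apply/configP; exists q, k.
  by split=> //=; case: j k kj {pj qk} => -[].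
Qed.

Lemma start_state (s : start) :
  pencil_state tau (start_param K s) (start_val s) 3 (start_mult s).
Proof.
split; first exact: good_start.
exists (eis_val tau (if s is Start1 then (1, -1) else (-3, 0)))%:MP => i.
have := pc_eqP tau (start_wronskian s (ltn_ord i)).
rewrite poly_val_cat !(poly_val_scale tau_eq) !(poly_val_mul tau_eq) !(poly_val_deriv tau_eq).
rewrite eis_valN eis_val1 scaleN1r mul_mpolyC => ->; congr (_ *: _).
case: s => /=; last exact: xi_codeE.
by rewrite poly_val_cat omega_codeE xi_codeE tnth_mktuple scale1r.
Qed.

Lemma state_pencil (t : option K) (P : pencil K) d mu :
  pencil_state tau t P d mu ->
  [/\ is_pencil_of (lins_neto t) P, generic_degree P d & elliptic P].
Proof.
case=> gP wP; split; last exact: good_elliptic gP; last exact: good_degree gP.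
split=> //; first by exists d; apply: good_homog gP.
- exact: good_no_common_factor gP.
- exact: good_irreducible gP.
Qed.

End Starts.

(** * The algorithm *)

(* A word: whether the start is F_1, and the indices in reverse order. *)
Definition word := (bool * seq cremona_index)%type.

Definition word_start (b : bool) : start := if b then Start1 else StartInf.

Definition append (i : cremona_index) (w : word) : word := (w.1, i :: w.2).

(* The map of index s sends the parameter t to - t - s, so the maps of indices
   s and s' compose to the translation by s - s'. *)
Definition translate (i j : cremona_index) (w : word) : word := append j (append i w).

Definition translate_by_3 (w : word) : word :=
  translate Idx1 IdxTau2 (translate Idx1 IdxTau w).

(** The state holds words for [k], [k + 1] and [k + 2], because the translations at hand are by 3.
    At the start, 0 is the image of infinity, 1 is F_1 itself, and 2 is [-1 + 3], where -1 is the
    image of 0 under the map of index 1. *)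
Definition word_nat (k : nat) : word :=
  (nat_rect (fun=> (word * word * word)%type)
    ((false, [:: IdxInf]), (true, [::]), translate_by_3 (false, [:: Idx1; IdxInf]))
    (fun _ W => (W.1.2, W.2, translate_by_3 W.1.1)) k).1.1.

(** [Negz j] stands for [- j - 1], the image of [j] under the map of index 1. *)
Definition word_int (k : int) : word :=
  match k with Posz j => word_nat j | Negz j => append Idx1 (word_nat j) end.

(** [m + n tau = (m + n) + n (tau - 1)], and the maps of indices tau and 1 in this order translate
    by [tau - 1]. The case [Negz j] takes [j + 1] translations in the opposite direction. *)
Definition word_of (mn : int * int) : word :=
  let w := word_int (mn.1 + mn.2) in
  match mn.2 with
  | Posz j => nat_rect (fun=> word) w (fun _ => translate IdxTau Idx1) j
  | Negz j => nat_rect (fun=> word) w (fun _ => translate Idx1 IdxTau) j.+1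
  end.

(** A table instead of a function of the index, as the values handled by the algorithm must be
    data. *)
Definition mults := (nat * nat * nat * nat)%type.

Definition mult_of (q : mults) (i : cremona_index) : nat :=
  match i with Idx1 => q.1.1.1 | IdxTau => q.1.1.2 | IdxTau2 => q.1.2 | IdxInf => q.2 end.

Definition make_mults (mu : cremona_index -> nat) : mults :=
  (mu Idx1, mu IdxTau, mu IdxTau2, mu IdxInf).

(* The generators, the degree and the multiplicities of a pencil. *)
Definition pencil_code := (poly_code * poly_code * nat * mults)%type.

Definition start_pencil_code (b : bool) : pencil_code :=
  let s := word_start b in
  ((start_code s).1, (start_code s).2, 3%N, make_mults (start_mult s)).

Definition step_code (i : cremona_index) (c : pencil_code) : pencil_code :=
  let mu := mult_of c.2 in let d := c.1.2 in
  (pc_step i (mu i) c.1.1.1, pc_step i (mu i) c.1.1.2, (2 * d - 3 * mu i)%N,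
   make_mults (next_mult i d mu)).

Definition run (w : word) : pencil_code := foldr step_code (start_pencil_code w.1) w.2.

Definition algorithm (mn : int * int) : output :=
  let w := word_of mn in let c := run w in
  (word_start w.1, rev w.2, c.1.2,
   [seq (u.1, mult_of c.2 u.2) | u : point_code * cremona_index <- points],
   c.1.1.1, c.1.1.2).

Lemma mult_of_make mu : mult_of (make_mults mu) =1 mu.
Proof. by case. Qed.

Lemma points_distinct : pairwise (fun u w : point_code * cremona_index =>
  ~~ same_code u.1 w.1) points.
Proof. by vm_compute. Qed.

Lemma successive_rcons (I X : Type) (step : I -> X -> X -> Prop) x l y i z :
  successive step x l y -> step i y z -> successive step x (rcons l i) z.
Proof.
elim: l x => [|j l IH] x /= => [-> h|[x' h hl] hz]; first by exists z.
by exists x' => //; apply: IH.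
Qed.

Section Correctness.
Variables (K : numClosedFieldType) (tau : K).
Hypothesis tau_eq : tau ^+ 2 + tau + 1 = 0.
Local Notation val := (poly_val tau).

Fixpoint reaches (t0 : option K) (r : seq cremona_index) (t : option K) : Prop :=
  if r is i :: r' then
    exists t', [/\ reaches t0 r' t', admissible i t' & t = next_param tau i t']
  else t = t0.

Definition word_reaches (w : word) (t : K) : Prop :=
  reaches (start_param K (word_start w.1)) w.2 (Some t).

Lemma append_reaches i (w : word) t u : i != IdxInf -> u = - t - eis_val tau (idx_s i) ->
  word_reaches w t -> word_reaches (append i w) u.
Proof.
by move=> iInf -> h; exists (Some t); rewrite /admissible (negPf iInf).
Qed.

Lemma translate_reaches i j (w : word) t u : i != IdxInf -> j != IdxInf ->
  u = t + eis_val tau (idx_s i) - eis_val tau (idx_s j) ->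
  word_reaches w t -> word_reaches (translate i j w) u.
Proof.
move=> iInf jInf -> h; apply: (append_reaches jInf) (append_reaches iInf erefl h); ring.
Qed.

Lemma translate_by_3_reaches (w : word) t u : u = t + 3%:R ->
  word_reaches w t -> word_reaches (translate_by_3 w) u.
Proof.
move=> -> h; apply: translate_reaches (translate_reaches _ _ erefl h) => //.
rewrite !(idx_s_val tau_eq); apply/eqP; rewrite eq_sym -subr_eq0; apply/eqP.
by rewrite -[RHS]oppr0 -tau_eq; ring.
Qed.

Lemma word_nat_reaches k : word_reaches (word_nat k) k%:R.
Proof.
rewrite /word_nat; set W := nat_rect _ _ _ _.
suff [] : [/\ word_reaches W.1.1 k%:R, word_reaches W.1.2 k.+1%:R
  & word_reaches W.2 k.+2%:R] by [].
rewrite {}/W; elim: k => [|k [IH1 IH2 IH3]] /=; last first.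
  by split=> //; apply: translate_by_3_reaches IH1; rewrite -natrD addn3.
have w0 : word_reaches (false, [:: IdxInf]) 0 by exists None.
split=> //; apply: (@translate_by_3_reaches _ (-1)); first by ring.
by apply: append_reaches w0; rewrite // (idx_s_val tau_eq) oppr0 sub0r.
Qed.

Lemma word_of_reaches (m n : int) : word_reaches (word_of (m, n)) (m%:~R + n%:~R * tau).
Proof.
have wk (k : int) : word_reaches (word_int k) k%:~R.
  case: k => k; first exact: word_nat_reaches.
  apply: append_reaches (word_nat_reaches k) => //.
  by rewrite (idx_s_val tau_eq) NegzE rmorphN /= -pmulrn -natr1 opprD.
have {wk} h := wk (m + n).
have iterate i j (c : K) (w : word) (t : K) k : i != IdxInf -> j != IdxInf ->
    eis_val tau (idx_s i) - eis_val tau (idx_s j) = c -> word_reaches w t ->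
    word_reaches (nat_rect (fun=> word) w (fun _ => translate i j) k) (t + k%:R * c).
  move=> iInf jInf <- hw; elim: k => [|k IH] /=; first by rewrite mul0r addr0.
  by apply: (translate_reaches iInf jInf _ IH); rewrite -natr1; ring.
rewrite /word_of; simpl fst; simpl snd; case: n h => n h.
  have := iterate IdxTau Idx1 (tau - 1) _ _ n isT isT _ h.
  rewrite !(idx_s_val tau_eq) => /(_ erefl); congr word_reaches.
  by rewrite rmorphD /= -pmulrn; ring.
have := iterate Idx1 IdxTau (1 - tau) _ _ n.+1 isT isT _ h.
rewrite !(idx_s_val tau_eq) => /(_ erefl); congr word_reaches.
by rewrite rmorphD NegzE rmorphN /= -pmulrn; ring.
Qed.

Definition code_pencil (c : pencil_code) : pencil K := (val c.1.1.1, val c.1.1.2).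

Lemma config_ext mu mu' : mu =1 mu' -> config tau mu = config tau mu'.
Proof. by move=> e; apply: eq_map => u; rewrite e. Qed.

Lemma run_correct (w : word) (t : option K) :
  let s := word_start w.1 in let c := run w in
  reaches (start_param K s) w.2 t ->
  [/\ successive (fun i => strict_transform_form (cremona tau i))
        (lins_neto (start_param K s)) (rev w.2) (lins_neto t),
      successive (fun i => strict_transform_pencil (cremona tau i))
        (start_pencil tau s) (rev w.2) (code_pencil c)
    & pencil_state tau t (code_pencil c) c.1.2 (mult_of c.2)].
Proof.
case: w => b r /=; rewrite /run /=; elim: r t => [|i r IH] t /=.
  move=> ->; split=> //; first by rewrite -(start_codeE tau_eq).
  have [gS wS] := start_state tau_eq (word_start b).
  by split=> //; rewrite (config_ext (mult_of_make _)).
case=> t' [/IH]; move: (foldr _ _ _) => [[[F G] d] q] [hf hp hs] adm ->.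
have [sf sp [gN wN]] := state_step tau_eq adm hs.
rewrite rev_cons; split.
- exact: successive_rcons hf sf.
- exact: successive_rcons hp sp.
- by split=> //=; rewrite (config_ext (mult_of_make _)).
Qed.

(** All twelve points are listed, including those of multiplicity at most one, since the condition
    on the list concerns [1 < r]. *)
Lemma state_singularities (t : option K) (P : pencil K) d mu :
  pencil_state tau t P d mu ->
  generic_singularities P (sing_val tau [seq (u.1, mu u.2) | u : point_code * cremona_index <- points]).
Proof.
case=> gP _; have -> : sing_val tau [seq (u.1, mu u.2) | u : point_code * cremona_index <- points] =
    config tau mu by rewrite /sing_val -map_comp.
split; [exact: good_neq0 gP| |exact: good_multiplicities gP].
move=> i j u; rewrite size_map => /andP[ij jn].
have in_ := ltn_trans ij jn; pose u0 := ((e0, e0, e0), Idx1) : point_code * cremona_index.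
rewrite !(nth_map u0) //=.
have pt_ok k : (k < size points)%N -> is_point (nth u0 points k).1.
  by move=> kn; case/and5P: (step_okP Idx1) => _ _ /allP/(_ _ (mem_nth u0 kn)).
rewrite -(same_codeP tau_eq (pt_ok _ in_) (pt_ok _ jn)); apply/negP.
by have /(pairwiseP u0)/(_ i j in_ jn ij) := points_distinct.
Qed.

End Correctness.

(** * Computability of the algorithm *)


Lemma computable_comp A B C (F : B -> C) (f : A -> B) :
  computable F -> computable f -> computable (fun a => F (f a)).
Proof. by move=> cF cf; apply: CompComp cf cF. Qed.

Lemma computable_comp2 A B C D (F : B -> C -> D) (f : A -> B) (g : A -> C) :
  computable (fun p : B * C => F p.1 p.2) -> computable f -> computable g ->
  computable (fun a => F (f a) (g a)).
Proof. by move=> cF cf cg; apply: CompComp (CompPair cf cg) cF. Qed.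

Lemma computable_fst A B C (f : A -> B * C) : computable f -> computable (fun a => (f a).1).
Proof. by move=> cf; apply: CompComp cf (CompFst _ _). Qed.

Lemma computable_snd A B C (f : A -> B * C) : computable f -> computable (fun a => (f a).2).
Proof. by move=> cf; apply: CompComp cf (CompSnd _ _). Qed.

Lemma computable_nat_rect A B (f : A -> B) (g : A -> nat -> B -> B) (n : A -> nat) :
  computable f -> computable (fun p : A * nat * B => g p.1.1 p.1.2 p.2) -> computable n ->
  computable (fun a => nat_rect (fun=> B) (f a) (fun k b => g a k b) (n a)).
Proof.
by move=> cf cg cn; have := CompComp (CompPair (CompId A) cn) (CompNatRec cf cg).
Qed.

Lemma computable_foldr A B T (f : A -> B) (g : A -> T -> B -> B) (s : A -> seq T) :
  computable f -> computable (fun p : A * T * B => g p.1.1 p.1.2 p.2) -> computable s ->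
  computable (fun a => foldr (fun u b => g a u b) (f a) (s a)).
Proof.
move=> cf cg cs.
have cg' : computable (fun p : A * T * seq T * B => g p.1.1.1 p.1.1.2 p.2).
  apply: (CompComp (f := fun p : A * T * seq T * B => (p.1.1.1, p.1.1.2, p.2)) _ cg).
  have c1 := computable_fst (CompFst (A * T * seq T) B).
  exact: CompPair (CompPair (computable_fst c1) (computable_snd c1)) (CompSnd _ _).
apply: CompExt (CompComp (CompPair (CompId A) cs) (CompSeqRec cf cg')) => a /=.
by elim: (s a) => [//|u r /= ->].
Qed.

Lemma computable_cons A T (f : A -> T) (s : A -> seq T) :
  computable f -> computable s -> computable (fun a => f a :: s a).
Proof. by move=> cf cs; apply: CompComp (CompPair cf cs) (CompCons _). Qed.

Lemma computable_int_case A B (g h : A -> nat -> B) (n : A -> int) :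
  computable (fun p : A * nat => g p.1 p.2) -> computable (fun p : A * nat => h p.1 p.2) ->
  computable n ->
  computable (fun a => match n a with Posz k => g a k | Negz k => h a k end).
Proof.
by move=> cg ch cn; have := CompComp (CompPair (CompId A) cn) (CompIntCase cg ch).
Qed.

Lemma computable_index A B (F : cremona_index -> A -> B) (i : A -> cremona_index) :
  (forall j, computable (F j)) -> computable i -> computable (fun a => F (i a) a).
Proof.
by move=> cF ci; have := CompComp (CompPair ci (CompId A)) (CompIndex cF).
Qed.

Ltac comp_step :=
  first [ assumption
        | apply CompId | apply CompConst | apply CompPair | apply CompIf
        | apply computable_fst | apply computable_snd | apply computable_cons
        | apply computable_nat_rect | apply computable_foldr | apply computable_int_case
        | apply (computable_comp CompSucc) | apply (computable_comp CompPosz)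
        | apply (computable_comp CompNegz) ].
Ltac comp := repeat comp_step.

Lemma computable_addn A (f g : A -> nat) : computable f -> computable g ->
  computable (fun a => f a + g a)%N.
Proof.
move=> cf cg; apply: (CompExt (f := fun a => nat_rect (fun=> nat) (f a) (fun _ b => b.+1) (g a))).
  by move=> a; elim: (g a) => [|k /= ->]; rewrite ?addn0 ?addnS.
comp.
Qed.

Lemma computable_predn A (f : A -> nat) : computable f -> computable (fun a => (f a).-1).
Proof.
move=> cf; apply: (CompExt (f := fun a => nat_rect (fun=> nat) 0%N (fun k _ => k) (f a))).
  by move=> a; case: (f a).
comp.
Qed.

Lemma computable_subn A (f g : A -> nat) : computable f -> computable g ->
  computable (fun a => f a - g a)%N.
Proof.
move=> cf cg; apply: (CompExt (f := fun a => nat_rect (fun=> nat) (f a) (fun _ b => b.-1) (g a))).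
  by move=> a; elim: (g a) => [|k /= ->]; rewrite ?subn0 ?subnS.
comp; apply: computable_predn; comp.
Qed.

Lemma computable_muln A (f g : A -> nat) : computable f -> computable g ->
  computable (fun a => f a * g a)%N.
Proof.
move=> cf cg; apply: (CompExt (f := fun a => nat_rect (fun=> nat) 0%N (fun _ b => f a + b)%N (g a))).
  by move=> a; elim: (g a) => [|k /= ->]; rewrite ?muln0 ?mulnS.
comp; apply: computable_addn; comp; apply: (computable_comp cf); comp.
Qed.

Lemma computable_leq A (f g : A -> nat) : computable f -> computable g ->
  computable (fun a => f a <= g a)%N.
Proof.
move=> cf cg.
apply: (CompExt (f := fun a => nat_rect (fun=> bool) true (fun _ _ => false) (f a - g a)%N)).
  by move=> a; rewrite /leq; case: (_ - _)%N.
comp; exact: computable_subn.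
Qed.

Ltac comp_nat_step := first [
    apply computable_addn | apply computable_subn | apply computable_muln
  | apply computable_leq | apply computable_predn | comp_step ].
Ltac comp_nat := repeat comp_nat_step.

Lemma computable_oppz A (f : A -> int) : computable f -> computable (fun a => - f a).
Proof.
move=> cf; apply: (CompExt (f := fun a => match f a with
  | Posz k => nat_rect (fun=> int) (Posz 0) (fun j _ => Negz j) k
  | Negz k => Posz k.+1 end)).
  by move=> a; case: (f a) => [[]|].
comp.
Qed.

Lemma computable_addz A (f g : A -> int) : computable f -> computable g ->
  computable (fun a => f a + g a).
Proof.
apply: computable_comp2.
apply: (CompExt (f := fun p : int * int => match p.1 with
  | Posz i => match p.2 with
    | Posz j => Posz (i + j)
    | Negz j => if (j.+1 <= i)%N then Posz (i - j.+1) else Negz (j - i) end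
  | Negz i => match p.2 with
    | Posz j => if (i.+1 <= j)%N then Posz (j - i.+1) else Negz (i - j)
    | Negz j => Negz (i + j).+1 end end)); last by comp_nat.
by case=> -[i|i] [j|j].
Qed.

Lemma computable_mulz A (f g : A -> int) : computable f -> computable g ->
  computable (fun a => f a * g a).
Proof.
apply: computable_comp2.
apply: (CompExt (f := fun p : int * int => match p.1 with
  | Posz i => match p.2 with
    | Posz j => Posz (i * j)
    | Negz j => - Posz (i * j.+1) end
  | Negz i => match p.2 with
    | Posz j => - Posz (i.+1 * j)
    | Negz j => Posz (i.+1 * j.+1) end end)).
  by case=> -[i|i] [j|j] /=; rewrite ?NegzE ?mulrN ?mulNr ?opprK -?PoszM.
by do ?[apply: computable_oppz | comp_nat_step].
Qed.

Ltac comp_int_step := first [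
    apply computable_oppz | apply computable_addz | apply computable_mulz | comp_nat_step ].
Ltac comp_int := repeat comp_int_step.

Lemma computable_cat A T (f g : A -> seq T) : computable f -> computable g ->
  computable (fun a => f a ++ g a).
Proof.
move=> cf cg; apply: (CompExt (f := fun a => foldr (fun u r => u :: r) (g a) (f a))).
  by move=> a; elim: (f a) => //= u r ->.
comp.
Qed.

Lemma computable_rev A T (f : A -> seq T) : computable f -> computable (fun a => rev (f a)).
Proof.
move=> cf; apply: (CompExt (f := fun a => foldr (fun u r => r ++ [:: u]) [::] (f a))).
  by move=> a; elim: (f a) => //= u r ->; rewrite rev_cons cats1.
comp; apply: computable_cat; comp.
Qed.

Lemma computable_map A S T (g : A -> S -> T) (f : A -> seq S) :
  computable (fun p : A * S => g p.1 p.2) -> computable f ->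
  computable (fun a => map (g a) (f a)).
Proof.
move=> cg cf; apply: (CompExt (f := fun a => foldr (fun u r => g a u :: r) [::] (f a))).
  by move=> a; elim: (f a) => //= u r ->.
comp; apply: (computable_comp2 cg); comp.
Qed.

Lemma computable_pc_mul A (f g : A -> poly_code) : computable f -> computable g ->
  computable (fun a => pc_mul (f a) (g a)).
Proof.
apply: computable_comp2; rewrite /pc_mul; comp; apply: computable_cat; comp.
by apply: computable_map; rewrite /tc_mul /emul; comp_int.
Qed.

Lemma computable_pc_const A (f : A -> eisenstein) : computable f ->
  computable (fun a => pc_const (f a)).
Proof. by move=> cf; rewrite /pc_const; comp. Qed.

Lemma computable_pc_exp A (f : A -> poly_code) (n : A -> nat) :
  computable f -> computable n -> computable (fun a => pc_exp (f a) (n a)).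
Proof.
by apply: computable_comp2; rewrite /pc_exp; do ?[apply computable_pc_mul | comp_step].
Qed.

Lemma computable_pc_linear A (f : A -> point_code) : computable f ->
  computable (fun a => pc_linear (f a)).
Proof. by move=> cf; rewrite /pc_linear; comp. Qed.

Lemma computable_pc_map A (M : A -> mat_code) (f : A -> poly_code) :
  computable M -> computable f -> computable (fun a => pc_map (M a) (f a)).
Proof.
apply: computable_comp2; rewrite /pc_map /pc_subst.
by do ?[apply computable_pc_mul | apply computable_pc_const
  | apply computable_pc_exp | apply computable_pc_linear | apply computable_cat | comp_step].
Qed.

Lemma computable_pc_std A (n : A -> nat) (f : A -> poly_code) :
  computable n -> computable f -> computable (fun a => pc_std (n a) (f a)).
Proof.
apply: computable_comp2; rewrite /pc_std /tc_std.
by do ?[apply computable_cat | comp_nat_step].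
Qed.

(** For a fixed index the matrices are constants; the dependence on the index is treated by cases in
    [computable_step_code]. *)
Lemma computable_pc_step i A (n : A -> nat) (f : A -> poly_code) :
  computable n -> computable f -> computable (fun a => pc_step i (n a) (f a)).
Proof.
move=> cn cf; apply: computable_pc_map (CompConst _ _) _.
by apply: computable_pc_std cn _; apply: computable_pc_map (CompConst _ _) cf.
Qed.

Lemma computable_step_code A (i : A -> cremona_index) (c : A -> pencil_code) :
  computable i -> computable c -> computable (fun a => step_code (i a) (c a)).
Proof.
apply: computable_comp2.
apply: (computable_index (F := fun i (p : cremona_index * pencil_code) => step_code i p.2)) (CompFst _ _).
by case; rewrite /step_code /make_mults /next_mult /mult_of /=;
  do ?[apply computable_pc_step | comp_nat_step].
Qed.

Lemma computable_run A (w : A -> word) : computable w -> computable (fun a => run (w a)).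
Proof.
move=> cw; apply: computable_foldr; [|by apply: computable_step_code; comp|by comp].
apply: (CompExt (f := fun a => if (w a).1 then start_pencil_code true else start_pencil_code false)).
  by move=> a; case: (w a).1.
comp.
Qed.

Lemma computable_append i A (w : A -> word) : computable w ->
  computable (fun a => append i (w a)).
Proof. by move=> cw; rewrite /append; comp. Qed.

Lemma computable_translate i j A (w : A -> word) : computable w ->
  computable (fun a => translate i j (w a)).
Proof. by move=> cw; do 2!apply: computable_append. Qed.

Lemma computable_word_nat A (k : A -> nat) : computable k ->
  computable (fun a => word_nat (k a)).
Proof.
by move=> ck; rewrite /word_nat /translate_by_3; do ?[apply computable_translate | comp_step].
Qed.

Lemma computable_word_int A (k : A -> int) : computable k ->
  computable (fun a => word_int (k a)).
Proof.
by move=> ck; rewrite /word_int;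
  do ?[apply computable_append | apply computable_word_nat | comp_step].
Qed.

Lemma computable_iter_translate i j A (w : A -> word) (n : A -> nat) :
  computable w -> computable n ->
  computable (fun a => nat_rect (fun=> word) (w a) (fun _ => translate i j) (n a)).
Proof.
move=> cw cn; apply: computable_nat_rect cw _ cn.
by apply: computable_translate; comp.
Qed.

Lemma computable_word_of : computable word_of.
Proof.
rewrite /word_of.
by do ?[apply computable_iter_translate | apply computable_word_int | comp_int_step].
Qed.

Lemma computable_algorithm : computable algorithm.
Proof.
have cr := computable_run computable_word_of; have cw := computable_word_of.
have cs : computable (fun mn => word_start (word_of mn).1).
  by rewrite /word_start; comp.
by rewrite /algorithm; do ?[apply computable_rev | comp_step].
Qed.

(** * The primitive cube root of unity *)

Section CubeRootOfUnity.
Variable R : realType.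
Import trigo.

(** As [3 a = 2 pi], the triple angle formula makes [cos a] a root of
    [4 c^3 - 3 c - 1 = (c - 1) (2 c + 1)^2]; since [cos a < 1], it equals -1/2. *)
Lemma tau_root : tau R ^+ 2 + tau R + 1 = 0.
Proof.
set a : R := 2 * pi / 3.
have a3 : a + a + a = pi *+ 2 by rewrite /a mulr2n; field.
have c3 : 4 * cos a ^+ 3 - 3 * cos a = 1.
  have := cos2pi R; rewrite -a3 cosD cosD sinD => e.
  have s2 : sin a ^+ 2 = 1 - cos a ^+ 2 by rewrite -(cos2Dsin2 a) addrAC subrr add0r.
  apply: etrans e; transitivity (cos a ^+ 3 - 3 * cos a * (1 - cos a ^+ 2)); first by ring.
  by rewrite -s2; ring.
have c1 : cos a < 1.
  have -> : a = (pi / 3) *+ 2 by rewrite /a mulr2n; field.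
  have s0 : 0 < sin (pi / 3 : R).
    have pi0 := pi_gt0 R; apply: sin_gt0_pi; rewrite divr_gt0 //=.
    by rewrite ltr_pdivrMr // ltr_pMr // ltr1n.
  rewrite cos_mulr2n ltrBlDr -mulr2n ltr_pMn2r // -[ltRHS](cos2Dsin2 (pi / 3)).
  by rewrite ltrDl exprn_gt0.
have ca : cos a = - 2^-1.
  have /eqP : (cos a - 1) * (2 * cos a + 1) ^+ 2 = 0.
    by transitivity (4 * cos a ^+ 3 - 3 * cos a - 1); [ring|rewrite c3 subrr].
  rewrite mulf_eq0 subr_eq0 (lt_eqF c1) expf_eq0 /= => /eqP h.
  apply: (mulfI (x := 2)); first by rewrite pnatr_eq0.
  by rewrite mulrN divff ?pnatr_eq0 //; apply/eqP; rewrite -addr_eq0 h.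
have s2 : sin a ^+ 2 = 3 / 4.
  have -> : sin a ^+ 2 = 1 - cos a ^+ 2 by rewrite -(cos2Dsin2 a) addrAC subrr add0r.
  by rewrite ca; field.
apply/eqP; rewrite eq_complex /tau -/a expr2 /= ca; apply/andP; split; apply/eqP.
  by rewrite -[sin a * sin a]expr2 s2; field.
by field.
Qed.

End CubeRootOfUnity.

Theorem theorem1 (R : realType) :
  let tau : R[i] := tau R in
  (* the displayed pencils are the elliptic pencils of cubics F_1, F_infinity *)
  (forall s : start,
     [/\ is_pencil_of (lins_neto (start_param _ s)) (start_pencil tau s),
         generic_degree (start_pencil tau s) 3
       & elliptic (start_pencil tau s)]) /\
  exists alg : int * int -> output,
    computable alg /\
    forall m n : int,
      let t : R[i] := m%:~R + n%:~R * tau in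
      let: (s, l, d, sings, F, G) := alg (m, n) in
      let P := (poly_val tau F, poly_val tau G) in
      [/\ successive (fun i => strict_transform_form (cremona tau i))
            (lins_neto (start_param _ s)) l (lins_neto (Some t)),
          successive (fun i => strict_transform_pencil (cremona tau i))
            (start_pencil tau s) l P,
          is_pencil_of (lins_neto (Some t)) P /\ elliptic P,
          generic_degree P d
        & generic_singularities P (sing_val tau sings)].
Proof.
move=> tau; have tau_eq : tau ^+ 2 + tau + 1 = 0 := tau_root R.
split=> [s|].
  by rewrite -(start_codeE tau_eq); apply: (state_pencil (start_state tau_eq s)).
exists algorithm; split=> [|m n t]; first exact: computable_algorithm.
have [hf hp hs] := run_correct tau_eq (word_of_reaches tau_eq m n).
have [isP dP eP] := state_pencil hs.
by split=> //; exact: (state_singularities tau_eq hs).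
Qed.
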